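(* Let $n \geq 2$ and let $p$ be a prime number. Fix $b_n \in \mathbb{Z}_p^{\times}$ and let \[ V_n(\mathbb{Z}_p)_{a_n = b_n} = \{f(x) = x^n + a_1 x^{n - 1} + \ldots + a_n \in \mathbb{Z}_p[x] : a_n = b_n\}. \] Then \begin{align*} P^{\mathrm{sqf}}(V_n(\mathbb{Z}_p)_{a_n = b_n}) &= \begin{cases} \dfrac{2}{3} \left(1 - \dfrac{(-1)^n}{2^n}\right) & \text{if } p = 2, \\ 1 - \dfrac{3p - 1}{p(p + 1)^2} + O\left(\dfrac{n}{p^{2 \lceil n/2 \rceil - 2}}\right) & \text{if } p \neq 2, \end{cases} \\ P^{\max}(V_n(\mathbb{Z}_p)_{a_n = b_n}) &= 1 - \frac{1}{p^2 + p + 1} + O\left(\frac{1}{p^{3 \lceil n/2 \rceil - 1}}\right), \end{align*} where the implied constants are absolute, and these densities are positive. The quantity $P^{\mathrm{sqf}}(V_n(\mathbb{Z}_p)_{a_n = b_n})$ is independent of $b_n$ if and only if $\gcd(n, p - 1) = 1$. The quantity $P^{\max}(V_n(\mathbb{Z}_p)_{a_n = b_n})$ depends strictly on whether $b_n$ is a square or not a square mod $p$ if $p$ is odd and $n$ is even, and is independent of $b_n$ otherwise.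
   Context: $V_n(\mathbb{Z}_p)$ denotes the set of monic polynomials of degree $n$ over $\mathbb{Z}_p$, identified with $\mathbb{Z}_p^n$ via the coefficients $(a_1,\dots,a_n)$. A subset $\Sigma$ defined by fixing exactly $k$ coefficients and imposing congruence conditions on the others is viewed as a subset of $\mathbb{Z}_p^{n-k}$ of positive measure with Haar measure. $P^{\mathrm{sqf}}(\Sigma)$ denotes the density (measure of the subset divided by measure of $\Sigma$) of $f \in \Sigma$ whose discriminant is not divisible by $p^2$, and $P^{\max}(\Sigma)$ denotes the density of $f \in \Sigma$ such that $\mathbb{Z}_p[x]/(f(x))$ is the maximal order of $\mathbb{Q}_p[x]/(f(x))$. *)

(* Defs.v *)
From HB Require Import structures.
From mathcomp Require Import all_boot all_order all_algebra.
From mathcomp Require Import all_classical all_reals all_analysis.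
Set Implicit Arguments.
Unset Strict Implicit.
Unset Printing Implicit Defensive.
Import Order.TTheory GRing.Theory Num.Theory.
Local Open Scope ring_scope.

(* The ring Z_p is the inverse limit of the rings Z/p^k: [residue x k] is the
   representative in {0, ..., p^k - 1} of x mod p^k. The coherence condition
   alone forces [residue x k < p ^ k]. The primality proof is a parameter so
   that Z_p is an integral domain for every inhabitant of the family. *)
Definition coherent (p : nat) (x : nat -> nat) : Prop :=
  forall k, (x k.+1 %% p ^ k)%N = x k.

Record padic_int (p : nat) (pr : prime p) := PadicInt {
  residue : nat -> nat;
  _ : `[< coherent p residue >] }.

Section PadicRing.
Variables (p : nat) (pr : prime p).
Local Notation Zp := (padic_int pr).

HB.instance Definition _ := [isSub for @residue p pr].
HB.instance Definition _ := [Choice of Zp by <:].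

Let pX_gt0 k : (0 < p ^ k)%N. Proof. by rewrite expn_gt0 prime_gt0. Qed.

Lemma residueS (x : Zp) k : (residue x k.+1 %% p ^ k)%N = residue x k.
Proof. by case: x => x /= /asboolP. Qed.

Lemma residue_mod (x : Zp) k : (residue x k %% p ^ k)%N = residue x k.
Proof. by rewrite -residueS modn_mod. Qed.

Lemma residueD (x : Zp) k l : (residue x (k + l) %% p ^ k)%N = residue x k.
Proof.
elim: l => [|l IHl]; first by rewrite addn0 residue_mod.
by rewrite addnS -IHl -(residueS x (k + l)) modn_dvdm // expnD dvdn_mulr.
Qed.

Lemma padic_eqP (x y : Zp) : residue x =1 residue y -> x = y.
Proof. by move=> xy; apply/val_inj/funext. Qed.

(* The p-adic integer whose residue mod p^k is that of [u k]. *)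
Lemma coherent_modn (u : nat -> nat) :
  (forall k, u k.+1 = u k %[mod p ^ k]) ->
  `[< coherent p (fun k => u k %% p ^ k)%N >].
Proof.
move=> uS; apply/asboolP => k; rewrite modn_dvdm ?uS //.
by rewrite expnS dvdn_mull.
Qed.

Definition padic_of u uS : Zp := PadicInt pr (@coherent_modn u uS).

Lemma residue_of u uS k : residue (@padic_of u uS) k = (u k %% p ^ k)%N.
Proof. by []. Qed.

Let zeroS k : (fun=> 0)%N k.+1 = (fun=> 0)%N k %[mod p ^ k].
Proof. by []. Qed.
Let oneS k : (fun=> 1)%N k.+1 = (fun=> 1)%N k %[mod p ^ k].
Proof. by []. Qed.
Let addS (x y : Zp) k : (residue x k.+1 + residue y k.+1)%N =
  (residue x k + residue y k)%N %[mod p ^ k].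
Proof. by rewrite -modnDm !residueS. Qed.
Let mulS (x y : Zp) k : (residue x k.+1 * residue y k.+1)%N =
  (residue x k * residue y k)%N %[mod p ^ k].
Proof. by rewrite -modnMm !residueS. Qed.
(* - x is computed as (p^k - 1) * x mod p^k *)
Let oppS (x : Zp) k : ((p ^ k.+1).-1 * residue x k.+1)%N =
  ((p ^ k).-1 * residue x k)%N %[mod p ^ k].
Proof.
apply/eqP; rewrite -(eqn_modDr (residue x k.+1)) -mulSnr prednK //.
rewrite -[X in _ == X]modnDmr residueS -mulSnr prednK //.
by rewrite expnS mulnAC modnMl modnMr.
Qed.

Definition padic_zero := padic_of zeroS.
Definition padic_one := padic_of oneS.
Definition padic_add x y := padic_of (addS x y).
Definition padic_mul x y := padic_of (mulS x y).
Definition padic_opp x := padic_of (oppS x).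

Let addA : associative padic_add.
Proof.
by move=> x y z; apply: padic_eqP => k; rewrite !residue_of modnDmr modnDml addnA.
Qed.
Let addC : commutative padic_add.
Proof. by move=> x y; apply: padic_eqP => k; rewrite !residue_of addnC. Qed.
Let add0 : left_id padic_zero padic_add.
Proof.
by move=> x; apply: padic_eqP => k; rewrite !residue_of modnDml residue_mod.
Qed.
Let addN : left_inverse padic_zero padic_opp padic_add.
Proof.
move=> x; apply: padic_eqP => k.
by rewrite !residue_of modnDml -mulSnr prednK // modnMr mod0n.
Qed.
HB.instance Definition _ := GRing.isZmodule.Build Zp addA addC add0 addN.

Let mulA : associative padic_mul.
Proof.
by move=> x y z; apply: padic_eqP => k; rewrite !residue_of modnMmr modnMml mulnA.
Qed.
Let mulC : commutative padic_mul.
Proof. by move=> x y; apply: padic_eqP => k; rewrite !residue_of mulnC. Qed.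
Let mul1 : left_id padic_one padic_mul.
Proof.
move=> x; apply: padic_eqP => k.
by rewrite !residue_of modnMml mul1n residue_mod.
Qed.
Let mulD : left_distributive padic_mul padic_add.
Proof.
move=> x y z; apply: padic_eqP => k.
by rewrite !residue_of modnMml modnDmr modnDml mulnDl.
Qed.
Let one_neq0 : padic_one != padic_zero.
Proof.
apply/eqP => /(congr1 (fun x : Zp => residue x 1)).
by rewrite !residue_of expn1 mod0n modn_small ?prime_gt1.
Qed.
HB.instance Definition _ :=
  GRing.Zmodule_isComNzRing.Build Zp mulA mulC mul1 mulD one_neq0.

Definition padic_unit : pred Zp := fun x => `[< exists y : Zp, y * x = 1 >].
Definition padic_inv (x : Zp) : Zp :=
  if pselect (exists y : Zp, y * x = 1) is left ex then projT1 (cid ex) else x.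

Let mulV : {in padic_unit, left_inverse 1 padic_inv *%R}.
Proof.
move=> x /asboolP ex; rewrite /padic_inv; case: pselect => // ex'.
exact: (projT2 (cid ex')).
Qed.
Let unitP (x y : Zp) : y * x = 1 -> padic_unit x.
Proof. by move=> yx; apply/asboolP; exists y. Qed.
Let inv_out : {in [predC padic_unit], padic_inv =1 id}.
Proof.
move=> x /negP xNu; rewrite /padic_inv; case: pselect => // ex.
by case: xNu; apply/asboolP.
Qed.
HB.instance Definition _ :=
  GRing.ComNzRing_hasMulInverse.Build Zp mulV unitP inv_out.

Let mul_eq0 (x y : Zp) : x * y = 0 -> (x == 0) || (y == 0).
Proof.
move=> xy0; apply/norP => -[x0 y0].
have ex (z : Zp) : z != 0 -> exists k, residue z k != 0%N.
  move=> z0; apply/not_existsP => zk; case/eqP: z0.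
  by apply: padic_eqP => k; rewrite residue_of mod0n; move/negP/negbNE/eqP: (zk k).
have [k xk] := ex _ x0; have [l yl] := ex _ y0.
have Nd (z : Zp) i j : residue z i != 0%N ->
    (0 < residue z (i + j))%N && (logn p (residue z (i + j)) < i)%N.
  rewrite -(residueD z i j) -/(dvdn _ _) => zN.
  have z0 : (0 < residue z (i + j))%N.
    by rewrite lt0n; apply: contraNneq zN => ->; rewrite dvdn0.
  by rewrite z0 ltnNge -pfactor_dvdn.
have /andP[a0 ak] := Nd x k l xk; have /andP[b0 bl] := Nd y l k yl.
rewrite addnC in b0 bl.
have := congr1 (fun z : Zp => residue z (k + l)%N) xy0.
rewrite !residue_of mod0n => /eqP.
rewrite -/(dvdn _ _) pfactor_dvdn ?muln_gt0 ?a0 // lognM // leqNgt.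
by rewrite -addnS leq_add // ltnW.
Qed.
HB.instance Definition _ := GRing.ComUnitRing_isIntegral.Build Zp mul_eq0.

HB.instance Definition _ := isPointed.Build Zp 0.

Section PadicTopology.
Local Open Scope classical_set_scope.

(* The p-adic topology: the residue classes mod p^k of x form a base of
   neighborhoods of x. *)
Definition padic_ball (x : Zp) (k : nat) : set Zp :=
  [set y | residue y k = residue x k].

HB.instance Definition _ := hasNbhs.Build Zp
  (fun x => filter_from setT (padic_ball x)).

Let nbhs_filter (x : Zp) : ProperFilter (nbhs x).
Proof.
apply: filter_from_proper; last by move=> k _; exists x.
apply: filter_from_filter; first by exists 0%N.
move=> k l _ _; exists (k + l)%N => // y xy; rewrite /padic_ball/= in xy *.
split; first by rewrite -[LHS](residueD y k l) xy residueD.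
by rewrite -[LHS](residueD y l k) addnC xy addnC residueD.
Qed.
Let nbhs_singleton (x : Zp) (A : set Zp) : nbhs x A -> A x.
Proof. by case=> k _; apply. Qed.
Let nbhs_nbhs (x : Zp) (A : set Zp) : nbhs x A -> nbhs x (nbhs^~ A).
Proof.
case=> k _ xA; exists k => // y /= yx; exists k => // z /= zy.
by apply: xA; rewrite /padic_ball/= zy.
Qed.
HB.instance Definition _ :=
  Nbhs_isNbhsTopological.Build Zp nbhs_filter nbhs_singleton nbhs_nbhs.

End PadicTopology.
End PadicRing.

Section Haar.
Local Open Scope classical_set_scope.
Variables (R : realType) (p : nat) (pr : prime p) (m : nat).

(* Z_p^m (product topology of the p-adic one) with its Borel sigma-algebra *)
Definition padic_space :=
  g_sigma_algebraType (@open 'rV[padic_int pr]_m).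

Definition is_haar (mu : {measure set padic_space -> \bar R}) : Prop :=
  mu setT = 1%E /\
  forall (v : 'rV[padic_int pr]_m) (A : set padic_space), measurable A ->
    mu [set v + w | w in A] = mu A.
End Haar.

(* For monic f of degree d, disc f = (-1)^(d(d-1)/2) Res(f, f'). The Sylvester
   matrix behind [resultant] is sized by the actual sizes of f and f^`(); over
   the characteristic 0 domain Z_p the size of f^`() is d. *)
Definition monic_discriminant (A : comNzRingType) (f : {poly A}) : A :=
  let d := (size f).-1 in
  (-1) ^+ (d * d.-1)./2 * resultant f f^`().

Definition padic_dvd (p : nat) (pr : prime p) (x y : padic_int pr) : Prop :=
  exists z, y = z * x.

Section MaximalOrder.
Local Open Scope classical_set_scope.
Variables (p : nat) (pr : prime p).
Local Notation Zp := (padic_int pr).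
Local Notation Qp := {fraction Zp}.

(* The subset O of the Q_p-algebra K is a Z_p-order of K: a subring which is
   finitely generated as a Z_p-module and such that Q_p O = K. *)
Definition is_order (K : lalgType Qp) (O : set K) : Prop :=
  [/\ O 1,
      forall x y, O x -> O y -> O (x - y),
      forall x y, O x -> O y -> O (x * y),
      exists (r : nat) (e : 'I_r -> K),
        O = [set \sum_(i < r) FracField.tofrac (c i) *: e i
            | c in [set: 'I_r -> Zp]]
    & forall x : K, exists a : Qp, exists2 y, O y & x = a *: y].

Definition is_maximal_order (K : lalgType Qp) (O : set K) : Prop :=
  is_order O /\ forall O' : set K, is_order O' -> O `<=` O' -> O' = O.

Definition to_Qp (f : {poly Zp}) : {poly Qp} := map_poly (@FracField.tofrac Zp) f.

(* Q_p[x]/(f); the library quotient is the intended one for f monic, deg f > 0 *)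
Definition Qp_quotient (f : {poly Zp}) : lalgType Qp := {poly %/ to_Qp f}.

(* Z_p[x]/(f) embedded in Q_p[x]/(f): the classes of the g in Z_p[x] *)
Definition Zp_quotient (f : {poly Zp}) : set (Qp_quotient f) :=
  [set in_qpoly (to_Qp f) (to_Qp g) | g in [set: {poly Zp}]].

Definition sqf_disc (f : {poly Zp}) : Prop :=
  ~ padic_dvd (p%:R ^+ 2) (monic_discriminant f).

Definition maximal_quotient (f : {poly Zp}) : Prop :=
  is_maximal_order (@Zp_quotient f).
End MaximalOrder.

Section Densities.
Local Open Scope classical_set_scope.
Variables (R : realType) (p : nat) (pr : prime p) (n : nat).
Local Notation Zp := (padic_int pr).

(* x^n + a_1 x^(n-1) + ... + a_n, where a_(i+1) is stored in column i *)
Definition monic_of_coefs (a : 'rV[Zp]_n) : {poly Zp} :=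
  'X^n + \sum_(i < n) a 0 i *: 'X^(n - i.+1).

(* (v_1, ..., v_(n-1), b) *)
Definition with_last (b : Zp) (v : 'rV[Zp]_n.-1) : 'rV[Zp]_n :=
  \row_(i < n) oapp (v 0) b (insub (i : nat)).

Definition V_last (b : Zp) (v : padic_space pr n.-1) : {poly Zp} :=
  monic_of_coefs (with_last b v).

Variable mu : {measure set (padic_space pr n.-1) -> \bar R}.

(* Density in the family of monic f of degree n with a_n = b, viewed as the
   whole of Z_p^(n-1), of those satisfying Q *)
Definition density_last (b : Zp) (Q : {poly Zp} -> Prop) : R :=
  fine (mu [set v | Q (V_last b v)]) / fine (mu setT).

Definition P_sqf (b : Zp) : R := density_last b (@sqf_disc p pr).
Definition P_max (b : Zp) : R := density_last b (@maximal_quotient p pr).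
End Densities.

Definition square_mod_p (p : nat) (pr : prime p) (b : padic_int pr) : Prop :=
  exists c, padic_dvd p%:R (b - c ^+ 2).

(* Main.v *)
(* Reduce f modulo p and write f = S^2 H + p R with S, H monic and H squarefree modulo p.
   By Dedekind's criterion Z_p[x]/(f) is maximal if and only if S and R are coprime modulo p.
   The discriminant is not divisible by p^2 if and only if S = 1 or (p odd) S = X - a modulo p
   with H(a) and R(a) nonzero: if v spans a kernel line modulo p of the Sylvester matrix M of
   f and f', then p^2 divides det M exactly when M becomes singular modulo p after one of its
   rows is replaced by v M / p.

   Both conditions depend on f modulo p^2 only. Haar measure equidistributes the first two
   digits of the coefficients, which turns each density into a weighted count of the monic
   f over F_q, q = p, of degree n with f(0) = b. If a weight w satisfies
     sum over d^2 | f of lam^(deg d) w(f / d^2) = 1,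
   then its sum X_n(b) satisfies X_n = q^(n-1) - lam q^(n-2) + lam X_(n-2). This applies with
   lam = 1 to the indicator of squarefree f, and with lam = 1/q to the probability
   phi(S) / |S| that R is coprime to S. Only X_2(b) = q - lam #{c : c^2 = b} depends on b, so
   the dependence on squares comes from even n. Counting (X - a)^2 h, with h squarefree and
   h(a) nonzero, by inclusion-exclusion in the order at a brings in #{c : c^n = b},
   hence the condition gcd(n, p - 1) = 1. *)
From HB Require Import structures.
Require Import Defs.
From mathcomp Require Import all_boot all_order all_algebra.
From mathcomp Require Import perm all_field.
From mathcomp Require Import all_classical all_reals all_analysis.
From mathcomp Require Import ring lra zify.
Import Order.TTheory GRing.Theory Num.Theory.
Local Open Scope ring_scope.
Set Implicit Arguments.
Unset Strict Implicit.
Unset Printing Implicit Defensive.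

(** The last coefficient is frozen, so modulo p the remainder R is t X + delta, where delta is
    forced by b and only t is random. Since S(0)^2 H(0) = b is nonzero modulo p, X is invertible
    modulo S and R is still uniform modulo S; this is where the unit b matters. The recursion closes
    because X_n(b) depends on b only modulo squares: dividing f by d^2 turns the constant term into
    b / d(0)^2. After normalization by q^(n-1), a step for lam = 1/q contracts the distance to its
    fixed point by q^-3, which gives both the limit and the error exponent for maximality. The
    derivative keeps its size over Z_p even if p divides n, so the reduced Sylvester matrix need not
    be the Sylvester matrix of the reduced polynomials. Its kernel is therefore handled through
    explicit pairs (u, w) with u f + w f' = 0 and bounded degrees. For maximality, a proper
    overorder yields an element a / b integral over Z_p; its equation comes from a determinant with
    denominators cleared, and so becomes a divisibility modulo p. *)

(** * Sums over monic polynomials over a finite field *)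

Section Monics.
Variable F : finFieldType.
Local Notation q := (#|F|).

Definition monics k : seq {poly F} := [seq 'X^k + val v | v : {poly_k F}].

Lemma mem_monics k f : (f \in monics k) = (f \is monic) && (size f == k.+1).
Proof.
apply/mapP/andP => [[v _ ->]|[fm /eqP sf]].
  have sv : (size (val v) < size ('X^k : {poly F}))%N.
    by rewrite size_polyXn ltnS size_npoly.
  by rewrite monicE lead_coefDl // size_polyDl // lead_coefXn size_polyXn !eqxx.
have sv : (size (f - 'X^k)%R <= k)%N.
  apply/leq_sizeP => j kj; rewrite coefB coefXn.
  case: (ltngtP k j) kj => // [kj _|<- _].
    by rewrite nth_default ?subr0 // sf.
  by move: fm; rewrite monicE lead_coefE sf /= => /eqP ->; rewrite subrr.
exists (npolyp k (f - 'X^k)); first exact: mem_enum.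
by rewrite /= npolypK // addrC subrK.
Qed.

Lemma monics_uniq k : uniq (monics k).
Proof.
by rewrite map_inj_uniq ?enum_uniq // => u v /addrI /val_inj.
Qed.

Lemma monics_monic k f : f \in monics k -> f \is monic.
Proof. by rewrite mem_monics => /andP[]. Qed.

Lemma monics_size k f : f \in monics k -> size f = k.+1.
Proof. by rewrite mem_monics => /andP[_ /eqP]. Qed.

Lemma monics_neq0 k f : f \in monics k -> f != 0.
Proof. by move/monics_monic/monic_neq0. Qed.

Lemma monics0 : monics 0 = [:: 1].
Proof.
apply: perm_small_eq => //; apply: uniq_perm; rewrite ?monics_uniq // => f.
rewrite mem_monics inE; apply/andP/eqP => [[fm /eqP/esym/eqP]|->].
  rewrite eq_sym => /size_poly1P[c _ fE].
  by move: fm; rewrite fE monicE lead_coefC => /eqP ->.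
by rewrite monic1 size_poly1.
Qed.

Lemma monicsM i j f g : f \in monics i -> g \in monics j ->
  f * g \in monics (i + j).
Proof.
rewrite !mem_monics => /andP[fm /eqP sf] /andP[gm /eqP sg].
by rewrite monicMl // gm size_monicM ?monic_neq0 // sf sg addnS addSn eqxx.
Qed.

Lemma monics_divisor n f d : f \in monics n -> d \is monic -> d %| f ->
  d \in monics (size d).-1 /\ ((size d).-1 <= n)%N.
Proof.
move=> fM dm df; rewrite mem_monics dm prednK ?eqxx ?size_poly_gt0 ?monic_neq0 //.
split=> //; have := dvdp_leq (monics_neq0 fM) df.
by rewrite (monics_size fM); case: (size d).
Qed.

Lemma monics_divp n i f d : f \in monics n -> d \in monics i -> d %| f ->
  f %/ d \in monics (n - i).
Proof.
move=> fM dM df; rewrite mem_monics.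
have fE := divpK df.
have := monics_monic fM; rewrite -{1}fE monicMr ?(monics_monic dM) // => qm.
rewrite qm /= size_divp ?(monics_neq0 dM) // (monics_size fM) (monics_size dM) /=.
have := dvdp_leq (monics_neq0 fM) df.
rewrite (monics_size fM) (monics_size dM) ltnS => le.
by rewrite subSn.
Qed.

Section Sums.
Variable K : realFieldType.
Implicit Type G : {poly F} -> K.

Lemma sum_monics_dvd n i d G : d \in monics i -> (i <= n)%N ->
  \sum_(f <- monics n | d %| f) G f = \sum_(g <- monics (n - i)) G (d * g).
Proof.
move=> dM le; rewrite -big_filter -(big_map (fun g => d * g) xpredT).
apply/perm_big/uniq_perm; first by rewrite filter_uniq ?monics_uniq.
  rewrite map_inj_uniq ?monics_uniq //; apply: mulfI.
  exact: monics_neq0 dM.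
move=> f; rewrite mem_filter; apply/andP/mapP => [[df fM]|[g gM ->]].
  by exists (f %/ d); [exact: monics_divp | rewrite mulrC divpK].
by rewrite dvdp_mulIl -[in monics n](subnKC le) monicsM.
Qed.

Lemma sum_monicsS n G :
  \sum_(f <- monics n.+1) G f = \sum_(c : F) \sum_(g <- monics n) G (g * 'X + c%:P).
Proof.
rewrite -(big_allpairs_dep (h := fun c g => g * 'X + c%:P)).
apply/perm_big/uniq_perm; first exact: monics_uniq.
  apply: allpairs_uniq; rewrite ?index_enum_uniq ?monics_uniq //=.
  move=> [c g] [c' g'] _ _ /= e.
  have ec : c = c' by have := congr1 (horner^~ 0) e; rewrite !hornerE.
  by move: e; rewrite ec => /addIr/(mulIf (negbT (polyX_eq0 F))) ->.
move=> f; apply/idP/allpairsP => [fM|[[c g] /= [_ gM ->]]].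
  have fE : f = f %/ 'X * 'X + (f.[0])%:P.
    by rewrite {1}(divp_eq f 'X) -modp_XsubC polyC0 subr0.
  exists (f.[0], f %/ 'X); split; rewrite ?mem_index_enum //=.
  have sq : size (f %/ 'X) = n.+1.
    by rewrite size_divp ?polyX_eq0 // (monics_size fM) size_polyX.
  rewrite mem_monics sq eqxx andbT monicE lead_coefE sq /=.
  have := monics_monic fM; rewrite monicE lead_coefE (monics_size fM) /=.
  by rewrite {1}fE coefD coefMX coefC /= addr0.
have sgX : size (g * 'X) = n.+2.
  by rewrite size_mulX ?(monics_neq0 gM) // (monics_size gM).
have lt : (size (c%:P : {poly F}) < size (g * 'X)%R)%N.
  by rewrite sgX (leq_ltn_trans (size_polyC_leq1 _)).
rewrite mem_monics monicE lead_coefDl // size_polyDl // sgX eqxx andbT.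
by rewrite lead_coefMX -monicE (monics_monic gM).
Qed.

Lemma sum_monics1 n : \sum_(f <- monics n) (1 : K) = q%:R ^+ n.
Proof.
by rewrite big_map big_enum /= sumr_const card_npoly natrX.
Qed.

Lemma sum_monics_horner0 n (G : F -> K) :
  \sum_(f <- monics n.+1) G f.[0] = q%:R ^+ n * \sum_(c : F) G c.
Proof.
rewrite sum_monicsS mulr_sumr; apply: eq_bigr => c _.
rewrite -sum_monics1 mulr_suml; apply: eq_bigr => f _.
by rewrite !hornerE.
Qed.

Definition nroots e (b : F) : K := \sum_(c : F | c ^+ e == b) 1.

Lemma nroots2_sqr c b : c != 0 -> nroots 2 (b / c ^+ 2) = nroots 2 b.
Proof.
move=> c0; rewrite /nroots (reindex_inj (mulIf (invr_neq0 c0))) /=.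
apply: eq_bigl => d; rewrite exprMn exprVn (inj_eq (mulIf _)) //.
by rewrite invr_neq0 ?expf_neq0.
Qed.

(** * The recursion for weighted counts with prescribed constant term *)

Section SquareRecursion.
Variables (lam : K) (w : {poly F} -> K).
Hypothesis w1 : w 1 = 1.
Hypothesis w_sum : forall n f, f \in monics n -> f.[0] != 0 ->
  \sum_(j < n./2.+1) lam ^+ j *
    (\sum_(d <- monics j | d ^+ 2 %| f) w (f %/ d ^+ 2)) = 1.

Definition weight_sum n b := \sum_(f <- monics n | f.[0] == b) w f.
Local Notation X := weight_sum.
(** [U] gathers the constant terms [b / d(0)^2] that [f / d^2] can have, one for each nonzero value
    of [d(0)]. *)
Local Notation U n b := (\sum_(c : F | c != 0) X n (b / c ^+ 2)).

Lemma weight_sum0 b : X 0 b = (b == 1)%:R.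
Proof.
rewrite /X monics0 big_cons big_nil hornerE addr0 w1 eq_sym.
by case: eqP.
Qed.

(** In degree 0 the only cofactor is 1, which forces [c^2 = b]. This is how the square roots of [b]
    enter. *)
Lemma sum_weight_sum0 b : b != 0 -> U 0%N b = nroots 2 b.
Proof.
move=> b0; rewrite /nroots [RHS]big_mkcond [LHS]big_mkcond.
apply: eq_bigr => c _; case: eqVneq => [->|c0] /=.
  by rewrite expr0n /= eq_sym (negbTE b0).
rewrite weight_sum0; have -> : (b / c ^+ 2 == 1) = (c ^+ 2 == b).
  by apply/eqP/eqP => [/divr1_eq//|<-]; rewrite divff ?expf_neq0.
by case: eqP.
Qed.

Lemma sum_weight_sum_sqr n b c : c != 0 -> U n (b / c ^+ 2) = U n b.
Proof.
move=> c0; rewrite [RHS](reindex_inj (mulfI c0)) /=.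
apply: eq_big => d; first by rewrite mulf_eq0 (negbTE c0).
by move=> d0; rewrite exprMn [in RHS]invfM mulrA.
Qed.

(** Insert [w_sum] into the count [q^n] of all monics with [f(0) = b] and write [f = d^2 g]. Then
    [g] has constant term [b / d(0)^2], and each nonzero value of [d(0)] is taken by [q^j] monics
    [d] of degree [j + 1]. *)
Lemma weight_sum_total n b : b != 0 ->
  q%:R ^+ n = X n.+1 b +
    \sum_(j < n.+1./2) lam ^+ j.+1 * q%:R ^+ j * U (n.+1 - j.+1.*2)%N b.
Proof.
move=> b0.
transitivity (\sum_(f <- monics n.+1 | f.[0] == b) (1 : K)).
  rewrite big_mkcond (sum_monics_horner0 n (fun c => if c == b then 1 else 0)).
  by rewrite -big_mkcond big_pred1_eq mulr1.
transitivity (\sum_(f <- monics n.+1 | f.[0] == b) \sum_(j < n.+1./2.+1)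
   lam ^+ j * (\sum_(d <- monics j | d ^+ 2 %| f) w (f %/ d ^+ 2))).
  rewrite big_seq_cond [RHS]big_seq_cond; apply: eq_bigr => f /andP[fM /eqP f0].
  by rewrite w_sum // f0.
(* The term [j = 0] has [d = 1] only and gives [X n.+1 b]. *)
rewrite exchange_big big_ord_recl /=; congr (_ + _).
  apply: eq_bigr => f _; rewrite expr0 mul1r monics0 big_cons big_nil expr1n.
  by rewrite dvd1p divp1 addr0.
apply: eq_bigr => j _; rewrite -mulr_sumr -mulrA; congr (_ * _).
have lej : (j.+1.*2 <= n.+1)%N by rewrite -geq_half_double; exact: ltn_ord j.
have -> : q%:R ^+ j * U (n.+1 - j.+1.*2)%N b =
   \sum_(d <- monics j.+1 | d.[0] != 0) X (n.+1 - j.+1.*2) (b / d.[0] ^+ 2).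
  rewrite [RHS]big_mkcond
    (sum_monics_horner0 j (fun c => if c != 0 then X (n.+1 - j.+1.*2) (b / c ^+ 2)
       else 0)).
  by rewrite -big_mkcond.
rewrite (eq_bigr _ (fun f _ => big_mkcond _ _)) exchange_big /=.
rewrite [RHS]big_mkcond big_seq [RHS]big_seq; apply: eq_bigr => d dM.
rewrite -big_mkcondr /= (eq_bigl (fun f => (d ^+ 2 %| f) && (f.[0] == b))); last first.
  by move=> f; rewrite andbC.
rewrite big_mkcondr /=.
have d2M : d ^+ 2 \in monics j.+1.*2 by rewrite -addnn expr2 monicsM.
(* If [d(0) = 0], then [d^2] divides no [f] with [f(0) = b], as [b] is nonzero. *)
rewrite (sum_monics_dvd _ d2M) //; case: eqVneq => [d0|d0] /=.
  by rewrite big1 // => g _; rewrite hornerM horner_exp d0 expr0n mul0r eq_sym (negbTE b0).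
rewrite /X -big_mkcond /=; apply: eq_big => g.
  rewrite hornerM horner_exp -(inj_eq (mulIf (invr_neq0 (expf_neq0 2 d0)))).
  by rewrite mulrAC divff ?expf_neq0 // mul1r.
by move=> _; rewrite mulrC mulpK // (monics_neq0 d2M).
Qed.

Lemma weight_sum1 b : b != 0 -> X 1 b = 1.
Proof. by move=> b0; have := weight_sum_total 0 b0; rewrite big_ord0 addr0. Qed.

Lemma weight_sum2 b : b != 0 -> X 2 b = q%:R - lam * nroots 2 b.
Proof.
move=> b0; have := weight_sum_total 1 b0.
rewrite big_ord_recl big_ord0 /= expr0 mulr1 expr1 subnn sum_weight_sum0 // addr0.
by rewrite expr1 => ->; rewrite addrK.
Qed.

(** Subtract [lam * q] times the identity of degree [n + 1] from that of degree [n + 3]: all terms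
    with [j > 0] cancel. *)
Lemma weight_sum_step n b : b != 0 ->
  X n.+3 b = q%:R ^+ n.+2 - lam * U n.+1 b - lam * q%:R * (q%:R ^+ n - X n.+1 b).
Proof.
move=> b0; have := weight_sum_total n.+2 b0; rewrite (weight_sum_total n b0).
set V := \sum_(j < n.+1./2) _; rewrite big_ord_recl /=.
have -> : \sum_(i < uphalf n) lam ^+ (bump 0 i).+1 * q%:R ^+ bump 0 i *
    U (n.+3 - (bump 0 i).+1.*2)%N b = lam * q%:R * V.
  rewrite mulr_sumr; apply: eq_bigr => i _.
  rewrite /bump /= add1n !doubleS !subSS !exprS; ring.
rewrite expr0 mulr1 expr1 /= !subSS subn0; lra.
Qed.

(** Invariance under squares passes from [nroots 2] and from [U] to [X] along the step; it is what
    evaluates [U] in the next recursion. *)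
Lemma weight_sum_sqr n b c : b != 0 -> c != 0 -> X n.+1 (b / c ^+ 2) = X n.+1 b.
Proof.
move=> b0 c0; have bc0 : b / c ^+ 2 != 0 by rewrite mulf_neq0 ?invr_neq0 ?expf_neq0.
move: n; apply: (@ltn_ind (fun n => X n.+1 (b / c ^+ 2) = X n.+1 b)).
case=> [|[|n]] IH; first by rewrite !weight_sum1.
  by rewrite !weight_sum2 // nroots2_sqr.
by rewrite !weight_sum_step // sum_weight_sum_sqr // IH.
Qed.

Lemma card_neq0 : \sum_(c : F | c != 0) (1 : K) = q%:R - 1.
Proof.
transitivity (#|predC1 (0 : F)|%:R : K); first by rewrite -sumr_const.
by rewrite cardC1 -subn1 natrB // ltnW // finNzRing_gt1.
Qed.

(** All [q - 1] summands of [U] equal [X n.+1 b], and [- lam (q - 1) + lam q = lam]. *)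
Lemma weight_sumS n b : b != 0 ->
  X n.+3 b = q%:R ^+ n.+2 - lam * q%:R ^+ n.+1 + lam * X n.+1 b.
Proof.
move=> b0; rewrite weight_sum_step //.
have -> : U n.+1 b = (q%:R - 1) * X n.+1 b.
  rewrite -card_neq0 mulr_suml; apply: eq_bigr => c c0.
  by rewrite mul1r weight_sum_sqr.
rewrite !exprS; ring.
Qed.

End SquareRecursion.
End Sums.
End Monics.

(** * Square parts over a perfect field *)

Section Squarefree.
Variable F : fieldType.
Implicit Types d s h u v f : {poly F}.

(** After division by the gcd of [d] and [s], the square of the rest of [d] is coprime to the rest
    of [s], so it divides the squarefree [h] and is constant. *)
Lemma sqfree_dvd_sqr h d s : s != 0 -> separable_poly h -> d ^+ 2 %| s ^+ 2 * h ->
  d %| s.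
Proof.
move=> s0 sep_h; set g := gcdp d s.
have g0 : g != 0 by rewrite gcdp_eq0 negb_and s0 orbT.
have dE : d = d %/ g * g by rewrite divpK ?dvdp_gcdl.
have sE : s = s %/ g * g by rewrite divpK ?dvdp_gcdr.
have cop : coprimep (d %/ g) (s %/ g) by rewrite coprimep_div_gcd // s0 orbT.
have -> : (d ^+ 2 %| s ^+ 2 * h) = ((d %/ g) ^+ 2 %| (s %/ g) ^+ 2 * h).
  by rewrite -[RHS](dvdp_mul2r _ _ (expf_neq0 2 g0)) [_ * h * _]mulrAC -!exprMn -dE -sE.
rewrite Gauss_dvdpr ?coprimep_expl ?coprimep_expr //.
have := separable_nosquare (u := d %/ g) sep_h (isT : (1 < 2)%N).
case: eqVneq => [d1 _ _|_ ->//].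
have e1 : d %/ g %= 1 by rewrite -size_poly_eq1 d1.
by rewrite dE [X in _ %| X]sE dvdp_mul // (eqp_dvdl _ e1) dvd1p.
Qed.

Lemma eqp_monic_eq u v : u \is monic -> v \is monic -> u %| v -> v %| u -> u = v.
Proof. by move=> um vm uv vu; apply/eqP; rewrite -eqp_monic // /eqp uv. Qed.

Section Perfect.
Variables (p : nat) (pF : p \in [pchar F]).
Hypothesis pth_root : forall a : F, exists b, b ^+ p = a.

(** The leading term is a [p]-th power with zero derivative; remove it, induct on the size and add
    the roots by additivity of Frobenius. *)
Lemma deriv0_pth_power u : u^`() = 0 -> exists v, u = v ^+ p.
Proof.
have p_gt0 : (0 < p)%N by rewrite prime_gt0 // (pcharf_prime pF).
have pFX : p \in [pchar {poly F}] by rewrite pchar_poly.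
move: {2}(size u).+1 (ltnSn (size u)) => N; elim: N u => // N IH u; rewrite ltnS => su u'0.
have [->|u0] := eqVneq u 0; first by exists 0; rewrite expr0n; case: (p) p_gt0.
set n := (size u).-1.
(* The leading coefficient times [n] is a coefficient of [u'], hence zero. *)
have pn : (p %| n)%N.
  case n0 : n => [|m]; first exact: dvdn0.
  have := congr1 (fun g : {poly F} => g`_m) u'0; rewrite coef_deriv coef0 -n0 => /eqP.
  rewrite -lead_coefE -mulr_natr mulf_eq0 lead_coef_eq0 (negbTE u0) /=.
  by rewrite (dvdn_pcharf pF).
have [b bE] := pth_root (lead_coef u).
set t := (b *: 'X^(n %/ p)%N) ^+ p.
have tE : t = lead_coef u *: 'X^n.
  by rewrite /t exprZn bE -exprM divnK.
have t'0 : t^`() = 0.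
  by rewrite tE derivZ derivXn -mulr_natr -polyC_natr (eqP (_ : n%:R == 0 :> F))
     ?mulr0 ?scaler0 // -(dvdn_pcharf pF).
have [||v vE] := IH (u - t).
- rewrite (leq_trans _ su) // -(prednK (_ : 0 < size u)%N) ?size_poly_gt0 // ltnS.
  apply/leq_sizeP => j; rewrite leq_eqVlt tE coefB coefZ coefXn => /predU1P[<-|lt].
    by rewrite eqxx mulr1 lead_coefE subrr.
  rewrite nth_default ?gtn_eqF ?mulr0 ?subr0 //.
  by rewrite -(prednK (_ : 0 < size u)%N) ?size_poly_gt0.
- by rewrite derivB u'0 t'0 subrr.
exists (v + b *: 'X^(n %/ p)%N).
by rewrite -(pFrobenius_autE pFX) pFrobenius_autD_comm ?pFrobenius_autE -?vE ?subrK //;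
   exact: mulrC.
Qed.

(** An inseparable factor would have derivative zero, hence be a [p]-th power, and so contain a
    square. *)
Lemma square_free_separable f : f != 0 ->
  (forall u, size u != 1%N -> ~~ (u ^+ 2 %| f)) -> separable_poly f.
Proof.
move=> f0 /poly_square_freeP sqf; apply/separable_polyP; split=> // u uf su.
apply/eqP => /deriv0_pth_power[v uE].
have /poly_square_freeP := sqf => /(_ v).
have p_gt1 : (1 < p)%N by rewrite prime_gt1 // (pcharf_prime pF).
have v2f : v ^+ 2 %| f.
  by apply: dvdp_trans uf; rewrite uE -(subnK p_gt1) exprD dvdp_mull.
rewrite v2f; case: (eqVneq (size v) 1) => [v1|_ /(_ isT)//].
move: su; rewrite uE ltnNge; case/negP.
have /size_poly1P[c c0 ->] : size v == 1 by rewrite v1.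
by rewrite -polyC_exp size_polyC_leq1.
Qed.

(** Squares of nonconstant divisors are split off until the rest is separable. The final [h] may
    still share roots with [s], as for X^3. *)
Lemma square_decomp f : f \is monic -> exists s h,
  [/\ s \is monic, h \is monic, separable_poly h & f = s ^+ 2 * h].
Proof.
move: {2}(size f).+1 (ltnSn (size f)) => N; elim: N f => // N IH f; rewrite ltnS => sf fm.
have f0 := monic_neq0 fm.
have [sep_f|nsep] := boolP (separable_poly f).
  by exists 1, f; rewrite monic1 expr1n mul1r.
have [u su uf] : exists2 u : {poly F}, size u != 1%N & u ^+ 2 %| f.
  apply: contrapT => nex; case/negP: nsep; apply: square_free_separable => // u su.
  by apply/negP => uf; apply: nex; exists u.
have u0 : u != 0 by apply: contraNneq f0 => u0; rewrite u0 expr0n dvd0p in uf.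
pose v := (lead_coef u)^-1 *: u.
have vm : v \is monic by rewrite monicE lead_coefZ mulVf ?lead_coef_eq0.
have lu0 : (lead_coef u)^-1 != 0 by rewrite invr_eq0 lead_coef_eq0.
have sv : size v = size u by rewrite size_scale.
have vf : v ^+ 2 %| f by rewrite exprZn dvdpZl // expf_neq0.
have fE := divpK vf.
have gm : f %/ v ^+ 2 \is monic.
  by move: fm; rewrite -{1}fE monicMr // monic_exp.
have [|s [h [sm hm sep_h gE]]] := IH (f %/ v ^+ 2) _ gm.
  rewrite (leq_trans _ sf) // -[in ltnRHS]fE size_monicM ?expf_neq0 ?monic_neq0 //.
  rewrite expr2 size_monicM ?monic_neq0 // sv.
  have : (0 < size u)%N by rewrite size_poly_gt0.
  have : (0 < size (f %/ (v * v))%R)%N by rewrite -expr2 size_poly_gt0 monic_neq0.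
  by move: su; lia.
exists (v * s), h; rewrite monicMl // sm hm; split=> //.
by rewrite -fE gE exprMn; ring.
Qed.

End Perfect.
End Squarefree.

Lemma finField_pth_root (F : finFieldType) p : p \in [pchar F] ->
  forall a : F, exists b, b ^+ p = a.
Proof.
move=> pF a; have inj : injective (fun b : F => b ^+ p).
  by move=> x y; rewrite -!(pFrobenius_autE pF); apply: fmorph_inj.
by exists (invF inj a); exact: (f_invF inj a).
Qed.

(** * The square part over a finite field and the two weights of the recursion *)

Section SquarePart.
Variable F : finFieldType.
Local Notation q := (#|F|).
Implicit Types d s h u v f : {poly F}.

(** For monic [f] the choice is unique by [sq_partE]: it is the largest monic [d], for divisibility,
    with [d^2 %| f]. *)
Definition sq_part f : {poly F} := xget 1 [set s | exists h,
  [/\ s \is monic, h \is monic, separable_poly h & f = s ^+ 2 * h]]%classic.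

Lemma sq_partP f : f \is monic -> exists h,
  [/\ sq_part f \is monic, h \is monic, separable_poly h & f = sq_part f ^+ 2 * h].
Proof.
move=> fm; have [p _ pF] := finPcharP F.
exact: (xgetPex 1 (square_decomp pF (finField_pth_root pF) fm)).
Qed.

Lemma sq_part_dvd f d : f \is monic -> (d ^+ 2 %| f) = (d %| sq_part f).
Proof.
move=> fm; have [h [sm hm sep_h fE]] := sq_partP fm; apply/idP/idP => [|ds].
  by rewrite {1}fE; apply: sqfree_dvd_sqr; rewrite ?monic_neq0.
by rewrite fE dvdp_mulr // dvdp_exp2r.
Qed.

Lemma sq_partE s h : s \is monic -> h \is monic -> separable_poly h ->
  sq_part (s ^+ 2 * h) = s.
Proof.
move=> sm hm sep_h; have fm : s ^+ 2 * h \is monic by rewrite monicMl ?monic_exp.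
have [h' [s'm _ sep_h' fE]] := sq_partP fm.
apply: eqp_monic_eq => //; last by rewrite -sq_part_dvd // dvdp_mulr.
by apply: (sqfree_dvd_sqr _ sep_h); rewrite ?monic_neq0 // sq_part_dvd.
Qed.

Lemma sq_part_div f d : f \is monic -> d \is monic -> d ^+ 2 %| f ->
  sq_part (f %/ d ^+ 2) = sq_part f %/ d.
Proof.
move=> fm dm d2f; have [h [sm hm sep_h fE]] := sq_partP fm.
have d0 := monic_neq0 dm.
move: d2f; rewrite sq_part_dvd // => ds; have sE := divpK ds.
have qm : sq_part f %/ d \is monic by move: sm; rewrite -{1}sE monicMr.
have -> : f %/ d ^+ 2 = (sq_part f %/ d) ^+ 2 * h.
  by rewrite {1}fE -{1}sE exprMn mulrAC mulpK // expf_neq0.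
exact: sq_partE.
Qed.

Lemma separable_sq_part f : f \is monic -> separable_poly f = (sq_part f == 1).
Proof.
move=> fm; have [h [sm hm sep_h fE]] := sq_partP fm; apply/idP/eqP => [sep_f|s1].
  by have := sq_partE (monic1 _) fm sep_f; rewrite expr1n mul1r.
by rewrite fE s1 expr1n mul1r.
Qed.

Lemma size_sq_part n f : f \in monics F n ->
  sq_part f \in monics F (size (sq_part f)).-1 /\ ((size (sq_part f)).-1 <= n./2)%N.
Proof.
move=> fM; have fm := monics_monic fM.
have [h [sm hm sep_h fE]] := sq_partP fm.
have sf : sq_part f ^+ 2 %| f by rewrite {2}fE dvdp_mulr.
have s2m : sq_part f ^+ 2 \is monic by rewrite monic_exp.
split; first by rewrite mem_monics sm prednK ?eqxx // size_poly_gt0 monic_neq0.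
have := dvdp_leq (monic_neq0 fm) sf.
rewrite (monics_size fM) expr2 size_monicM ?monic_neq0 //.
have : (0 < size (sq_part f))%N by rewrite size_poly_gt0 monic_neq0.
rewrite geq_half_double -addnn. move: (size _) => m. lia.
Qed.

Definition polys k : seq {poly F} := [seq val v | v : {poly_k F}].

Lemma mem_polys k t : (t \in polys k) = (size t <= k)%N.
Proof.
apply/mapP/idP => [[v _ ->]|st]; first exact: size_npoly.
by exists (npolyp k t); rewrite ?mem_enum //= npolypK.
Qed.

Lemma polys_uniq k : uniq (polys k).
Proof. by rewrite map_inj_uniq ?enum_uniq //; apply: val_inj. Qed.

Section Weights.
Variable K : realFieldType.

(** Both weight identities reduce to this: the double sum runs over all monics of degree below [N],
    and one of them survives. *)
Lemma sum_monics_unique N k d0 (P : pred {poly F}) (G : nat -> {poly F} -> K) :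
  d0 \in monics F k -> (k < N)%N -> P d0 ->
  (forall j d, (j < N)%N -> d \in monics F j -> P d -> d = d0) ->
  \sum_(j < N) (\sum_(d <- monics F j | P d) G j d) = G k d0.
Proof.
move=> d0M kN Pd0 uniq_d; rewrite (bigD1 (Ordinal kN)) //= [X in _ + X]big1 ?addr0.
  rewrite big_mkcond (bigD1_seq d0) ?monics_uniq //= Pd0 [X in _ + X]big_seq_cond.
  rewrite big1 ?addr0 // => d /andP[dM /negP dN]; case: ifP => // Pd; case: dN.
  exact/eqP/(uniq_d k).
move=> j jk; rewrite big_seq_cond big1 // => d /andP[dM Pd]; case/negP: jk.
move: (dM); rewrite (uniq_d j d) // => /monics_size; rewrite (monics_size d0M).
by case=> kj; apply/eqP/val_inj.
Qed.

Lemma sum_polys_dvd k j d (G : {poly F} -> K) : d \in monics F j -> (j <= k)%N ->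
  \sum_(t <- polys k | d %| t) G t = \sum_(t <- polys (k - j)) G (d * t).
Proof.
move=> dM jk; have d0 := monics_neq0 dM.
rewrite -big_filter -(big_map (fun t => d * t) xpredT).
apply/perm_big/uniq_perm; first by rewrite filter_uniq ?polys_uniq.
  by rewrite map_inj_uniq ?polys_uniq //; apply: mulfI.
move=> t; rewrite mem_filter; apply/andP/mapP => [[dt]|[u]].
  rewrite mem_polys => st; exists (t %/ d); last by rewrite mulrC divpK.
  by rewrite mem_polys size_divp // (monics_size dM) /= leq_sub2r.
rewrite !mem_polys => su ->; rewrite dvdp_mulIl; split=> //.
move: su (size_polyMleq d u) jk; rewrite (monics_size dM).
by move: (size u) (size _) => a b; lia.
Qed.

Lemma sum_polys1 k : \sum_(t <- polys k) (1 : K) = q%:R ^+ k.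
Proof. by rewrite big_map big_enum /= sumr_const card_npoly natrX. Qed.

(** Euler's function of F_q[X]: the number of units modulo [s], counted on representatives of degree
    below deg [s]. *)
Definition poly_phi s : K := \sum_(t <- polys (size s).-1) (coprimep s t)%:R.

(** Gauss's identity, the sum of phi(s / d) over d | s being |s|: sort the residues [t] modulo [s]
    by their monic gcd with [s]. *)
Lemma sum_poly_phi N k s : s \in monics F k -> (k < N)%N ->
  \sum_(j < N) (\sum_(d <- monics F j | d %| s) poly_phi (s %/ d)) = q%:R ^+ k.
Proof.
move=> sM kN; have s0 := monics_neq0 sM; have sm := monics_monic sM.
rewrite -sum_polys1.
transitivity (\sum_(j < N) \sum_(d <- monics F j | d %| s)
   \sum_(t <- polys k) ((d %| t) && coprimep (s %/ d) (t %/ d))%:R : K).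
  apply: eq_bigr => j _; rewrite big_seq_cond [RHS]big_seq_cond.
  apply: eq_bigr => d /andP[dM ds].
  have jk : (j <= k)%N.
    by have := dvdp_leq s0 ds; rewrite (monics_size sM) (monics_size dM).
  rewrite (eq_bigr (fun t => if d %| t then (coprimep (s %/ d) (t %/ d))%:R else 0));
    last by move=> t _; case: (d %| t).
  rewrite -big_mkcond (sum_polys_dvd _ dM jk) /poly_phi.
  rewrite (monics_size (monics_divp sM dM ds)) /=.
  by apply: eq_bigr => t _; rewrite mulrC mulpK // (monics_neq0 dM).
under eq_bigr do rewrite exchange_big.
rewrite exchange_big /= big_seq [RHS]big_seq; apply: eq_bigr => t _.
pose g := gcdp s t; have g0 : g != 0 by rewrite gcdp_eq0 negb_and s0.
pose d0 := (lead_coef g)^-1 *: g.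
have lg0 : (lead_coef g)^-1 != 0 by rewrite invr_eq0 lead_coef_eq0.
have d0m : d0 \is monic by rewrite monicE lead_coefZ mulVf ?lead_coef_eq0.
have d0g : d0 %= g by apply: eqp_scale.
have d0s : d0 %| s by rewrite (eqp_dvdl _ d0g) dvdp_gcdl.
have d0t : d0 %| t by rewrite (eqp_dvdl _ d0g) dvdp_gcdr.
have [d0M d0k] := monics_divisor sM d0m d0s.
have cop d : d != 0 -> d %| s -> d %| t -> coprimep (s %/ d) (t %/ d) = (g %= d).
  move=> dn0 ds dt; rewrite -gcdp_eqp1 -(eqp_mul2r _ _ dn0) mul1r.
  by rewrite -(eqp_ltrans (gcdp_mul2r _ _ _)) !divpK.
transitivity (\sum_(j < N) \sum_(d <- monics F j |
   [&& d %| s, d %| t & coprimep (s %/ d) (t %/ d)]) (1 : K)).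
  apply: eq_bigr => j _; rewrite [LHS]big_mkcond [RHS]big_mkcond.
  by apply: eq_bigr => d _; case: (d %| s) => //=; case: (_ && _).
apply: (sum_monics_unique (fun _ _ => 1) d0M); first exact: leq_ltn_trans d0k kN.
  by rewrite d0s d0t cop ?monic_neq0 // eqp_sym.
move=> j d _ dM /and3P[ds dt]; rewrite cop ?(monics_neq0 dM) // => gd.
apply/eqP; rewrite -eqp_monic ?(monics_monic dM) //.
by rewrite (eqp_rtrans d0g) eqp_sym.
Qed.

(* The probability that a random residue class modulo the square part of [f] is a unit,
   i.e. that a random lift of [f] is maximal. *)
Definition phi_weight f : K :=
  poly_phi (sq_part f) / q%:R ^+ (size (sq_part f)).-1.

(** The only [d] with separable cofactor is the square part of [f]. *)
Lemma sqfree_weight_sum n f : f \in monics F n ->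
  \sum_(j < n./2.+1) (1 : K) ^+ j *
    (\sum_(d <- monics F j | d ^+ 2 %| f) (separable_poly (f %/ d ^+ 2))%:R) = 1.
Proof.
move=> fM; have fm := monics_monic fM; have [sM sn] := size_sq_part fM.
transitivity (\sum_(j < n./2.+1) \sum_(d <- monics F j |
    (d ^+ 2 %| f) && separable_poly (f %/ d ^+ 2)) (1 : K)).
  apply: eq_bigr => j _; rewrite expr1n mul1r [LHS]big_mkcond [RHS]big_mkcond.
  by apply: eq_bigr => d _; case: (d ^+ 2 %| f) => //=; case: separable_poly.
have [h [sm hm sep_h fE]] := sq_partP fm.
apply: (sum_monics_unique (fun _ _ => 1) sM) => //.
  rewrite sq_part_dvd // dvdpp {1}fE mulrC mulpK ?sep_h //.
  by rewrite expf_neq0 // monic_neq0.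
move=> j d _ dM /andP[df sep_fd]; have dm := monics_monic dM.
have gm : f %/ d ^+ 2 \is monic.
  by move: fm; rewrite -{1}(divpK df) monicMr // monic_exp.
by rewrite -(sq_partE dm gm sep_fd) mulrC divpK.
Qed.

(** The divisors [d] of the square part [s] are exactly those with [d^2 %| f], and
    [q^-j / q^(k - j) = q^-k] is the same for all of them, so Gauss's identity for [s] applies. *)
Lemma phi_weight_sum n f : f \in monics F n ->
  \sum_(j < n./2.+1) (q%:R^-1) ^+ j *
    (\sum_(d <- monics F j | d ^+ 2 %| f) phi_weight (f %/ d ^+ 2)) = 1.
Proof.
move=> fM; have fm := monics_monic fM; have [sM sn] := size_sq_part fM.
set s := sq_part f in sM sn *; set k := (size s).-1 in sM sn *.
have q0 : q%:R != 0 :> K by rewrite pnatr_eq0 -lt0n; apply/card_gt0P; exists 0.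
transitivity (\sum_(j < n./2.+1)
   (\sum_(d <- monics F j | d %| s) poly_phi (s %/ d)) / q%:R ^+ k); last first.
  by rewrite -mulr_suml (sum_poly_phi sM) // divff // expf_neq0.
apply: eq_bigr => j _; rewrite mulr_suml mulr_sumr big_seq_cond [RHS]big_seq_cond.
apply: eq_big => d; first by rewrite sq_part_dvd.
move=> /andP[dM d2f]; have dm := monics_monic dM.
have ds : d %| s by rewrite -sq_part_dvd.
rewrite /phi_weight sq_part_div // -/s (monics_size (monics_divp sM dM ds)) /=.
have jk : (j <= k)%N.
  by have := dvdp_leq (monics_neq0 sM) ds; rewrite (monics_size sM) (monics_size dM).
by rewrite -{2}(subnKC jk) exprD invfM exprVn mulrCA mulrA.
Qed.

Lemma separable_weight1 : (separable_poly (1 : {poly F}))%:R = 1 :> K.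
Proof. by rewrite separable_poly.unlock coprime1p. Qed.

Lemma phi_weight1 : phi_weight 1 = 1.
Proof.
have s1 : sq_part 1 = 1.
  by apply/eqP; rewrite -separable_sq_part ?monic1 // separable_poly.unlock coprime1p.
rewrite /phi_weight s1 size_poly1 expr0 divr1 /poly_phi size_poly1 /=.
rewrite -[RHS](expr0 (q%:R : K)) -sum_polys1; apply: eq_bigr => t _.
by rewrite coprime1p.
Qed.
End Weights.
End SquarePart.

(** * Closed forms of the squarefree and the maximal counts *)

Section ClosedForms.
Variables (F : finFieldType) (K : realFieldType).
Local Notation q := (#|F|%:R : K).
Local Notation r2 := (nroots K 2).
Implicit Types (a b c : F).

Lemma card_gt1 : 1 < q.
Proof. by rewrite ltr1n finNzRing_gt1. Qed.

Definition sqfree_count n b : K :=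
  weight_sum (fun f => (separable_poly f)%:R) n b.
Local Notation S := sqfree_count.
Definition phi_count n b : K := weight_sum (phi_weight K) n b.
Local Notation W := phi_count.

(** The recursion has step 2, with bases in degrees 1 and 2; [b] survives only from the base of even
    degree. *)
Lemma sqfree_countE n b : b != 0 ->
  S n.+1 b = (q ^+ n.+1 - (-1) ^+ n.+1) / (q + 1) - (odd n)%:R * (r2 b - 1).
Proof.
have q1 := card_gt1; have w1 := separable_weight1 F K.
have wS := fun n f fM (_ : f.[0] != 0) => @sqfree_weight_sum F K n f fM.
move=> b0; elim/ltn_ind: n => -[|[|n]] IH.
- by rewrite /S (weight_sum1 wS) //=; field; lra.
- by rewrite /S (weight_sum2 w1 wS) //=; field; lra.
rewrite /S (weight_sumS w1 wS) // -/(S n.+1 b) IH //= negbK.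
rewrite !exprS; field; lra.
Qed.

(** The fixed point of [x = 1 - q^-2 + q^-3 x], which is the recursion for [W n.+1 b / q ^+ n]. *)
Definition max_limit : K := 1 - 1 / (q ^+ 2 + q + 1).

Lemma phi_countE n b : b != 0 ->
  W n.+1 b / q ^+ n = max_limit + (q ^- 3) ^+ n./2 *
    (1 / (q ^+ 2 + q + 1) - (odd n)%:R * (r2 b / q ^+ 2)).
Proof.
have q1 := card_gt1; have w1 := phi_weight1 F K.
have wS := fun n f fM (_ : f.[0] != 0) => @phi_weight_sum F K n f fM.
have q0 : q != 0 by lra.
have l0 : q ^+ 2 + q + 1 != 0 by rewrite gt_eqF //; nra.
rewrite /max_limit => b0; elim/ltn_ind: n => -[|[|n]] IH.
- by rewrite /W (weight_sum1 wS) //=; field; rewrite q0 l0.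
- by rewrite /W (weight_sum2 w1 wS) //=; field; rewrite q0 l0.
rewrite /W (weight_sumS w1 wS) // -/(W n.+1 b).
have -> : W n.+1 b = (W n.+1 b / q ^+ n) * q ^+ n by rewrite mulfVK // expf_neq0.
rewrite IH // (_ : n.+2./2 = n./2.+1) // (_ : odd n.+2 = odd n) /= ?negbK //.
rewrite [(q ^- 3) ^+ _.+1]exprS; move: ((q ^- 3) ^+ _) (odd n)%:R => z t.
rewrite !exprS expr0.
have : q ^+ n != 0 by rewrite expf_neq0.
by move: (q ^+ n) => y y0; field; rewrite q0 l0.
Qed.

End ClosedForms.

(** * Counting the polynomials whose square part is linear and coprime to the cofactor *)

Section DoubleRoot.
Variables (F : finFieldType) (K : realFieldType).
Local Notation q := (#|F|%:R : K).
Local Notation r2 := (nroots K 2).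
Local Notation S := (@sqfree_count F K).
Implicit Types (a b c : F).

Lemma sum_monics_linear (G : {poly F} -> K) :
  \sum_(s <- monics F 1) G s = \sum_(a : F) G ('X - a%:P).
Proof.
rewrite sum_monicsS (reindex_inj (@oppr_inj F)); apply: eq_bigr => a _.
by rewrite monics0 big_cons big_nil addr0 mul1r polyCN.
Qed.

Definition sqfree_count_at a n b : K :=
  \sum_(h <- monics F n | h.[0] == b) (separable_poly h && ~~ root h a)%:R.
Local Notation Sa := sqfree_count_at.

Lemma sqfree_count_at0 a b : Sa a 0 b = (b == 1)%:R.
Proof.
rewrite /Sa monics0 big_cons big_nil hornerE root1 andbT.
rewrite separable_poly.unlock coprime1p addr0 eq_sym.
by case: eqP.
Qed.

(** The squarefree [h] vanishing at [a] are the [(X - a) g] with [g] squarefree and [g(a)] nonzero;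
    [g] then has constant term [b / - a]. *)
Lemma sqfree_countS a n b : a != 0 -> S n.+1 b = Sa a n.+1 b + Sa a n (b / - a).
Proof.
move=> a0; have XaM : 'X - a%:P \in monics F 1 by rewrite mem_monics monicXsubC size_XsubC.
have -> : Sa a n (b / - a) = \sum_(h <- monics F n.+1 | 'X - a%:P %| h)
     (if h.[0] == b then (separable_poly h)%:R else 0).
  rewrite (sum_monics_dvd _ XaM) // subn1 /= [LHS]big_mkcond; apply: eq_bigr => h _.
  rewrite [('X - _) * h]mulrC separable_root !hornerE.
  by rewrite -(inj_eq (mulIf (_ : - a != 0))) ?oppr_eq0 // divfK ?oppr_eq0.
rewrite /S /weight_sum /Sa [LHS]big_mkcond [X in X + _]big_mkcond.
rewrite [X in _ + X]big_mkcond -big_split /=; apply: eq_bigr => h _.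
rewrite dvdp_XsubCl; by case: (h.[0] == b); case: root; rewrite ?andbT ?andbF ?add0r ?addr0.
Qed.

(* These [f] are the [(X - a)^2 h] with [h] squarefree and [h(a) <> 0]. *)
Definition double_root_count n b : K :=
  \sum_(f <- monics F n | f.[0] == b)
    ((size (sq_part f) == 2%N) && coprimep (sq_part f) (f %/ sq_part f ^+ 2))%:R.

(** The density needs [e = 2] only. A general [e] is kept because each step of the
    inclusion-exclusion trades one degree [m] for one factor [- a]. *)
Definition double_root_sum m e b : K := \sum_(a : F | a != 0) Sa a m (b / (- a) ^+ e).
Local Notation E := double_root_sum.

(** At most one linear [s] has [s^2 %| f] with separable cofactor, namely the square part, so the
    count may be summed over [s = X - a]. *)
Lemma double_root_countE n b : b != 0 -> double_root_count n.+2 b = E n 2 b.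
Proof.
move=> b0; rewrite /double_root_count.
transitivity (\sum_(f <- monics F n.+2 | f.[0] == b) \sum_(s <- monics F 1 | s ^+ 2 %| f)
    (separable_poly (f %/ s ^+ 2) && coprimep s (f %/ s ^+ 2))%:R : K).
  rewrite big_seq_cond [RHS]big_seq_cond; apply: eq_bigr => f /andP[fM _].
  have fm := monics_monic fM; have [h [sm hm sep_h fE]] := sq_partP fm.
  have sf : sq_part f ^+ 2 %| f by rewrite sq_part_dvd.
  have hE : f %/ sq_part f ^+ 2 = h.
    by rewrite {1}fE mulrC mulpK // expf_neq0 // monic_neq0.
  have uniq_s s : s \in monics F 1 -> s ^+ 2 %| f -> separable_poly (f %/ s ^+ 2) ->
      s = sq_part f.
    move=> sM s2f sep; rewrite -{1}(divpK s2f) mulrC sq_partE ?(monics_monic sM) //.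
    by move: fm; rewrite -{1}(divpK s2f) monicMr // monic_exp // (monics_monic sM).
  case: eqVneq => [s2|s2] /=.
    have sM : sq_part f \in monics F 1 by rewrite mem_monics sm s2.
    rewrite [RHS]big_mkcond (bigD1_seq (sq_part f)) ?monics_uniq //= sf hE sep_h /=.
    rewrite big_seq_cond big1 ?addr0 // => s /andP[sM' sN]; case: ifP => // s2f.
    case: (boolP (separable_poly _)) => //= sep.
    by rewrite (uniq_s s) ?eqxx in sN.
  rewrite big_seq_cond big1 // => s /andP[sM s2f].
  case: (boolP (separable_poly _)) => //= sep; case/eqP: s2.
  by rewrite -(uniq_s s) // (monics_size sM).
rewrite (eq_bigr _ (fun f _ => big_mkcond _ _)) exchange_big /= big_seq.
under eq_bigr => s sM.
  have s2M : s ^+ 2 \in monics F 2 by rewrite expr2 (monicsM sM sM).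
  rewrite -big_mkcondr /= (eq_bigl (fun f => (s ^+ 2 %| f) && (f.[0] == b))); last first.
    by move=> f; rewrite andbC.
  rewrite big_mkcondr /= (sum_monics_dvd _ s2M) //.
  over.
rewrite -big_seq sum_monics_linear /E [RHS]big_mkcond.
apply: eq_bigr => a _ /=; rewrite !subSS subn0.
have Xa0 : 'X - a%:P != 0 by rewrite polyXsubC_eq0.
(* The root [a = 0] would force [f(0) = 0]. *)
case: eqVneq => [->|a0] /=.
  rewrite big1 // => g _; rewrite hornerM horner_exp hornerXsubC subrr expr0n mul0r.
  by rewrite eq_sym (negbTE b0).
rewrite /Sa [RHS]big_mkcond; apply: eq_bigr => g _.
rewrite hornerM horner_exp hornerXsubC sub0r.
rewrite -[g.[0] == _](inj_eq (mulfI (expf_neq0 2 (_ : - a != 0)))) ?oppr_eq0 //.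
rewrite [_ * (b / _)]mulrC divfK ?expf_neq0 ?oppr_eq0 //.
by rewrite [_ * g]mulrC mulpK ?expf_neq0 // coprimep_sym coprimep_XsubC.
Qed.

(** Each nonzero [c] is an [e]-th root of exactly one nonzero element. *)
Lemma sum_nroots e : (0 < e)%N -> \sum_(c : F | c != 0) nroots K e c = q - 1.
Proof.
move=> e0; rewrite -card_neq0 (exchange_big_dep xpredT) //=.
rewrite [RHS]big_mkcond; apply: eq_bigr => c _; case: eqVneq => [->|c0].
  by rewrite big1 // => d /andP[d0]; rewrite expr0n eqn0Ngt e0 /= eq_sym (negbTE d0).
rewrite (big_pred1 (c ^+ e)) // => d /=; rewrite [_ == d]eq_sym.
by case: (eqVneq d (c ^+ e)) => [->|_]; rewrite ?andbF ?andbT ?expf_neq0.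
Qed.

(** Modulo squares [b / a^e] is [b] for even [e] and [b / a] for odd [e]. In the odd case it runs
    over all nonzero elements, where [r2 - 1] sums to zero. *)
Lemma sum_sqfree_count m e b : b != 0 ->
  \sum_(a : F | a != 0) S m.+1 (b / (- a) ^+ e) =
  (q - 1) * ((q ^+ m.+1 - (-1) ^+ m.+1) / (q + 1)
              - (odd m && ~~ odd e)%:R * (r2 b - 1)).
Proof.
move=> b0; pose t := (q ^+ m.+1 - (-1) ^+ m.+1) / (q + 1).
transitivity (\sum_(a : F | a != 0) (t - (odd m)%:R * (r2 (b / a ^+ e) - 1))).
  rewrite (reindex_inj (@oppr_inj F)); apply: eq_big => a; first by rewrite oppr_eq0.
  rewrite oppr_eq0 => a0; rewrite sqfree_countE ?opprK //.
  by rewrite mulf_neq0 // invr_neq0 // expf_neq0.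
have -> (G : F -> K) : \sum_(a | a != 0) (t - (odd m)%:R * (G a - 1)) =
    (q - 1) * t - (odd m)%:R * (\sum_(a | a != 0) G a - (q - 1)).
  rewrite -card_neq0 mulr_suml -!sumrB mulr_sumr -sumrB.
  by apply: eq_bigr => a _; rewrite mul1r.
rewrite -/t [RHS]mulrBr; congr (_ - _).
case: (odd m) => /=; last by rewrite !mul0r mulr0.
case oe: (odd e) => /=.
  rewrite mul1r mul0r mulr0 -(sum_nroots (isT : (0 < 2)%N)).
  rewrite [X in _ - X](reindex_inj (mulfI b0)) [X in _ - X](reindex_inj (@invr_inj F)).
  apply/eqP; rewrite subr_eq0; apply/eqP/eq_big => a; rewrite ?mulf_eq0 ?invr_eq0 ?(negbTE b0) //.
  move=> a0; rewrite -(odd_double_half e) oe add1n exprS -muln2 exprM invfM mulrA.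
  by rewrite nroots2_sqr // expf_neq0.
rewrite !mul1r mulrBr mulr1; congr (_ - _); rewrite -card_neq0 mulr_suml.
apply: eq_bigr => a a0; rewrite mul1r.
by rewrite -(odd_double_half e) oe add0n -muln2 exprM nroots2_sqr // expf_neq0.
Qed.

(** Induction through [E m.+1 e = (sum of S) - E m e.+1]. The sum [m + e] is preserved, so the base
    [m = 0], where [h = 1] and [(- a)^e = b], leaves the roots of exponent [e + m] with an
    alternating sign. *)
Lemma double_root_sumE m e b : b != 0 -> (0 < e)%N ->
  E m e b = (q - 1) * (q ^+ m.+1 / (q + 1) ^+ 2
                        - (-1) ^+ m * (q / (q + 1) ^+ 2 + m%:R / (q + 1)))
   - (~~ odd (m + e))%:R * ((q - 1) * (r2 b - 1) * (-1) ^+ m * (m./2)%:R)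
   + (-1) ^+ m * nroots K (e + m) b.
Proof.
have q1 := card_gt1 F K.
move=> b0; elim: m e => [|m IH] e e0.
  rewrite (_ : (0./2)%:R = 0 :> K) // addn0 !mulr0 subr0 expr0 mul0r addr0 !mul1r.
  rewrite expr1 subrr mulr0 add0r.
  rewrite /E /nroots (reindex_inj (@oppr_inj F)) /= [LHS]big_mkcond [RHS]big_mkcond.
  apply: eq_bigr => a _; rewrite oppr_eq0 opprK sqfree_count_at0.
  case: eqVneq => [->|a0] /=; first by rewrite expr0n eqn0Ngt e0 /= eq_sym (negbTE b0).
  have -> : (b / a ^+ e == 1) = (a ^+ e == b).
    by apply/eqP/eqP => [/divr1_eq//|<-]; rewrite divff ?expf_neq0.
  by case: eqP.
have -> : E m.+1 e b = \sum_(a : F | a != 0) S m.+1 (b / (- a) ^+ e) - E m e.+1 b.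
  rewrite /E -sumrB; apply: eq_bigr => a a0.
  by rewrite (sqfree_countS _ _ a0) -mulrA -invfM -exprSr addrK.
rewrite sum_sqfree_count // IH // addSnnS -[m.+1./2]/(uphalf m) uphalf_half natrD.
rewrite !oddD /=; move: (nroots _ _ _) => r; move: (r2 b) => r'.
rewrite !exprS -[(-1) ^+ m]signr_odd.
case: (odd m); case: (odd e) => /=; rewrite -?natr1; field; lra.
Qed.
End DoubleRoot.

(** * Coefficient vectors as polynomials, and uniformity of residues *)

(** Coordinates go down in degree, as in [monic_of_coefs]. *)
Definition row_poly (A : comNzRingType) m (v : 'rV[A]_m) : {poly A} :=
  \sum_(i < m) v 0 i *: 'X^(m - i.+1).

Lemma size_row_poly (A : comNzRingType) m (v : 'rV[A]_m) :
  (size (row_poly v) <= m)%N.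
Proof.
rewrite (leq_trans (size_sum _ _ _)) //; apply/bigmax_leqP => i _.
rewrite (leq_trans (size_scale_leq _ _)) // size_polyXn -subSn ?ltn_ord //.
by rewrite subSS leq_subr.
Qed.

Lemma coef_row_poly (A : comNzRingType) m (v : 'rV[A]_m) (i : 'I_m) :
  (row_poly v)`_(m - i.+1) = v 0 i.
Proof.
rewrite coef_sum (bigD1 i) //= coefZ coefXn eqxx mulr1 big1 ?addr0 // => j ji.
rewrite coefZ coefXn; case: eqP => [e|]; last by rewrite mulr0.
case/eqP: ji; apply/val_inj => /=.
by have := ltn_ord i; have := ltn_ord j; lia.
Qed.

Section RowPolySums.
Variables (F : finFieldType) (K : realFieldType).
Local Notation q := (#|F|%:R : K).
Implicit Types G : {poly F} -> K.

Lemma sum_row_poly m G : \sum_(v : 'rV[F]_m) G (row_poly v) = \sum_(t <- polys F m) G t.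
Proof.
rewrite -big_enum /= -(big_map (fun v : 'rV[F]_m => row_poly v) xpredT).
have u : uniq [seq row_poly v | v <- enum 'rV[F]_m].
  rewrite map_inj_uniq ?enum_uniq // => v v' e.
  by apply/rowP => i; rewrite -!coef_row_poly e.
apply/perm_big/uniq_perm; rewrite ?polys_uniq // => t.
have [] // := uniq_min_size (s2 := polys F m) u.
  by move=> _ /mapP[v _ ->]; rewrite mem_polys size_row_poly.
by rewrite size_image size_map -cardE card_npoly card_mx mul1n.
Qed.

Lemma sum_monics_row_poly m b G :
  \sum_(f <- monics F m.+1 | f.[0] == b) G f =
  \sum_(v : 'rV[F]_m) G (('X^m + row_poly v) * 'X + b%:P).
Proof.
rewrite (sum_row_poly m (fun t => G (('X^m + t) * 'X + b%:P))) big_mkcond sum_monicsS.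
rewrite (bigD1 b) //= [X in _ + X]big1 ?addr0 => [|c cb].
  rewrite /monics /polys !big_map; apply: eq_bigr => t _.
  by rewrite hornerD hornerMX hornerC mulr0 add0r eqxx.
by rewrite big1 // => g _; rewrite hornerD hornerMX hornerC mulr0 add0r (negbTE cb).
Qed.

(** Since [s(0)] is nonzero, X is invertible modulo [s] and [t -> t X + c] permutes the residues
    modulo [s]; each residue has [q^(m - k)] representatives of size at most [m]. *)
Lemma sum_coprime_translate m k s c : s \in monics F k -> s.[0] != 0 -> (k <= m)%N ->
  \sum_(t <- polys F m) (coprimep s (t * 'X + c%:P))%:R = q ^+ (m - k) * poly_phi K s.
Proof.
move=> sM s0 km; have sn0 := monics_neq0 sM; have sk := monics_size sM.
have polysk t : t \in polys F k -> (size t < size s)%N by rewrite mem_polys sk ltnS.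
have modk t : t %% s \in polys F k by rewrite mem_polys -ltnS -sk ltn_modp.
(* Euclidean division by [s] splits [t] into a quotient [u] and a remainder. *)
transitivity (\sum_(u <- polys F (m - k)) \sum_(t <- polys F k)
    (coprimep s ((u * s + t) * 'X + c%:P))%:R : K).
  rewrite -(big_allpairs_dep (h := fun u t => u * s + t)
     (F := fun t => (coprimep s (t * 'X + c%:P))%:R : K)).
  apply/perm_big/uniq_perm; first exact: polys_uniq.
    have small v : v \in [seq (u, t) | u <- polys F (m - k), t <- polys F k] ->
        (size v.2 < size s)%N.
      by case/allpairsP => -[u t] [_ /= tk ->]; rewrite sk ltnS -mem_polys.
    apply: allpairs_uniq; rewrite ?polys_uniq // => -[u t] [u' t'].
    move=> /small /= tk /small /= t'k e.
    have et := congr1 (fun f => f %% s) e; rewrite /= !modp_addl_mul_small // in et.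
    by move: e; rewrite /= et => /addIr/(mulIf sn0) ->.
  move=> t; rewrite mem_polys; apply/idP/allpairsP => [tm|[[u t'] /= [um t'k ->]]].
    exists (t %/ s, t %% s); rewrite modk; split=> //=; last exact: divp_eq.
    by rewrite mem_polys size_divp // sk leq_sub2r.
  move: um t'k; rewrite !mem_polys => um t'k.
  rewrite (leq_trans (size_polyD _ _)) // geq_max (leq_trans t'k km) andbT.
  move: um (size_polyMleq u s) km; rewrite sk.
  by move: (size u) (size _) => x y; lia.
pose g t := (t * 'X + c%:P) %% s.
have H (u : {poly F}) :
    \sum_(t <- polys F k) (coprimep s ((u * s + t) * 'X + c%:P))%:R = poly_phi K s.
  rewrite /poly_phi sk /=.
  transitivity (\sum_(t <- [seq g t | t <- polys F k]) (coprimep s t)%:R : K).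
    rewrite [RHS]big_map; apply: eq_bigr => t _; rewrite /g coprimep_modr.
    by rewrite mulrDl mulrAC -addrA coprimep_addl_mul.
  have ug : uniq [seq g t | t <- polys F k].
    rewrite map_inj_in_uniq ?polys_uniq // => t t'.
    move=> /polysk tk /polysk t'k /eqP.
    rewrite -subr_eq0 -modpN -modpD opprD addrACA subrr addr0 -mulrBl => /eqP/modp_eq0P.
    rewrite Gauss_dvdpl; last by rewrite -['X]subr0 -polyC0 coprimep_XsubC.
    move=> /dvdp_leq H; apply/eqP; rewrite -subr_eq0; apply: contraT => /H.
    by rewrite leqNgt (leq_ltn_trans (size_polyD _ _)) // size_polyN gtn_max tk.
  apply/perm_big/uniq_perm; rewrite ?polys_uniq // => t.
  have sub : {subset [seq g t | t <- polys F k] <= polys F k}.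
    by move=> _ /mapP[v _ ->]; exact: modk.
  have sz : (size (polys F k) <= size [seq g t | t <- polys F k])%N.
    by rewrite [leqRHS]size_map.
  by have [_ ->] := uniq_min_size ug sub sz.
rewrite (eq_bigr _ (fun u _ => H u)) -sum_polys1 mulr_suml.
by under [RHS]eq_bigr do rewrite mul1r.
Qed.
End RowPolySums.

(** * Reduction of p-adic integers modulo p *)

Section PadicReduction.
Variables (p : nat) (pr : prime p).
Local Notation Zp := (padic_int pr).
Implicit Types x y : Zp.

Lemma residue_nat n k : residue (n%:R : Zp) k = (n %% p ^ k)%N.
Proof.
elim: n => [|n IH]; first by [].
by rewrite -natr1 -[in RHS]addn1 -modnDm -IH.
Qed.

Definition red x : 'F_p := (residue x 1)%:R.

Let natFp n : ((n %% p ^ 1)%N%:R : 'F_p) = n%:R.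
Proof. by rewrite expn1; apply: Fp_nat_mod. Qed.

Let redD x y : red (x + y) = red x + red y.
Proof. by rewrite /red -natrD -[RHS]natFp. Qed.

Lemma red_is_zmod_morphism : zmod_morphism red.
Proof. by move=> x y; rewrite -[in RHS](subrK y x) [in RHS]redD addrK. Qed.

Lemma red_is_monoid_morphism : monoid_morphism red.
Proof.
split=> [|x y]; rewrite /red.
  by rewrite (residue_nat 1 1) natFp.
by rewrite -natrM -[RHS]natFp.
Qed.

HB.instance Definition _ := GRing.isZmodMorphism.Build Zp 'F_p red red_is_zmod_morphism.
HB.instance Definition _ := GRing.isMonoidMorphism.Build Zp 'F_p red red_is_monoid_morphism.

Lemma red_p : red p%:R = 0.
Proof. by rewrite rmorph_nat; apply/eqP; rewrite -(dvdn_pcharf (pchar_Fp pr)). Qed.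

Lemma padic_p_neq0 : p%:R != 0 :> Zp.
Proof.
apply/eqP => /(congr1 (fun x : Zp => residue x 2)).
rewrite residue_nat -[RHS]/(0 %% p ^ 2)%N mod0n modn_small; last first.
  by rewrite -{1}[p]expn1 ltn_exp2l ?prime_gt1.
by move=> p0; have := prime_gt0 pr; rewrite p0.
Qed.

Lemma red_eq0_residue x : red x = 0 -> residue x 1 = 0%N.
Proof.
move/eqP; rewrite -(dvdn_pcharf (pchar_Fp pr)) => /eqP.
by have := residue_mod x 1; rewrite expn1 => ->.
Qed.

(** The quotient by [p] has [residue x k.+1 %/ p] as its residue modulo [p^k]. *)
Lemma red_eq0 x : red x = 0 -> exists y, x = p%:R * y.
Proof.
move=> /red_eq0_residue x0.
have px k : (p %| residue x k.+1)%N.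
  by have := residueD x 1 k; rewrite add1n x0 expn1 => /eqP.
have ok k : (residue x k.+2 %/ p)%N = (residue x k.+1 %/ p)%N %[mod p ^ k].
  have /dvdnP[a Ea] := px k.+1.
  by rewrite -(residueS x k.+1) Ea expnSr -muln_modl !(mulnK _ (prime_gt0 pr)) modn_mod.
exists (padic_of pr ok); apply: padic_eqP => k.
rewrite [RHS]residue_of [in RHS]residue_nat residue_of modnMml modnMmr.
by rewrite mulnC divnK // residueS.
Qed.

Definition padic_lift (a : 'F_p) : Zp := (a : nat)%:R.

Lemma padic_liftK : cancel padic_lift red.
Proof. by move=> a; rewrite rmorph_nat natr_Zp. Qed.

(** Euler's theorem inverts each residue modulo [p^k] by a power; uniqueness of inverses makes these
    coherent. *)
Lemma padic_unitE x : (x \is a GRing.unit) = (red x != 0).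
Proof.
apply/idP/idP => [xu|x0]; first by rewrite -unitfE rmorph_unit.
have copx k : coprime (residue x k) (p ^ k).
  case: k => [|k]; first by rewrite coprimen1.
  rewrite coprimeXr // coprime_sym prime_coprime //; apply: contra x0 => px.
  by rewrite -(dvdn_pcharf (pchar_Fp pr)) -(residueD x 1 k) add1n expn1 /dvdn modn_mod.
pose u k := (residue x k ^ (totient (p ^ k)).-1)%N.
have uE k : (u k * residue x k)%N = 1 %[mod p ^ k].
  by rewrite /u -expnSr prednK ?totient_gt0 ?expn_gt0 ?prime_gt0 // cyclic.Euler_exp_totient.
have uS k : u k.+1 = u k %[mod p ^ k].
  have e1 : (u k.+1 * residue x k)%N = 1 %[mod p ^ k].
    have pk : (p ^ k %| p ^ k.+1)%N by rewrite expnS dvdn_mull.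
    rewrite -(residueS x k) modnMmr.
    by have := congr1 (modn^~ (p ^ k)%N) (uE k.+1); rewrite /= !(modn_dvdm _ pk).
  by rewrite -[u k.+1]muln1 -modnMmr -(uE k) modnMmr mulnCA -modnMmr e1 modnMmr muln1.
apply/unitrP; exists (padic_of pr uS).
have vx : padic_of pr uS * x = 1.
  by apply: padic_eqP => k; rewrite !residue_of modnMml uE.
by split; rewrite ?vx // mulrC.
Qed.

(** Each division by [p] lowers the index of a nonvanishing residue, so a unit is reached. *)
Lemma padic_valuation x : x != 0 -> exists k u, u \is a GRing.unit /\ x = p%:R ^+ k * u.
Proof.
move=> x0; have [k xk] : exists k, residue x k != 0%N.
  apply/not_existsP => z; case/eqP: x0; apply: padic_eqP => k.
  by rewrite residue_of mod0n; move/negP/negbNE/eqP: (z k).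
elim: k x x0 xk => [|k IH] x x0 xk; first by case/eqP: xk; rewrite -(residue_mod x 0) modn1.
have [ux|] := boolP (x \is a GRing.unit); first by exists 0%N, x; rewrite mul1r.
rewrite padic_unitE negbK => /eqP/red_eq0[y xE].
have y0 : y != 0 by apply: contraNneq x0 => y0; rewrite xE y0 mulr0.
have [|j [u [uu yE]]] := IH y y0.
  apply: contraNneq xk => yk; rewrite xE residue_of residue_nat.
  rewrite modnMml.
  have -> : residue y k.+1 = (residue y k.+1 %/ p ^ k * p ^ k)%N.
    by rewrite {1}(divn_eq (residue y k.+1) (p ^ k)) residueS yk addn0.
  by rewrite mulnCA -expnS modnMl.
by exists j.+1, u; rewrite exprS -mulrA -yE.
Qed.

End PadicReduction.

(** * Haar measure of the residue classes modulo p^2 *)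

Section HaarCells.
Local Open Scope classical_set_scope.
Variables (p : nat) (pr : prime p) (m : nat).
Local Notation Zp := (padic_int pr).
Local Notation rho := (@red p pr).
Local Notation lift := (@padic_lift p pr).

Lemma residue_eq0 k (x : Zp) : residue x k = 0%N -> exists y, x = p%:R ^+ k * y.
Proof.
elim: k x => [|k IH] x xk; first by exists x; rewrite mul1r.
have x1 : rho x = 0.
  by rewrite /red -(residueD x 1 k) add1n xk mod0n.
have [y xE] := red_eq0 x1.
have [|z yE] := IH y; last by exists z; rewrite exprS -mulrA -yE.
have : (p ^ k.+1 %| p * residue y k.+1)%N.
  move: xk; rewrite xE residue_of residue_nat modnMml => /eqP.
  by [].
by rewrite expnS dvdn_pmul2l ?prime_gt0 // -(residueS y k) => /eqP.
Qed.

Lemma residue_eq k (x y : Zp) : residue x k = residue y k ->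
  exists z, x = y + p%:R ^+ k * z.
Proof.
move=> xy; have : residue (x - y) k = 0%N.
  have := congr1 (fun z : Zp => residue z k) (subrr y).
  by rewrite !residue_of mod0n xy.
by case/residue_eq0 => z zE; exists z; rewrite -zE addrC subrK.
Qed.

Lemma map_red_eq0 n (u : 'rV[Zp]_n) : map_mx rho u = 0 -> exists w, u = p%:R *: w.
Proof.
move=> /matrixP u0; exists (\row_j xget 0 [set z | u 0 j = p%:R * z]).
apply/rowP => j; rewrite !mxE; have := u0 0 j; rewrite !mxE => /red_eq0 ex.
by rewrite -(xgetPex 0 ex).
Qed.

Definition cell (c : 'rV[Zp]_m) : set 'rV[Zp]_m :=
  [set c + p%:R ^+ 2 *: w | w in [set: 'rV[Zp]_m]].

Lemma cell_open c : open (cell c).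
Proof.
rewrite openE => _ [w _ <-].
set v := c + _; exists (fun i j => padic_ball (v i j) 2).
  by move=> i j; exists 2%N.
move=> u /= uv.
pose W := \row_j xget 0 [set z | u 0 j = v 0 j + p%:R ^+ 2 * z].
exists (w + W) => //; apply/rowP => j; rewrite scalerDr addrA -/v mxE [in X in _ + X = _]mxE.
rewrite [W 0 j]mxE; have /residue_eq ex := uv 0 j.
by rewrite -(xgetPex 0 ex).
Qed.

Lemma cell_measurable c : measurable (cell c : set (padic_space pr m)).
Proof. by apply: sub_sigma_algebra; apply: cell_open. Qed.

Lemma map_liftK (r : 'rV['F_p]_m) : map_mx rho (map_mx lift r) = r.
Proof. by apply/rowP => j; rewrite 2!mxE padic_liftK. Qed.

Variables (l : 'rV['F_p]_m -> 'rV[Zp]_m) (lK : forall v, map_mx rho (l v) = v).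

(** The first digit enters through an arbitrary section [l] of the reduction. Taking [fiber_lift]
    for [l] later makes the second digit the remainder [R] directly. *)
Definition digit_cell (d : 'rV['F_p]_m * 'rV['F_p]_m) : set 'rV[Zp]_m :=
  cell (l d.1 + p%:R *: map_mx lift d.2).

Lemma digit_cell_inj v d d' : digit_cell d v -> digit_cell d' v -> d = d'.
Proof.
case: d d' => [d1 d2] [d1' d2'] [w _ <-] [w' _] e.
have red_pZ u : map_mx rho (p%:R *: u) = 0 :> 'rV_m.
  by apply/rowP => j; rewrite !mxE rmorphM /= red_p mul0r.
have e1 : d1' = d1.
  have := congr1 (map_mx rho) e.
  by rewrite !map_mxD /= expr2 -!scalerA !red_pZ !addr0 !lK.
rewrite /= e1 -!addrA in e *; congr (_, _); move/addrI: e.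
rewrite expr2 -!scalerA -!scalerDr => /matrixP e; apply/rowP => j.
have := e 0 j; rewrite !mxE => /(mulfI (padic_p_neq0 pr)) /(congr1 rho).
by rewrite !rmorphD !rmorphM /= red_p !mul0r !addr0 !padic_liftK.
Qed.

Lemma digit_cell_cover v : exists d, digit_cell d v.
Proof.
have [|w1 w1E] := @map_red_eq0 m (v - l (map_mx rho v)).
  by rewrite map_mxB lK subrr.
have [|w2 w2E] := @map_red_eq0 m (w1 - map_mx lift (map_mx rho w1)).
  by rewrite map_mxB map_liftK subrr.
exists (map_mx rho v, map_mx rho w1), w2 => //=.
by rewrite expr2 -scalerA -w2E -addrA -scalerDr [_ + (w1 - _)]addrC subrK -w1E addrC subrK.
Qed.

Variable R : realType.
Variables (mu : {measure set (padic_space pr m) -> \bar R}) (mu_haar : is_haar mu).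

Let mu_cell c : mu (cell c) = mu (cell 0).
Proof.
rewrite -[RHS](mu_haar.2 c); last exact: cell_measurable.
congr (mu _); apply/seteqP; split => [_ [w _ <-]|_ [_ [w _ <-] <-]].
  by exists (p%:R ^+ 2 *: w); rewrite // -[X in cell 0 X]add0r; exists w.
by exists w; rewrite ?add0r.
Qed.

Lemma digit_cells_measure (P : pred ('rV['F_p]_m * 'rV['F_p]_m)) :
  mu [set v | exists2 d, P d & digit_cell d v] = (mu (cell 0) *+ #|P|)%E.
Proof.
pose r := enum P.
have -> : [set v | exists2 d, P d & digit_cell d v] = \bigcup_(d in [set` r]) digit_cell d.
  by apply/seteqP; split => v [d Pd dv]; exists d => //=; move: Pd; rewrite /= mem_enum.
rewrite measure_fin_bigcup; last by move=> d _; apply: cell_measurable.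
- rewrite -fsbig_seq ?enum_uniq // (eq_bigr (fun=> mu (cell 0))) => [|d _]; last exact: mu_cell.
  by rewrite big_enum /= sumr_const.
- exact: finite_seq.
- by move=> d d' _ _ [v [dv d'v]]; apply: digit_cell_inj dv d'v.
Qed.

(** The cells are translates of one another, so they have equal measure, and [Q] is a union of
    them. *)
Lemma haar_count (Q : set 'rV[Zp]_m) (T : 'rV['F_p]_m -> 'rV['F_p]_m -> bool) :
  (forall c r w, Q (l c + p%:R *: map_mx lift r + p%:R ^+ 2 *: w) <-> T c r) ->
  fine (mu Q) / fine (mu setT) =
    (\sum_c \sum_r (T c r)%:R) / (p%:R ^+ m * p%:R ^+ m).
Proof.
move=> QT.
have QE : Q = [set v | exists2 d, T d.1 d.2 & digit_cell d v].
  apply/seteqP; split=> v => [|[d Td [w _ <-]]]; last exact/QT.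
  by have [d [w _ <-]] := digit_cell_cover v; move=> /QT Td; exists d => //; exists w.
have TE : [set: 'rV[Zp]_m] = [set v | exists2 d, predT d & digit_cell d v].
  by apply/seteqP; split=> // v _; have [d dv] := digit_cell_cover v; exists d.
pose n := #|[pred d | T d.1 d.2]|; pose N := #|{: 'rV['F_p]_m * 'rV['F_p]_m}|.
have muQ : mu Q = (mu (cell 0) *+ n)%E by rewrite QE -digit_cells_measure.
have muT : mu setT = (mu (cell 0) *+ N)%E.
  by rewrite [X in mu X]TE digit_cells_measure; congr (_ *+ _)%E; apply: eq_card.
have N0 : (0 < N)%N by apply/card_gt0P; exists (0, 0).
have := mu_haar.1; rewrite muQ muT.
have -> : \sum_c \sum_r (T c r)%:R = n%:R :> R.
  rewrite pair_big /= /n -sum1_card natr_sum [RHS]big_mkcond.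
  by apply: eq_bigr => d _; rewrite inE; case: (T _ _).
have -> : p%:R ^+ m * p%:R ^+ m = N%:R :> R.
  by rewrite /N card_prod !card_mx card_Fp // mul1n natrM !natrX.
(* The [N] cells have total measure 1, so the measure of one cell is finite and nonzero. *)
clear -N0; move: n N N0 => n; case=> // N _; case: (mu (cell 0)) => [x| |].
- rewrite -!EFin_natmul /= => -[xN].
  have x0 : x != 0 by apply: contra_eqN xN => /eqP ->; rewrite mul0rn eq_sym oner_eq0.
  by rewrite -[x *+ n]mulr_natl -[x *+ _]mulr_natl -mulf_div divff ?mulr1.
- by rewrite enatmul_pinfty.
- by rewrite enatmul_ninfty.
Qed.
End HaarCells.

Lemma sum_congr_mod (A : comNzRingType) (b : A) (I : finType) (P : pred I) (F G : I -> A) :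
  (forall i, exists e, F i = G i + b * e) ->
  exists e, \sum_(i | P i) F i = \sum_(i | P i) G i + b * e.
Proof.
move=> FG; elim/big_rec2: _ => [|i x y _ [e ->]]; first by exists 0; rewrite mulr0 addr0.
by have [e' ->] := FG i; exists (e + e'); ring.
Qed.

Lemma prod_congr_mod (A : comNzRingType) (b : A) (I : finType) (P : pred I) (F G : I -> A) :
  (forall i, exists e, F i = G i + b * e) ->
  exists e, \prod_(i | P i) F i = \prod_(i | P i) G i + b * e.
Proof.
move=> FG; elim/big_rec2: _ => [|i x y _ [e ->]]; first by exists 0; rewrite mulr0 addr0.
by have [e' ->] := FG i; exists (G i * e + e' * x + b * e' * e); ring.
Qed.

(** It yields the equation of integrality of [a / b] in the form [a^r + b e], without dividing by
    [b]. *)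
Lemma det_scalar_congr (A : comNzRingType) (a b : A) n (M : 'M[A]_n) :
  exists e, \det (a%:M - b *: M) = a ^+ n + b * e.
Proof.
rewrite -det_scalar; apply: sum_congr_mod => s.
have [|e ->] := @prod_congr_mod A b 'I_n xpredT (fun i => (a%:M - b *: M) i (s i))
   (fun i => (a%:M : 'M[A]_n) i (s i)).
  by move=> i; exists (- M i (s i)); rewrite !mxE mulrN.
by exists ((-1) ^+ s * e); rewrite mulrDr mulrCA.
Qed.

(** * Reduction and lifting of polynomials *)

Section PolyReduction.
Variables (p : nat) (pr : prime p).
Local Notation Zp := (padic_int pr).
Local Notation redp := (map_poly (@red p pr)).
Implicit Types f g : {poly Zp}.

Lemma redp_p : redp p%:R = 0.
Proof. by rewrite -polyC_natr map_polyC /= red_p polyC0. Qed.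

Lemma redp_eq0 f : redp f = 0 -> exists g, f = p%:R * g.
Proof.
move=> f0; have ex i : exists y, f`_i = p%:R * y.
  by apply: red_eq0; rewrite -coef_map f0 coef0.
exists (\poly_(i < size f) xget 0 [set y | f`_i = p%:R * y]%classic).
apply/polyP => i; rewrite -polyC_natr coefCM coef_poly.
case: ltnP => [_|/leq_sizeP]; last by move=> ->; rewrite ?mulr0.
exact: (xgetPex 0 (ex i)).
Qed.

Lemma redp_eq f g : redp f = redp g -> exists h, f = g + p%:R * h.
Proof.
move=> fg; have [|h hE] := @redp_eq0 (f - g); first by rewrite rmorphB /= fg subrr.
by exists h; rewrite -hE addrC subrK.
Qed.

Lemma poly_mul_p_inj f g : p%:R * f = p%:R * g -> f = g.
Proof. by apply: mulfI; rewrite -polyC_natr polyC_eq0 padic_p_neq0. Qed.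

Definition poly_lift (g : {poly 'F_p}) : {poly Zp} := \poly_(i < size g) padic_lift pr g`_i.

Lemma poly_liftK (g : {poly 'F_p}) : redp (poly_lift g) = g.
Proof.
apply/polyP => i; rewrite coef_map coef_poly; case: ltnP => [_|/leq_sizeP ->//].
  exact: padic_liftK.
by rewrite raddf0.
Qed.

Lemma poly_lift_monic (g : {poly 'F_p}) : g \is monic ->
  poly_lift g \is monic /\ size (poly_lift g) = size g.
Proof.
move=> gm; have lc : padic_lift pr (lead_coef g) = 1.
  rewrite (monicP gm) /padic_lift /= Fp_cast // modn_small ?prime_gt1 //.
have sg : (size g).-1.+1 = size g by rewrite prednK // size_poly_gt0 monic_neq0.
have sl : size (poly_lift g) = size g.
  by rewrite size_poly_eq // -lead_coefE lc oner_eq0.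
split=> //; rewrite monicE lead_coefE sl coef_poly -sg ltnSn /= -lead_coefE.
by rewrite lc.
Qed.

Lemma size_redp_monic f : f \is monic -> size (redp f) = size f.
Proof. by move=> fm; rewrite size_map_poly_id0 // (monicP fm) rmorph1 oner_eq0. Qed.

Lemma redp_monic f : f \is monic -> redp f \is monic.
Proof. exact: monic_map. Qed.
End PolyReduction.

(** * The algebra Q_p[x]/(f) and its orders *)

Section QuotientOrder.
Variables (p : nat) (pr : prime p).
Local Notation Zp := (padic_int pr).
Local Notation Qp := {fraction Zp}.
Local Notation redp := (map_poly (@red p pr)).
Local Notation tofrac := (@FracField.tofrac Zp).
Variable f : {poly Zp}.
Hypotheses (f_monic : f \is monic) (f_size : (1 < size f)%N).
Local Notation K := {poly %/ to_Qp f}.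
Implicit Types g h : {poly Zp}.

HB.instance Definition _ := GRing.RMorphism.copy (@to_Qp p pr) (map_poly tofrac).

Lemma tofrac_nat n : tofrac n%:R = n%:R.
Proof. exact: rmorph_nat. Qed.

Lemma to_Qp_nat n : to_Qp (n%:R : {poly Zp}) = n%:R.
Proof. exact: rmorph_nat. Qed.

Lemma to_QpX : to_Qp ('X : {poly Zp}) = 'X.
Proof. exact: map_polyX. Qed.

Lemma to_QpC (c : Zp) : to_Qp c%:P = (tofrac c)%:P.
Proof. exact: map_polyC. Qed.

Definition quot_class : {poly Zp} -> K := in_qpoly (to_Qp f) \o @to_Qp p pr.
HB.instance Definition _ := GRing.RMorphism.on quot_class.
Local Notation io := quot_class.

Lemma tofrac_inj : injective tofrac.
Proof. by move=> x y /eqP; rewrite tofrac_eq => /eqP. Qed.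

Let size_toQp g : size (to_Qp g) = size g.
Proof. by rewrite size_map_inj_poly ?rmorph0 //; apply: tofrac_inj. Qed.

Lemma mk_monic_toQp : mk_monic (to_Qp f) = to_Qp f.
Proof. by rewrite /mk_monic size_toQp f_size monic_map. Qed.

(** Division by the monic [f] takes place over Z_p already, so the kernel is generated by [f] over
    Z_p. *)
Lemma quot_class_eq0 g : io g = 0 <-> exists k, g = k * f.
Proof.
have iof : io f = 0.
  apply/val_inj; rewrite /= mk_monic_toQp /to_Qp.
  by rewrite Pdiv.RingMonic.rmodpp // monic_map.
split=> [g0|[k ->]]; last by rewrite rmorphM /= iof mulr0.
have gE := Pdiv.RingMonic.rdivp_eq f_monic g.
have : io (Pdiv.Ring.rmodp g f) = 0.
  by move: g0; rewrite {1}gE rmorphD rmorphM /= iof mulr0 add0r.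
move=> /(congr1 val) /=; rewrite mk_monic_toQp Pdiv.Ring.rmodp_small; last first.
  by rewrite !size_toQp Pdiv.Ring.ltn_rmodpN0 // monic_neq0.
move=> r0; exists (Pdiv.Ring.rdivp g f); rewrite [LHS]gE.
suff -> : Pdiv.Ring.rmodp g f = 0 by rewrite addr0.
by apply: (map_inj_poly tofrac_inj) => //; rewrite ?rmorph0.
Qed.

Lemma frac_numden (a : Qp) : exists n d, d != 0 /\ tofrac d * a = tofrac n.
Proof.
elim/quotW: a => x; exists (frac x).1, (frac x).2; split; first exact: denom_ratioP.
unlock FracField.tofrac; rewrite -[LHS]FracField.pi_mul; apply/eqmodP => /=.
rewrite FracField.equivfE /FracField.mulf.
by rewrite !numden_Ratio ?(oner_eq0, mulf_neq0, denom_ratioP) // !mulr1 mul1r mulrC.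
Qed.

Lemma frac_denominator (a : Qp) : exists k b, p%:R ^+ k * a = tofrac b.
Proof.
have [n [d [d0 da]]] := frac_numden a.
have [k [u [uu dE]]] := padic_valuation d0.
exists k, (u^-1 * n).
rewrite rmorphM /= -da mulrA -rmorphM /= dE mulrCA mulVr // mulr1.
by rewrite tofracXn tofrac_nat.
Qed.

Lemma poly_denominator (P : {poly Qp}) : exists k g, p%:R ^+ k * P = to_Qp g.
Proof.
elim/poly_ind: P => [|P c [k [g kg]]].
  by exists 0%N, 0; rewrite mulr0 /to_Qp rmorph0.
have [l [b lb]] := frac_denominator c.
exists (k + l)%N, (p%:R ^+ l * g * 'X + (p%:R ^+ k * b)%:P).
rewrite rmorphD !rmorphM rmorphXn /= to_Qp_nat -kg to_QpX !to_QpC.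
rewrite tofracXn tofrac_nat -lb exprD polyCM !polyC_exp !polyC_natr.
by move: (p%:R ^+ k) (p%:R ^+ l) => A B; ring.
Qed.

Lemma quot_denominator (x : K) : exists k g, p%:R ^+ k * x = io g.
Proof.
have [k [g kg]] := poly_denominator (val x).
have xE : in_qpoly (to_Qp f) (val x) = x.
  by apply/val_inj/in_qpoly_small; exact: size_mk_monic.
by exists k, g; rewrite /quot_class /= -kg rmorphM rmorphXn /= rmorph_nat xE.
Qed.

Lemma quot_scale c (x : K) : tofrac c *: x = io c%:P * x.
Proof.
rewrite -[x in LHS]mul1r scalerAl; congr (_ * _).
by rewrite /quot_class /= to_QpC -[_%:P]mulr1 mul_polyC in_qpolyZ in_qpoly1.
Qed.

Lemma quot_p_inj (x y : K) : p%:R * x = p%:R * y -> x = y.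
Proof.
have p0 : p%:R != 0 :> Qp.
  by rewrite -tofrac_nat tofrac_eq0 padic_p_neq0.
move=> e; rewrite -[x]scale1r -[y]scale1r -(mulVf p0) -!scalerA !scaler_nat.
by rewrite -[x *+ p]mulr_natl -[y *+ p]mulr_natl e.
Qed.
End QuotientOrder.

Section Orders.
Local Open Scope classical_set_scope.
Variables (p : nat) (pr : prime p).
Local Notation Zp := (padic_int pr).
Local Notation redp := (map_poly (@red p pr)).
Local Notation tofrac := (@FracField.tofrac Zp).
Variable f : {poly Zp}.
Hypotheses (f_monic : f \is monic) (f_size : (1 < size f)%N).
Local Notation K := {poly %/ to_Qp f}.
Local Notation io := (quot_class f).
Implicit Types g h : {poly Zp}.

Lemma quot_classM g h : io (g * h) = io g * io h.
Proof. exact: rmorphM. Qed.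

Lemma quot_classD g h : io (g + h) = io g + io h.
Proof. exact: rmorphD. Qed.

Lemma quot_classB g h : io (g - h) = io g - io h.
Proof. exact: rmorphB. Qed.

Lemma quot_class0 : io 0 = 0.
Proof. exact: rmorph0. Qed.

Lemma quot_class1 : io 1 = 1.
Proof. exact: rmorph1. Qed.

(* Integrality over [Zp] of [y = a / b], with denominators cleared. *)
Lemma order_integral (O : set K) (y : K) (a b : {poly Zp}) :
  is_order (K := Qp_quotient f) O -> O y -> io b * y = io a ->
  exists r e k, a ^+ r + b * e = k * f.
Proof.
move=> [one_in OB OM [r [e OE]] _] Oy by_a.
have Oe j : O (e j).
  rewrite OE; exists (fun i => (i == j)%:R) => //=.
  rewrite (bigD1 j) //= eqxx rmorph1 scale1r big1 ?addr0 // => i /negbTE ->.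
  by rewrite rmorph0 scale0r.
have yeP j : exists c : 'I_r -> Zp, \sum_(i < r) tofrac (c i) *: e i = y * e j.
  by have := OM _ _ Oy (Oe j); rewrite OE => -[c _ <-]; exists c.
have [c cE] := choice yeP.
(* [M] describes multiplication by [y] on the generators [e], so [a - b M] kills the column of the
   generators. *)
pose M : 'M[Zp]_r := \matrix_(j, i) c j i.
pose N : 'M[{poly Zp}]_r := a%:M - b *: map_mx polyC M.
pose E : 'cV[K]_r := \col_j e j.
have NE : map_mx io N *m E = 0.
  apply/colP => j; rewrite !mxE.
  transitivity (io a * e j - io b * (y * e j)); last by rewrite mulrA by_a subrr.
  rewrite -cE mulr_sumr (eq_bigr (fun i => io (a *+ (j == i)) * e i -
      io b * (io (c j i)%:P * e i))).
    rewrite sumrB (bigD1 j) //= eqxx big1 ?addr0 ?mulr1n.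
      by congr (_ - _); apply: eq_bigr => i _; rewrite quot_scale.
    by move=> i ij; rewrite eq_sym (negbTE ij) mulr0n rmorph0 mul0r.
  move=> i _; have -> : map_mx io N j i = io (a *+ (j == i)) - io b * io (c j i)%:P.
    by rewrite mxE -rmorphM -rmorphB /= !mxE.
  by rewrite [E i 0]mxE mulrBl -mulrA.
(* The adjugate turns [N E = 0] into annihilation of every generator by the determinant; since 1 is
   a combination of them, the determinant vanishes in [K]. *)
have detE j : io (\det N) * e j = 0.
  have := congr1 (fun X => (\adj (map_mx io N) *m X) j 0) NE.
  by rewrite mulmxA mul_adj_mx mulmx0 mul_scalar_mx det_map_mx !mxE.
have : io (\det N) = 0.
  move: one_in; rewrite OE => -[d _ d1]; rewrite -[LHS]mulr1 -d1 mulr_sumr big1 // => i _.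
  by rewrite -scalerAr detE scaler0.
move=> /(quot_class_eq0 f_monic f_size) [k kE].
by have [s sE] := det_scalar_congr a b (map_mx polyC M); exists r, s, k; rewrite -sE.
Qed.

Definition adjoin_order (beta : K) : set K := [set x | exists g h, x = io g + beta * io h].

Lemma quot_class_span g : exists c : 'I_(size f).-1 -> Zp,
  io g = \sum_i tofrac (c i) *: io 'X^i.
Proof.
pose r := Pdiv.Ring.rmodp g f.
have rs : (size r <= (size f).-1)%N.
  by rewrite -ltnS prednK ?(ltnW f_size) // Pdiv.Ring.ltn_rmodpN0 // monic_neq0.
exists (fun i => r`_i); transitivity (io r).
  have z : io (Pdiv.Ring.rdivp g f * f) = 0.
    by apply/(quot_class_eq0 f_monic f_size); exists (Pdiv.Ring.rdivp g f).
  by rewrite {1}(Pdiv.RingMonic.rdivp_eq f_monic g) rmorphD /= z add0r.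
have rE : r = \sum_(i < (size f).-1) (r`_i)%:P * 'X^i.
  transitivity (\poly_(i < (size f).-1) r`_i).
    apply/polyP => j; rewrite coef_poly; case: ltnP => // nj.
    exact/nth_default/(leq_trans rs nj).
  by rewrite poly_def; apply: eq_bigr => i _; rewrite mul_polyC.
rewrite [in LHS]rE rmorph_sum; apply: eq_bigr => i _.
by rewrite quot_scale -quot_classM.
Qed.

Lemma quot_class_p : io p%:R = p%:R.
Proof. exact: rmorph_nat. Qed.

(** The quadratic relation closes the set under products, and the [x^i] and [beta x^i] with
    [i < deg f] generate it. *)
Lemma adjoin_order_is_order beta a b :
  beta * beta = beta * io a + io b -> is_order (K := Qp_quotient f) (adjoin_order beta).
Proof.
move=> beta2; split.
- by exists 1, 0; rewrite quot_class0 mulr0 addr0 quot_class1.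
- move=> _ _ [g [h ->]] [g' [h' ->]]; exists (g - g'), (h - h').
  by rewrite !quot_classB mulrBr opprD addrACA.
- move=> _ _ [g [h ->]] [g' [h' ->]].
  exists (g * g' + b * h * h'), (g * h' + h * g' + a * h * h').
  rewrite !quot_classD !quot_classM.
  rewrite -[LHS]/((io g + beta * io h) * (io g' + beta * io h') : K).
  transitivity (io g * io g' + beta * (io g * io h' + io h * io g') +
                  beta * beta * (io h * io h') : K); first by ring.
  by rewrite beta2; ring.
- pose n := (size f).-1.
  exists (n + n)%N, (fun i => match fintype.split i with
    | inl j => io 'X^j | inr j => beta * io 'X^j end).
  apply/seteqP; split=> x.
    move=> [g [h ->]]; have [c cE] := quot_class_span g; have [d dE] := quot_class_span h.
    exists (fun i => match fintype.split i with inl j => c j | inr j => d j end) => //=.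
    rewrite big_split_ord /= cE dE mulr_sumr; congr (_ + _); apply: eq_bigr => i _.
      by rewrite (unsplitK (inl _ i)).
    by rewrite (unsplitK (inr _ i)) scalerAr.
  move=> [c _ <-]; rewrite big_split_ord /=.
  exists (\sum_(i < n) (c (lshift n i))%:P * 'X^i), (\sum_(i < n) (c (rshift n i))%:P * 'X^i).
  rewrite !rmorph_sum mulr_sumr; congr (_ + _); apply: eq_bigr => i _.
    by rewrite (unsplitK (inl _ i)) quot_scale -quot_classM.
  by rewrite (unsplitK (inr _ i)) quot_scale mulrCA -quot_classM.
- move=> x; have [k [g kg]] := quot_denominator x.
  exists (p%:R ^+ k)^-1, (io g).
    by exists g, 0; rewrite quot_class0 mulr0 addr0.
  have <- : p%:R ^+ k *: x = io g.
    rewrite -kg -tofrac_nat -tofracXn quot_scale polyC_exp polyC_natr.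
    by rewrite rmorphXn rmorph_nat.
  by rewrite scalerA mulVf ?scale1r // expf_neq0 // -tofrac_nat tofrac_eq0 padic_p_neq0.
Qed.

Lemma Zp_quotientE : @Zp_quotient p pr f = adjoin_order 0.
Proof.
apply/seteqP; split=> [_ [g _ <-]|_ [g [h ->]]].
  by exists g, 0; rewrite mul0r addr0.
by exists g => //; rewrite mul0r addr0.
Qed.

Lemma Zp_quotient_is_order : is_order (@Zp_quotient p pr f).
Proof.
rewrite Zp_quotientE; apply: (@adjoin_order_is_order _ 0 0).
by rewrite !mul0r quot_class0 addr0.
Qed.

Lemma redp_mul_p g : redp (p%:R * g) = 0.
Proof. by rewrite rmorphM /= redp_p mul0r. Qed.

Lemma redp_dvd_lift (q : {poly 'F_p}) g : q %| redp g ->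
  exists h k, g = poly_lift pr q * h + p%:R * k.
Proof.
move=> /divpK qg; have [|k kE] := @redp_eq p pr g (poly_lift pr q * poly_lift pr (redp g %/ q)).
  by rewrite rmorphM /= !poly_liftK mulrC.
by exists (poly_lift pr (redp g %/ q)), k.
Qed.

(** The obstruction in Dedekind's criterion does not depend on the expansion of [f]. Modulo [p],
    [q^2] divides [f = S^2 H] with [H] squarefree, hence [q] divides [S]. *)
Lemma sqfree_lift_dvd (S H R u v r : {poly Zp}) (q : {poly 'F_p}) :
  separable_poly (redp H) -> redp S != 0 -> f = S ^+ 2 * H + p%:R * R ->
  f = u * v + p%:R * r -> q %| redp u -> q %| redp v -> q %| redp r ->
  q %| redp S /\ q %| redp R.
Proof.
move=> sep_h s0 fE fE' /redp_dvd_lift[u1 [u2 uE]] /redp_dvd_lift[v1 [v2 vE]].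
move=> /redp_dvd_lift[r1 [r2 rE]].
set Q := poly_lift pr q in uE vE rE; have QE : redp Q = q by apply: poly_liftK.
have qS : q %| redp S.
  apply: (sqfree_dvd_sqr s0 sep_h).
  have := congr1 redp fE'; rewrite {1}fE !rmorphD /= !redp_mul_p !addr0 rmorphM rmorphXn /= => ->.
  rewrite rmorphM uE vE !rmorphD /= !redp_mul_p !addr0 !rmorphM /= QE expr2.
  by apply: dvdp_mul; apply: dvdp_mulIl.
split=> //; have [S1 [S2 SE]] := redp_dvd_lift qS; rewrite -/Q in SE.
have q0 : q ^+ 2 != 0.
  by rewrite expf_neq0 //; apply: contraNneq s0 => q0; move: qS; rewrite q0 dvd0p.
(* Comparing the two expansions modulo [p ^ 2] divides [R] by [Q] modulo [p]. *)
pose X := u1 * v2 + u2 * v1 + r1 - 2%:R * S1 * S2 * H.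
pose Y := u2 * v2 + r2 - S2 ^+ 2 * H.
have e : Q ^+ 2 * (S1 ^+ 2 * H - u1 * v1) = p%:R * (Q * X + p%:R * Y - R).
  have := fE'; rewrite {1}fE uE vE rE SE /X /Y => e.
  apply/eqP; rewrite -subr_eq0; move/eqP: e; rewrite -subr_eq0 => /eqP e; apply/eqP.
  by rewrite -[RHS]e; ring.
have /redp_eq0[Z ZE] : redp (S1 ^+ 2 * H - u1 * v1) = 0.
  have := congr1 redp e; rewrite redp_mul_p rmorphM rmorphXn /= QE => /eqP.
  by rewrite mulf_eq0 (negbTE q0) => /eqP.
move: e; rewrite ZE mulrCA => /poly_mul_p_inj e.
have -> : R = Q * (X - Q * Z) + p%:R * Y.
  apply/eqP; rewrite -subr_eq0; move/eqP: e; rewrite -subr_eq0 => /eqP e; apply/eqP.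
  by rewrite -[RHS]e; ring.
by rewrite rmorphD /= redp_mul_p addr0 rmorphM /= QE dvdp_mulIl.
Qed.

End Orders.

Lemma coprimep_dvd_exp (F : fieldType) (u v : {poly F}) m :
  v %| u ^+ m -> coprimep v u -> size v = 1%N.
Proof.
move=> vu /(coprimep_expr m) cop; apply/eqP.
by rewrite -dvdp1 -(Gauss_dvdpr 1 cop) mulr1.
Qed.

(** * Dedekind's criterion *)

Section Dedekind.
Local Open Scope classical_set_scope.
Variables (p : nat) (pr : prime p).
Local Notation Zp := (padic_int pr).
Local Notation Qp := {fraction Zp}.
Local Notation redp := (map_poly (@red p pr)).
Variable f : {poly Zp}.
Hypotheses (f_monic : f \is monic) (f_size : (1 < size f)%N).
Local Notation K := {poly %/ to_Qp f}.
Local Notation io := (quot_class f).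
Variables (S H R : {poly Zp}).
Hypotheses (sep_h : separable_poly (redp H)) (fE : f = S ^+ 2 * H + p%:R * R).

Let redp_f : redp f = redp S ^+ 2 * redp H.
Proof. by rewrite {1}fE rmorphD /= redp_mul_p addr0 rmorphM rmorphXn. Qed.

Let redp_f0 : redp f != 0.
Proof. by rewrite monic_neq0 // redp_monic. Qed.

Let redp_S0 : redp S != 0.
Proof. by apply: contraNneq redp_f0 => s0; rewrite redp_f s0 expr0n mul0r. Qed.

(** A nontrivial common factor [q] of [S] and [R] modulo [p] makes [beta = Q A / p] integral, and
    adjoining it gives a strictly larger order. *)
Lemma maximal_quotient_coprime : @maximal_quotient p pr f -> coprimep (redp S) (redp R).
Proof.
move=> [_ max_f]; rewrite coprimep_def; apply/negPn/negP => nq.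
set q := gcdp _ _ in nq.
have [S1 [S2 SE]] := redp_dvd_lift (dvdp_gcdl (redp S) (redp R)).
have [R1 [R2 RE]] := redp_dvd_lift (dvdp_gcdr (redp S) (redp R)).
rewrite -/q in SE RE; set Q := poly_lift pr q in SE RE.
pose A := S1 ^+ 2 * H; pose B := 2%:R * S1 * S2 * H + R1; pose C := S2 ^+ 2 * H + R2.
have fE' : f = Q ^+ 2 * A + p%:R * Q * B + p%:R ^+ 2 * C.
  by rewrite {1}fE SE RE /A /B /C; ring.
have p0 : p%:R != 0 :> Qp by rewrite -tofrac_nat tofrac_eq0 padic_p_neq0.
(* Multiplying [f = 0] by [A / p^2] gives [beta^2 + B beta + A C = 0]. *)
pose beta : K := p%:R^-1 *: io (Q * A).
have pbeta : p%:R * beta = io (Q * A).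
  by rewrite mulr_natl -scaler_nat /beta scalerA divff // scale1r.
have iof : io f = 0 by apply/(quot_class_eq0 f_monic f_size); exists 1; rewrite mul1r.
have beta2 : beta * beta = beta * io (- B) + io (- (A * C)).
  apply: (@quot_p_inj p pr); apply: (@quot_p_inj p pr).
  transitivity ((p%:R * beta) * (p%:R * beta)); first by ring.
  transitivity (p%:R * ((p%:R * beta) * io (- B)) + p%:R * p%:R * io (- (A * C)));
    last by ring.
  rewrite pbeta -!(quot_class_p f) -!quot_classM -quot_classD.
  apply/eqP; rewrite -subr_eq0 -quot_classB; apply/eqP.
  apply/(quot_class_eq0 f_monic f_size); exists A; rewrite [in RHS]fE'; ring.
have Obeta : (adjoin_order beta) beta.
  by exists 0, 1; rewrite quot_class0 quot_class1 add0r mulr1.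
have sub : @Zp_quotient p pr f `<=` adjoin_order beta.
  by move=> _ [g _ <-]; exists g, 0; rewrite quot_class0 mulr0 addr0.
have := max_f _ (adjoin_order_is_order f_monic f_size beta2) sub.
move=> e; move: Obeta; rewrite e => -[g _ gE].
have : io (Q * A - p%:R * g) = 0.
  by rewrite quot_classB -pbeta quot_classM quot_class_p -gE subrr.
move=> /(quot_class_eq0 f_monic f_size) [k kE].
have QE : redp Q = q by apply: poly_liftK.
have aE : redp A = redp S1 ^+ 2 * redp H by rewrite /A rmorphM rmorphXn.
have sE : redp S = q * redp S1 by rewrite {1}SE rmorphD /= redp_mul_p addr0 rmorphM /= QE.
have fqA : redp S ^+ 2 * redp H = q ^+ 2 * redp A by rewrite sE aE; ring.
have qA : q * redp A != 0.
  by move: redp_f0; rewrite redp_f fqA expr2 -mulrA; apply: contraNneq => ->; rewrite mulr0.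
(* If [beta] were in Z_p[x]/(f), then [q A] would be a multiple of [f = q^2 A] modulo [p], and [q]
   would be constant. *)
have e1 : q * redp A = redp k * (q ^+ 2 * redp A).
  rewrite -fqA -redp_f -{1}QE -!rmorphM /= -kE rmorphB /= redp_mul_p subr0 //.
case/negP: nq; rewrite -dvdp1; apply/dvdpP.
exists (redp k); apply: (mulfI qA); rewrite mulr1 {1}e1; ring.
Qed.

(** Among the [p^j x], take the last one outside Z_p[x]/(f). *)
Lemma order_sub_step (O : set K) (x : K) : is_order (K := Qp_quotient f) O ->
  @Zp_quotient p pr f `<=` O -> O x -> ~ Zp_quotient x ->
  exists y z, [/\ O y, p%:R * y = io z & ~ Zp_quotient y].
Proof.
move=> [_ _ OM _ _] sub Ox Nx; have [k [g]] := quot_denominator x.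
elim: k x Ox Nx => [|k IH] x Ox Nx.
  by rewrite expr0 mul1r => xE; case: Nx; exists g.
have [[z _ zE] _|Npx] := pselect (@Zp_quotient p pr f (p%:R * x)); first by exists x, z.
rewrite exprSr -mulrA => /IH; apply => //; apply: OM => //.
by apply: sub; exists p%:R => //; apply: quot_class_p.
Qed.

(** A larger order contains some [y' = U / p] outside Z_p[x]/(f), with [u = U] modulo [p] a divisor
    of [f]. Put [v = f / u] modulo [p] and [f = U V + p R']. Integrality of [y'], read through two
    presentations as a fraction, gives a common factor of [u], [v] and [R'], which [sqfree_lift_dvd]
    moves to [S] and [R]. *)
Lemma coprime_maximal_quotient : coprimep (redp S) (redp R) -> @maximal_quotient p pr f.
Proof.
move=> cop; split; first exact: Zp_quotient_is_order.
move=> O ordO sub; apply/seteqP; split=> // x Ox; apply: contrapT => Nx.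
have [y [z [Oy yz Ny]]] := order_sub_step ordO sub Ox Nx.
have [one_in OB OM _ _] := ordO.
have Oio g : O (io g) by apply: sub; exists g.
have ON a : O a -> O (- a) by move=> Oa; rewrite -sub0r; apply: OB => //; rewrite -(quot_class0 f).
have OD a b : O a -> O b -> O (a + b).
  by move=> Oa Ob; rewrite -[b]opprK; apply: OB => //; apply: ON.
have [[a b] /= abE] := Bezoutp (redp z) (redp f).
set g := gcdp _ _ in abE.
have g0 : g != 0 by rewrite gcdp_eq0 negb_and redp_f0 orbT.
set t := a * _ + _ in abE.
have t0 : t != 0 by rewrite -size_poly_eq0 (eqp_size abE) size_poly_eq0.
pose u := (lead_coef t)^-1 *: t.
have lt0 : (lead_coef t)^-1 != 0 by rewrite invr_eq0 lead_coef_eq0.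
have ug : u %= g by apply: eqp_trans abE; apply: eqp_scale.
have uz : u %| redp z by rewrite (eqp_dvdl _ ug) dvdp_gcdl.
have uf : u %| redp f by rewrite (eqp_dvdl _ ug) dvdp_gcdr.
set v := redp f %/ u; have fvu : redp f = v * u by rewrite divpK.
pose A := poly_lift pr ((lead_coef t)^-1 *: a); pose B := poly_lift pr ((lead_coef t)^-1 *: b).
have [|C CE] := @redp_eq p pr (poly_lift pr u) (A * z + B * f).
  by rewrite rmorphD !rmorphM /= !poly_liftK -!scalerAl -scalerDr.
set U := poly_lift pr u in CE; have UE : redp U = u by apply: poly_liftK.
have iof : io f = 0 by apply/(quot_class_eq0 f_monic f_size); exists 1; rewrite mul1r.
(* Bezout modulo [p] replaces the numerator [z] of [y] by its gcd with [f]. *)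
pose y' := io A * y + io C.
have Oy' : O y' by apply: OD => //; apply: OM.
have py' : io p%:R * y' = io U.
  rewrite CE !quot_classD !quot_classM iof mulr0 addr0 quot_class_p /y' mulrDr.
  by rewrite mulrCA yz.
(* Presentation [y' = U / p]: modulo [p], [f] divides a power of [u]. *)
have [m [e [k ek]]] := order_integral f_monic f_size ordO Oy' py'.
have fum : redp f %| u ^+ m.
  apply/dvdpP; exists (redp k); rewrite -rmorphM -ek rmorphD /= redp_mul_p addr0.
  by rewrite rmorphXn /= UE.
set V := poly_lift pr v; have VE : redp V = v by apply: poly_liftK.
have [|R' fE'] := @redp_eq p pr f (U * V).
  by rewrite rmorphM /= UE VE mulrC.
have vy' : io (- V) * y' = io R'.
  apply: (@quot_p_inj p pr); rewrite mulrCA -(quot_class_p f) py' -!quot_classM.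
  apply/eqP; rewrite -subr_eq0 -quot_classB; apply/eqP.
  apply/(quot_class_eq0 f_monic f_size); exists (- 1); rewrite fE'; ring.
(* Presentation [y' = R' / (- V)]: modulo [p], [v] divides a power of [R']. *)
have [m' [e' [k' ek']]] := order_integral f_monic f_size ordO Oy' vy'.
have vr : v %| redp R' ^+ m'.
  apply/dvdpP; exists (redp k' * u + redp e').
  rewrite mulrDl -mulrA [u * v]mulrC -fvu -VE -rmorphM -rmorphXn -rmorphM -rmorphD /=.
  by congr redp; rewrite -ek'; ring.
have v0 : v != 0 by apply: contraNneq redp_f0 => v0; rewrite fvu v0 mul0r.
(* If [v] were constant, [f] would divide [z] modulo [p] and [y] would lie in Z_p[x]/(f). *)
have nv : size v != 1%N.
  apply/negP => v1; apply: Ny.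
  have : redp f %| redp z.
    by rewrite fvu (eqp_dvdl _ (_ : _ %= u)) // -{2}[u]mul1r eqp_mulr // -size_poly_eq1.
  move=> /divpK zf; have [|z' zE] := @redp_eq p pr z (poly_lift pr (redp z %/ redp f) * f).
    by rewrite rmorphM /= poly_liftK.
  exists z' => //; apply: (@quot_p_inj p pr).
  rewrite yz -(quot_class_p f) -!quot_classM; apply/eqP.
  rewrite eq_sym -subr_eq0 -quot_classB; apply/eqP.
  apply/(quot_class_eq0 f_monic f_size).
  exists (poly_lift pr (redp z %/ redp f)); rewrite {1}zE; ring.
have vum : v %| u ^+ m by apply: dvdp_trans fum; rewrite fvu dvdp_mulIl.
have nvu : ~~ coprimep v u by apply: contra nv => /(coprimep_dvd_exp vum) ->.
set w := gcdp v u in nvu; rewrite coprimep_def in nvu.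
have wr : w %| redp R' ^+ m' by rewrite (dvdp_trans (dvdp_gcdl _ _)).
have : ~~ coprimep w (redp R') by apply: contra nvu => /(coprimep_dvd_exp wr) ->.
set q := gcdp w (redp R'); rewrite coprimep_def -/q => /negP[].
have qv : q %| v by rewrite (dvdp_trans (dvdp_gcdl _ _)) ?dvdp_gcdl.
have qu : q %| u by rewrite (dvdp_trans (dvdp_gcdl _ _)) ?dvdp_gcdr.
have [|||qS qR] := @sqfree_lift_dvd p pr f S H R U V R' q sep_h redp_S0 fE fE'.
- by rewrite UE.
- by rewrite VE.
- exact: dvdp_gcdr.
by rewrite -dvdp1 -(eqp_dvdr _ (_ : gcdp (redp S) (redp R) %= 1)) ?dvdp_gcd ?qS ?gcdp_eqp1.
Qed.

Lemma maximal_quotientP : @maximal_quotient p pr f <-> coprimep (redp S) (redp R).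
Proof. by split; [apply: maximal_quotient_coprime | apply: coprime_maximal_quotient]. Qed.
End Dedekind.

Lemma mul_Sylvester (A : comNzRingType) (f g : {poly A})
    (y : 'rV[A]_((size g).-1 + (size f).-1)) :
  y *m Sylvester_mx f g = poly_rV (rVpoly (lsubmx y) * f + rVpoly (rsubmx y) * g).
Proof. by rewrite -[in LHS](hsubmxK y) mul_row_col !mul_rV_lin1 linearD. Qed.

(** * Divisibility of a determinant by p^2 *)

Section DetMod.
Variables (p : nat) (pr : prime p).
Local Notation Zp := (padic_int pr).
Local Notation rho := (@red p pr).
Local Notation redp := (map_poly rho).

Definition subst_row (A : Type) n (M : 'M[A]_n) (i : 'I_n) (w : 'rV[A]_n) : 'M[A]_n :=
  \matrix_(k, j) if k == i then w 0 j else M k j.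

(** Multiply by the adjugate and read column [i]: its entries are the cofactors of row [i], which do
    not see that row. *)
Lemma det_subst_row (A : comNzRingType) n (M : 'M[A]_n) i (v w : 'rV[A]_n) (a : A) :
  v *m M = a *: w -> v 0 i * \det M = a * \det (subst_row M i w).
Proof.
move=> vM; have := congr1 (fun X => (X *m \adj M) 0 i) vM.
rewrite -mulmxA mul_mx_adj mul_mx_scalar -scalemxAl [LHS]mxE [RHS]mxE mulrC => ->.
congr (a * _); rewrite (expand_det_row _ i) mxE; apply: eq_bigr => j _.
rewrite !mxE eqxx /cofactor; congr (_ * (_ * \det _)).
by apply/matrixP => k l; rewrite !mxE eq_sym (negbTE (neq_lift _ _)).
Qed.

Lemma mul_subst_row (A : comNzRingType) n (M : 'M[A]_n) i (w y : 'rV[A]_n) :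
  y *m subst_row M i w = (\row_k (if k == i then 0 else y 0 k)) *m M + y 0 i *: w.
Proof.
apply/rowP => j; rewrite !mxE (bigD1 i) //= [X in _ = X + _](bigD1 i) //= !mxE eqxx mul0r add0r.
by rewrite addrC; congr (_ + _); apply: eq_bigr => k /negbTE ki; rewrite !mxE ki.
Qed.

Lemma padic_dvd_red (x : Zp) : padic_dvd p%:R x <-> rho x = 0.
Proof.
split=> [[z ->]|/red_eq0[y ->]]; first by rewrite rmorphM /= red_p mulr0.
by exists y; rewrite mulrC.
Qed.

(* By Cramer, [v_i det M = p det M'] where [M'] is [M] with row [i] replaced by [w]. *)
Lemma det_dvd_p2 n (M : 'M[Zp]_n) i (v w : 'rV[Zp]_n) :
  v *m M = p%:R *: w -> rho (v 0 i) != 0 ->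
  padic_dvd (p%:R ^+ 2) (\det M) <->
  exists2 y : 'rV['F_p]_n, y != 0 & y *m subst_row (map_mx rho M) i (map_mx rho w) = 0.
Proof.
move=> vM vi; have dM := det_subst_row i vM.
have vu : v 0 i \is a GRing.unit by rewrite padic_unitE.
have -> : subst_row (map_mx rho M) i (map_mx rho w) = map_mx rho (subst_row M i w).
  by apply/matrixP => k j; rewrite !mxE; case: ifP.
transitivity (rho (\det (subst_row M i w)) = 0); last first.
  by rewrite -det_map_mx; split=> [/eqP/det0P//|ex]; apply/eqP/det0P.
rewrite -padic_dvd_red; split=> -[z zE].
  exists (v 0 i * z); apply: (mulfI (padic_p_neq0 pr)).
  by rewrite -dM zE; ring.
exists ((v 0 i)^-1 * z).
by rewrite -[LHS](mulKr vu) dM zE; ring.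
Qed.

Lemma mul_Sylvester_red (f g : {poly Zp}) (y : 'rV['F_p]_((size g).-1 + (size f).-1)) :
  y *m map_mx rho (Sylvester_mx f g) =
  poly_rV (rVpoly (lsubmx y) * redp f + rVpoly (rsubmx y) * redp g).
Proof.
rewrite -[y in LHS](map_liftK pr) -map_mxM mul_Sylvester map_poly_rV rmorphD !rmorphM /=.
by rewrite !map_rVpoly map_lsubmx map_rsubmx map_liftK.
Qed.
End DetMod.

(** * The Sylvester matrix of f and f' modulo p *)

Section Discriminant.
Variables (p : nat) (pr : prime p).
Local Notation Zp := (padic_int pr).
Local Notation F := 'F_p.
Local Notation rho := (@red p pr).
Local Notation redp := (map_poly rho).

Lemma padic_nat_neq0 n : (0 < n)%N -> n%:R != 0 :> Zp.
Proof.
move=> n0; apply/eqP => e.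
have : residue (n%:R : Zp) n = residue (0%:R : Zp) n by rewrite e.
rewrite !residue_nat mod0n modn_small; last exact/ltn_expl/prime_gt1.
by move=> nE; rewrite nE in n0.
Qed.

Variable f : {poly Zp}.
Variable n : nat.
Hypotheses (f_monic : f \is monic) (f_size : size f = n.+3).

(** The leading coefficient [n + 2] is nonzero in Z_p even when [p] divides it, so the size of the
    Sylvester matrix depends on the degree of [f] alone. *)
Lemma size_monic_deriv : size f^`() = n.+2.
Proof.
have lc : f^`()`_n.+1 = n.+2%:R.
  by rewrite coef_deriv; move: f_monic; rewrite monicE lead_coefE f_size /= => /eqP ->.
apply/eqP; rewrite eqn_leq; apply/andP; split.
  by rewrite -ltnS -f_size lt_size_deriv // monic_neq0.
by apply: contraTT isT; rewrite -ltnNge ltnS => /leq_sizeP/(_ _ (leqnn _))/eqP;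
   rewrite lc (negbTE (padic_nat_neq0 _)).
Qed.

Local Notation dq := (size f^`()).-1.
Local Notation dp := (size f).-1.
Local Notation M := (Sylvester_mx f f^`()).
Local Notation fb := (redp f).
Local Notation fb' := (fb^`()).

Lemma sqf_discE : sqf_disc f <-> ~ padic_dvd (p%:R ^+ 2) (\det M).
Proof.
rewrite /sqf_disc /monic_discriminant -/(resultant f f^`()).
suff E (k : nat) (x : Zp) : padic_dvd (p%:R ^+ 2) ((-1) ^+ k * x) <-> padic_dvd (p%:R ^+ 2) x.
  have [a b] := E ((size f).-1 * (size f).-1.-1)./2 (\det M).
  by split=> H D; apply: H; [exact: b | exact: a].
split=> -[z zE]; exists ((-1) ^+ k * z).
  by rewrite -mulrA -zE mulrA -exprMn mulrNN mulr1 expr1n mul1r.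
by rewrite zE mulrA.
Qed.

Implicit Type y : 'rV[F]_(dq + dp).

Lemma size_Sylvester_comb (u w : {poly F}) : (size u <= dq)%N -> (size w <= dp)%N ->
  (size (u * fb + w * fb')%R <= dq + dp)%N.
Proof.
rewrite size_monic_deriv f_size /= => su sw.
have sf : size fb = n.+3 by rewrite size_redp_monic.
have sf' : (size fb' <= n.+2)%N by rewrite -ltnS -sf lt_size_deriv // -size_poly_eq0 sf.
rewrite (leq_trans (size_polyD _ _)) // geq_max.
rewrite !(leq_trans (size_polyMleq _ _)) //.
  by move: sf' sw; move: (size fb') (size w) => a b; lia.
by rewrite sf; move: su; move: (size u) => a; lia.
Qed.

Lemma Sylvester_kernel y : y *m map_mx rho M = 0 <->
  rVpoly (lsubmx y) * fb + rVpoly (rsubmx y) * fb' = 0.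
Proof.
rewrite mul_Sylvester_red -deriv_map; split=> [/(congr1 rVpoly)|->]; last by rewrite linear0.
by rewrite poly_rV_K ?linear0 // size_Sylvester_comb ?size_poly.
Qed.

Lemma row_poly_eq0 y : rVpoly (lsubmx y) = 0 -> rVpoly (rsubmx y) = 0 -> y = 0.
Proof.
move=> u0 w0; rewrite -[y]hsubmxK -[lsubmx y]rVpolyK -[rsubmx y]rVpolyK u0 w0.
by rewrite !linear0 row_mx0.
Qed.

(** A kernel vector modulo [p] is a pair with [u f + w f' = 0] and [deg w < deg f]; coprimality
    gives [f | w], so [w = 0] and [u = 0]. *)
Lemma separable_sqf_disc : separable_poly fb -> ~ padic_dvd (p%:R ^+ 2) (\det M).
Proof.
rewrite separable_poly.unlock => cop [z zE].
have : \det (map_mx rho M) == 0.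
  by rewrite det_map_mx zE rmorphM rmorphXn /= red_p expr0n mulr0.
case/det0P => y /eqP y0 /Sylvester_kernel yk; apply: y0.
have f0 : fb != 0 by rewrite monic_neq0 // redp_monic.
have w0 : rVpoly (rsubmx y) = 0.
  apply/eqP; apply: contraT => w0.
  have /(dvdp_leq w0) : fb %| rVpoly (rsubmx y).
    rewrite -(Gauss_dvdpl _ cop) -(dvdp_addr _ (dvdp_mull (rVpoly (lsubmx y)) (dvdpp fb))).
    by rewrite yk dvdp0.
  rewrite size_redp_monic // => le; have := leq_trans le (size_poly _ _).
  by rewrite f_size ltnn.
apply: row_poly_eq0 => //; apply/eqP; move/eqP: yk.
by rewrite w0 mul0r addr0 mulf_eq0 (negbTE f0) orbF.
Qed.

(** A common factor of degree at least 2 makes the kernel at least two-dimensional, so it has a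
    nonzero vector that vanishes at the replaced row. *)
Lemma common_divisor_disc (g : {poly F}) : g %| fb -> g %| fb' -> (2 < size g)%N ->
  padic_dvd (p%:R ^+ 2) (\det M).
Proof.
move=> gf gf' sg; have f0 : fb != 0 by rewrite monic_neq0 // redp_monic.
have g0 : g != 0 by rewrite -size_poly_gt0 (ltn_trans _ sg).
have sf : size fb = n.+3 by rewrite size_redp_monic.
(* The pairs [(U, W)] and [(X U, X W)] both fit the degree bounds because [deg g >= 2]. *)
pose W := fb %/ g; pose U := - (fb' %/ g).
have WE : W * g = fb by rewrite divpK.
have UE : - U * g = fb' by rewrite opprK divpK.
have W0 : W != 0 by apply: contraNneq f0 => W0; rewrite -WE W0 mul0r.
have UW0 : U * fb + W * fb' = 0 by rewrite -UE -WE; ring.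
have sW : (size W <= n.+1)%N by rewrite size_divp // sf; move: sg; move: (size g) => c; lia.
have sU : (size U <= n)%N.
  have : (size fb' < n.+3)%N by rewrite -sf lt_size_deriv.
  by rewrite size_polyN size_divp //; move: sg; move: (size fb') (size g) => a c; lia.
pose row (u w : {poly F}) : 'rV[F]_(dq + dp) := row_mx (poly_rV u) (poly_rV w).
have dqE : dq = n.+1 by rewrite size_monic_deriv.
have dpE : dp = n.+2 by rewrite f_size.
have rowk (u w : {poly F}) : (size u <= dq)%N -> (size w <= dp)%N -> u * fb + w * fb' = 0 ->
    row u w *m map_mx rho M = 0.
  by move=> su sw e; apply/Sylvester_kernel; rewrite row_mxKl row_mxKr !poly_rV_K.
have sXU : (size ('X * U)%R <= dq)%N.
  by rewrite mulrC dqE (leq_trans (size_polyMleq _ _)) // size_polyX addn2 /= ltnS.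
have sXW : (size ('X * W)%R <= dp)%N.
  by rewrite mulrC dpE (leq_trans (size_polyMleq _ _)) // size_polyX addn2 /= ltnS.
have sU' : (size U <= dq)%N by rewrite dqE (leq_trans sU).
have sW' : (size W <= dp)%N by rewrite dpE (leq_trans sW).
have vk := rowk U W sU' sW' UW0.
have yk : row ('X * U) ('X * W) *m map_mx rho M = 0.
  by apply: rowk; rewrite // -!mulrA -mulrDr UW0 mulr0.
have v0 : row U W != 0.
  apply: contraNneq W0 => /(congr1 (fun y => rVpoly (rsubmx y))).
  by rewrite row_mxKr poly_rV_K // !linear0 => ->.
have /rV0Pn[i vi] := v0.
pose v := map_mx (@padic_lift p pr) (row U W).
have rv : map_mx rho v = row U W by apply: map_liftK.
have [|w wE] := @map_red_eq0 p pr _ (v *m M); first by rewrite map_mxM rv vk.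
have rvi : rho (v 0 i) != 0 
  by have -> : rho (v 0 i) = row U W 0 i by rewrite -rv [RHS]mxE.
apply/(det_dvd_p2 wE rvi).
(* [c] cancels coordinate [i]; the combination stays nonzero since its second half is
   [(X - c) W]. *)
pose c := row ('X * U) ('X * W) 0 i / row U W 0 i.
pose y := row ('X * U) ('X * W) - c *: row U W.
have yi : y 0 i = 0.
  have E (a b : 'rV[F]_(dq + dp)) (t : F) : (a - t *: b) 0 i = a 0 i - t * b 0 i by rewrite !mxE.
  by rewrite E divfK // subrr.
exists y.
  apply: contraNneq W0 => /(congr1 (fun y => rVpoly (rsubmx y))).
  rewrite /y !linearB /= !linearZ /= !row_mxKr !poly_rV_K // !linear0 => /eqP.
  by rewrite scalerN -mul_polyC -mulrBl mulf_eq0 polyXsubC_eq0 => /eqP->.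
rewrite mul_subst_row yi scale0r addr0.
have -> : \row_k (if k == i then 0 else y 0 k) = y.
  by apply/rowP => k; rewrite mxE; case: eqP => // ->.
by rewrite mulmxBl yk -scalemxAl vk scaler0 subrr.
Qed.
End Discriminant.

(** * The discriminant when the square part is linear *)

Section LinearDoubleRoot.
Variables (p : nat) (pr : prime p).
Local Notation Zp := (padic_int pr).
Local Notation F := 'F_p.
Local Notation rho := (@red p pr).
Local Notation redp := (map_poly rho).
Variables (f H R : {poly Zp}) (a : Zp) (n : nat).
Hypotheses (f_monic : f \is monic) (f_size : size f = n.+3).
Local Notation S := ('X - a%:P).
Hypotheses (fE : f = S ^+ 2 * H + p%:R * R).
Hypotheses (H_monic : H \is monic) (H_size : size H = n.+1) (R_size : (size R <= n.+2)%N).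
Local Notation s := ('X - (rho a)%:P).
Local Notation h := (redp H).
Local Notation r := (redp R).
Hypotheses (sep_h : separable_poly h) (h_a : ~~ root h (rho a)) (two_neq0 : 2%:R != 0 :> F).

Local Notation dq := (size f^`()).-1.
Local Notation dp := (size f).-1.
Local Notation M := (Sylvester_mx f f^`()).
Local Notation fb := (redp f).
Local Notation fb' := (fb^`()).

(** Modulo [p], [f = S^2 H] and [f' = S (2 H + S H')]; cancelling [S] gives the kernel pair
    [(U0, W0)], and [N] is its image divided by [p]. *)
Let U0 := - (2%:R * H + S * H^`()).
Let W0 := S * H.
Let N := U0 * R + W0 * R^`().

Let comb0 : U0 * f + W0 * f^`() = p%:R * N.
Proof.
have -> : f^`() = 2%:R * S * H + S ^+ 2 * H^`() + p%:R * R^`().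
  rewrite fE expr2 derivD !derivM derivXsubC -polyC_natr derivC; ring.
by rewrite {1}fE /N /U0 /W0; ring.
Qed.

Let dqE : dq = n.+1. Proof. by rewrite (size_monic_deriv f_monic f_size). Qed.
Let dpE : dp = n.+2. Proof. by rewrite f_size. Qed.

Let sizeM (A : comNzRingType) (u v : {poly A}) i j k : (size u <= i)%N -> (size v <= j)%N ->
  ((i + j).-1 <= k)%N -> (size (u * v)%R <= k)%N.
Proof.
move=> ui vj ijk; rewrite (leq_trans (size_polyMleq _ _)) //.
by move: (size u) (size v) ui vj => x y; lia.
Qed.

Let sizeD (A : comNzRingType) (u v : {poly A}) k : (size u <= k)%N -> (size v <= k)%N ->
  (size (u + v)%R <= k)%N.
Proof. by move=> uk vk; rewrite (leq_trans (size_polyD _ _)) // geq_max uk. Qed.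

Let size_H' : (size H^`() <= n)%N.
Proof. by rewrite -ltnS -H_size lt_size_deriv // monic_neq0. Qed.

Let size_R' : (size R^`() <= n.+1)%N.
Proof.
have [->|R0] := eqVneq R 0; first by rewrite deriv0 size_poly0.
by rewrite -ltnS (leq_trans (lt_size_deriv R0)).
Qed.

Let size_U0 : (size U0 <= n.+1)%N.
Proof.
rewrite size_polyN; apply: sizeD.
  by rewrite -polyC_natr mul_polyC (leq_trans (size_scale_leq _ _)) // H_size.
by apply: (sizeM (i := 2) (j := n)); rewrite ?size_XsubC.
Qed.

Let size_W0 : size W0 = n.+2.
Proof. by rewrite size_monicM ?monicXsubC ?monic_neq0 // size_XsubC H_size. Qed.

Let size_N : (size N <= n.*2.+2)%N.
Proof.
apply: sizeD; first by apply: (sizeM size_U0 R_size); rewrite -addnn; lia.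
by apply: (sizeM (i := n.+2) _ size_R'); rewrite ?size_W0 // -addnn; lia.
Qed.

(** The coordinate of [X^(n+1)] in the second half, where the monic [W0] has coefficient 1. *)
Let i0 : 'I_(dq + dp).
Proof. by apply: (rshift dq); apply: (@Ordinal _ n.+1); rewrite dpE. Defined.

Let v0 : 'rV[Zp]_(dq + dp) := row_mx (poly_rV U0) (poly_rV W0).

Let v0M : v0 *m M = p%:R *: poly_rV N.
Proof.
rewrite mul_Sylvester row_mxKl row_mxKr !poly_rV_K ?dqE ?dpE ?size_W0 //.
by rewrite comb0 -polyC_natr mul_polyC linearZ.
Qed.

Let v0i : v0 0 i0 = 1.
Proof.
rewrite /v0 row_mxEr mxE /=; have : W0 \is monic by rewrite monicMl ?monicXsubC.
by rewrite monicE lead_coefE size_W0 => /eqP.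
Qed.

Let k := h^`() * s + 2%:R *: h.
Let g := s * h.

Let redS : redp S = s.
Proof. by rewrite rmorphB /= map_polyX map_polyC. Qed.

Let fbE : fb = s * g.
Proof. by rewrite fE rmorphD /= redp_mul_p addr0 rmorphM rmorphXn /= redS /g; ring. Qed.

Let fb'E : fb' = s * k.
Proof.
by rewrite fbE /g /k !derivM derivXsubC -mul_polyC polyC_natr; ring.
Qed.

Let NE : redp N = - (k * r) + g * r^`().
Proof.
rewrite /N /U0 /W0 rmorphD !rmorphM /= rmorphN rmorphD !rmorphM /= redS rmorph_nat.
by rewrite -!deriv_map /k /g -mul_polyC polyC_natr; ring.
Qed.

(** At the root of [s], [k] is [2 h], nonzero by [two_neq0] and [h_a]; modulo [h], [k] is [h' s],
    coprime to the separable [h]. *)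
Let cop : coprimep g k.
Proof.
rewrite coprimepMl /k coprimep_addl_mul coprimepZr // coprimep_sym coprimep_XsubC h_a /=.
rewrite -mul_polyC addrC coprimep_addl_mul coprimepMr.
by rewrite coprimep_XsubC h_a andbT; move: sep_h; rewrite separable_poly.unlock.
Qed.

Let size_g : size g = n.+2.
Proof.
have hm : h \is monic by apply: redp_monic.
by rewrite size_monicM ?monicXsubC ?monic_neq0 // size_XsubC size_redp_monic // H_size.
Qed.

(** The modified matrix is singular if and only if [u f + w f' + c N = 0] has a nontrivial solution
    with [deg w <= n]. With [f = s g] and [f' = s k], a solution with [c = 1] needs [s | N], that is
    [r(a) = 0], and Bezout for [g] and [k] then provides it. *)
Lemma linear_disc : padic_dvd (p%:R ^+ 2) (\det M) <-> root r (rho a).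
Proof.
have rvi : rho (v0 0 i0) != 0 by rewrite v0i rmorph1 oner_eq0.
have sN : (size (redp N) <= dq + dp)%N.
  by rewrite dqE dpE (leq_trans (size_poly _ _)) // (leq_trans size_N) // addSn !addnS addnn leqnSn.
have sub_eq (y : 'rV[F]_(dq + dp)) :
    y *m subst_row (map_mx rho M) i0 (map_mx rho (poly_rV N)) = 0 <->
    let z := \row_j (if j == i0 then 0 else y 0 j) in
    rVpoly (lsubmx z) * fb + rVpoly (rsubmx z) * fb' + y 0 i0 *: redp N = 0.
  set z := \row_j _ => /=.
  rewrite (@mul_subst_row F) -/z mul_Sylvester_red -deriv_map map_poly_rV -linearZ -linearD /=.
  split=> [/(congr1 rVpoly)|->]; last by rewrite linear0.
  rewrite poly_rV_K ?linear0 //; apply: sizeD; last exact: leq_trans (size_scale_leq _ _) sN.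
  by apply: (size_Sylvester_comb f_monic f_size); exact: size_poly.
apply: (iff_trans (det_dvd_p2 v0M rvi)); split=> [[y y0 /sub_eq /=]|ra].
  set z := \row_j _; set u := rVpoly _; set w := rVpoly _; rewrite fb'E fbE NE => e.
  apply: contraT => nra; case/eqP: y0.
  (* Evaluation at [a] leaves [y_i0 * 2 * h(a) * r(a) = 0]. *)
  have yi : y 0 i0 = 0.
    have sa : s.[rho a] = 0 by rewrite hornerXsubC subrr.
    have ka : k.[rho a] = 2%:R * h.[rho a] by rewrite hornerD hornerM hornerZ sa mulr0 add0r.
    have e1 : y 0 i0 *: (k * r) = s * (u * g + w * k + y 0 i0 *: (h * r^`())).
      apply/eqP; rewrite eq_sym -subr_eq0; apply/eqP; rewrite -[RHS]e /g -!mul_polyC; ring.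
    have := congr1 (horner^~ (rho a)) e1.
    rewrite hornerZ [(k * r).[_]]hornerM ka [RHS]hornerM sa mul0r => /eqP.
    rewrite !mulf_eq0 (negbTE two_neq0) -!rootE (negbTE h_a) (negbTE nra) !orbF.
    by move/eqP.
  have zy : z = y by apply/rowP => j; rewrite mxE; case: eqP => // ->.
  have e1 : w * k = (- u) * g.
    have s0 : s != 0 by rewrite polyXsubC_eq0.
    apply: (mulfI s0); apply/eqP; rewrite -subr_eq0; apply/eqP.
    by rewrite -[RHS]e yi scale0r; ring.
  have w0 : w = 0.
    apply/eqP; apply: contraT => w0.
    have /(dvdp_leq w0) : g %| w by rewrite -(Gauss_dvdpl _ cop) e1 dvdp_mull.
    (* The zeroed coordinate [i0] is the top coefficient of [w], so [deg w < deg g]. *)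
    suff sw : (size w <= n.+1)%N by rewrite size_g leqNgt ltnS sw.
    apply/leq_sizeP => j nj; rewrite coef_rVpoly; case: insubP => // j' jd jj'.
    have -> : rsubmx z 0 j' = z 0 (rshift dq j') by rewrite mxE.
    have -> : rshift dq j' = i0.
      apply/val_inj => /=; congr (_ + _)%N; rewrite jj'; apply/eqP.
      by rewrite eqn_leq nj andbT -ltnS -dpE -jj' ltn_ord.
    by rewrite mxE eqxx.
  have u0 : u = 0.
    move: e1; rewrite w0 mul0r => /esym/eqP; rewrite mulf_eq0 oppr_eq0 -[g == 0]size_poly_eq0.
    by rewrite size_g orbF => /eqP.
  by rewrite -zy; apply: row_poly_eq0.
have [N1 N1E] : exists N1, redp N = N1 * s.
  apply/dvdpP; rewrite NE dvdp_addl; last by rewrite dvdp_mulr // dvdp_mulIl.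
  by rewrite dvdpNr dvdp_mull // dvdp_XsubCl.
have [[b1 b2] /= bE] : exists b, b.1 * k + b.2 * g = 1.
  have /Bezout_coprimepP[[b1 b2] /= tE] := cop.
  have := eqp_eq tE; rewrite lead_coef1 scale1r => bE.
  set t := b1 * g + b2 * k in bE; have t0 : lead_coef t != 0.
    by rewrite lead_coef_eq0 -size_poly_eq0 (eqp_size tE) size_poly1.
  exists ((lead_coef t)^-1 *: b2, (lead_coef t)^-1 *: b1) => /=.
  by rewrite -!scalerAl -scalerDr addrC -/t {2}bE scalerA mulVf // scale1r.
(* Bezout gives [- N1 = - N1 b1 k - N1 b2 g]; reducing the factor of [k] modulo [g] frees coordinate
   [i0]. *)
pose W := (- (N1 * b1)) %% g; pose U := (- N1 - W * k) %/ g.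
have g0 : g != 0 by rewrite -size_poly_eq0 size_g.
have sW : (size W <= n.+1)%N by rewrite -ltnS -size_g ltn_modp.
have UE : U * g = - N1 - W * k.
  rewrite divpK //; apply/dvdpP.
  have WE := divp_eq (- (N1 * b1)) g; rewrite -/W in WE.
  exists (- N1 * b2 + (- (N1 * b1) %/ g) * k).
  rewrite (_ : W = - (N1 * b1) - (- (N1 * b1) %/ g) * g); last by rewrite {1}WE addrC addKr.
  rewrite -{1}[N1]mulr1 -bE; ring.
have sN1 : (size N1 <= n.*2.+1)%N.
  have := leq_trans (size_poly _ _ : (size (redp N) <= _)%N) size_N.
  have [->|N10] := eqVneq N1 0; first by rewrite size_poly0.
  by rewrite N1E size_Mmonic ?monicXsubC // size_XsubC addn2.
have sk : (size k <= n.+1)%N.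
  apply: sizeD; last by rewrite (leq_trans (size_scale_leq _ _)) // size_redp_monic ?H_size.
  apply: (sizeM (i := n) (j := 2)); rewrite ?size_XsubC ?addn2 //.
  by rewrite deriv_map (leq_trans (size_poly _ _)).
have sU : (size U <= n.+1)%N.
  rewrite size_divp // size_g leq_subLR.
  have : (size (- N1 - W * k)%R <= n.*2.+1)%N.
    apply: sizeD; rewrite size_polyN //; apply: (sizeM sW sk).
    by rewrite addSn addnS addnn.
  by move=> /leq_trans; apply; rewrite addSn addnS addnn leqnSn.
pose z : 'rV[F]_(dq + dp) := row_mx (poly_rV U) (poly_rV W).
have zi : z 0 i0 = 0.
  by rewrite /z row_mxEr mxE nth_default.
(* The entry 1 at [i0] selects the replaced row, that is [N] itself. *)
pose y := z + delta_mx 0 i0.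
have yi : y 0 i0 = 1 by rewrite mxE zi mxE !eqxx add0r.
exists y.
  apply: contraTneq isT => y0; move: yi; rewrite y0 mxE => /eqP.
  by rewrite eq_sym oner_eq0.
apply/sub_eq => /=; rewrite yi scale1r.
have -> : \row_j (if j == i0 then 0 else y 0 j) = z.
  apply/rowP => j; rewrite mxE; case: eqP => [->//|/eqP ji].
  by rewrite mxE [delta_mx _ _ _ _]mxE (negbTE ji) andbF addr0.
rewrite row_mxKl row_mxKr !poly_rV_K ?dqE ?dpE // ?(leq_trans sW) //.
rewrite fb'E fbE N1E.
transitivity (s * (U * g + W * k + N1)); first by ring.
by rewrite UE; ring.
Qed.
End LinearDoubleRoot.

(** * The criterion for p^2 not dividing the discriminant *)

Section DiscriminantCriterion.
Variables (p : nat) (pr : prime p).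
Local Notation Zp := (padic_int pr).
Local Notation F := 'F_p.
Local Notation rho := (@red p pr).
Local Notation redp := (map_poly rho).

Lemma two_Fp_eq0 : (2%:R == 0 :> F) = (p == 2%N).
Proof. by rewrite -(dvdn_pcharf (pchar_Fp pr)) dvdn_prime2. Qed.

Lemma monic_size1 (A : nzRingType) (S : {poly A}) : S \is monic -> size S = 1%N -> S = 1.
Proof.
move=> Sm sS; have SE := size1_polyC (eq_leq sS).
by move: Sm; rewrite SE monicE lead_coefC => /eqP ->.
Qed.

Lemma monic_size2 (A : nzRingType) (S : {poly A}) : S \is monic -> size S = 2%N ->
  S = 'X - (- S`_0)%:P.
Proof.
move=> Sm sS; apply/polyP => -[|[|i]]; rewrite coefB coefX coefC ?sub0r ?opprK ?subr0 //=.
  by move: Sm; rewrite monicE lead_coefE sS => /eqP.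
by rewrite nth_default ?sS ?oppr0.
Qed.

Lemma sqf_disc_criterion n (f S H R : {poly Zp}) : f \is monic -> size f = n.+3 ->
  S \is monic -> H \is monic -> separable_poly (redp H) -> f = S ^+ 2 * H + p%:R * R ->
  sqf_disc f <-> coprimep (redp S) (redp R) && ((redp S == 1) ||
     [&& p != 2%N, size (redp S) == 2%N & coprimep (redp S) (redp H)]).
Proof.
move=> fm sf Sm Hm sep_h fE; rewrite (sqf_discE f); set s := redp S; set h := redp H.
have sm : s \is monic by apply: redp_monic.
have fbE : redp f = s * (s * h).
  by rewrite fE rmorphD /= redp_mul_p addr0 rmorphM rmorphXn /= -/s -/h; ring.
have fb'E : (redp f)^`() = s * (2%:R *: (s^`() * h) + s * h^`()).
  by rewrite fbE !derivM scaler_nat; ring.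
have s_f : s %| redp f by rewrite fbE dvdp_mulIl.
have s_f' : s %| (redp f)^`() by rewrite fb'E dvdp_mulIl.
have s2_f : s ^+ 2 %| redp f by rewrite fbE expr2 mulrA dvdp_mulIl.
have [s1|s1] := eqVneq s 1.
  rewrite s1 coprime1p /=; split=> // _; apply: (separable_sqf_disc fm sf).
  by rewrite fbE s1 !mul1r.
have s_gt1 : (1 < size s)%N.
  rewrite ltn_neqAle eq_sym size_poly_gt0 monic_neq0 // andbT.
  by apply: contra s1 => /eqP /(monic_size1 sm) ->.
have not_sqf g : g %| redp f -> g %| (redp f)^`() -> (2 < size g)%N ->
    ~ padic_dvd (p%:R ^+ 2) (\det (Sylvester_mx f f^`())) <-> false.
  by move=> gf gf' sg; split=> // -[]; apply: (common_divisor_disc fm sf gf gf' sg).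
rewrite /=; have [s2|s2] := eqVneq (size s) 2%N; last first.
  rewrite andbF andbF; apply: (not_sqf s) => //.
  by rewrite ltn_neqAle eq_sym s2.
have s2_size : (2 < size (s ^+ 2))%N by rewrite expr2 size_monicM ?monic_neq0 // s2.
have [p2|p2] := eqVneq p 2%N.
  rewrite andbF; apply: (not_sqf _ s2_f _ s2_size).
  have /eqP two0 : 2%:R == 0 :> F by rewrite two_Fp_eq0 p2.
  by rewrite fb'E two0 scale0r add0r expr2 mulrA dvdp_mulIl.
have SE : S = 'X - (- S`_0)%:P by apply: monic_size2; rewrite -?s2 ?size_redp_monic.
have sE : s = 'X - (rho (- S`_0))%:P by rewrite /s {1}SE rmorphB /= map_polyX map_polyC.
rewrite /=; have [sh|nsh] := boolP (coprimep s h); last first.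
  rewrite andbF; apply: (not_sqf _ s2_f _ s2_size).
  move: nsh; rewrite sE coprimep_sym coprimep_XsubC negbK -dvdp_XsubCl -sE => sh.
  by rewrite fb'E expr2 dvdp_mul // dvdp_addl ?dvdp_mulr // -mul_polyC dvdp_mull // dvdp_mull.
rewrite andbT; have ha : ~~ root h (rho (- S`_0)) by rewrite -coprimep_XsubC coprimep_sym -sE.
have sS : size S = 2%N by rewrite -s2 size_redp_monic.
have sSH : size (S ^+ 2 * H) = (size H).+2.
  by rewrite size_monicM ?monic_exp ?monic_neq0 // expr2 size_monicM ?monic_neq0 // sS.
have sH : size H = n.+1.
  have : size (redp f) = n.+3 by rewrite size_redp_monic.
  rewrite fbE size_monicM ?monic_neq0 ?monicMl ?redp_monic // s2.
  rewrite size_monicM ?monic_neq0 ?redp_monic // s2 size_redp_monic //.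
  by rewrite !addSn !add0n /=; move=> [].
(* [p R = f - S^2 H] is a difference of monics of equal degree. *)
have sR : (size R <= n.+2)%N.
  have : (size (p%:R * R)%R <= n.+2)%N.
    have -> : p%:R * R = f - S ^+ 2 * H by rewrite fE addrC addKr.
    apply/leq_sizeP => j; rewrite leq_eqVlt => /predU1P[<-|nj].
      have SHm : S ^+ 2 * H \is monic by rewrite monicMl ?monic_exp.
      move: fm SHm; rewrite !monicE !lead_coefE sSH sf sH /= coefB => /eqP -> /eqP ->.
      by rewrite subrr.
    by rewrite coefB !nth_default ?subr0 // ?sSH ?sf ?sH.
  rewrite -polyC_natr size_Cmul //; exact: padic_p_neq0.
have two0 : 2%:R != 0 :> F by rewrite two_Fp_eq0.
rewrite SE in fE.
have key := linear_disc fm sf fE Hm sH sR sep_h ha two0.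
rewrite coprimep_sym sE coprimep_XsubC.
by split=> [H0|/negP H0]; [apply/negP|]; rewrite -?key // => /key.
Qed.
End DiscriminantCriterion.

(** * The densities as weighted counts over F_p *)

Section Densities.
Local Open Scope classical_set_scope.
Variables (R : realType) (p : nat) (pr : prime p) (m : nat).
Local Notation Zp := (padic_int pr).
Local Notation F := 'F_p.
Local Notation rho := (@red p pr).
Local Notation redp := (map_poly rho).
Hypothesis m_gt0 : (0 < m)%N.

Lemma V_lastE (b : Zp) (v : 'rV[Zp]_m) :
  @V_last p pr m.+1 b v = ('X^m + row_poly v) * 'X + b%:P.
Proof.
rewrite /V_last /monic_of_coefs big_ord_recr /= mulrDl -exprSr -addrA; congr (_ + _).
rewrite /row_poly mulr_suml; congr (_ + _).
  apply: eq_bigr => i _; rewrite mxE /= insubT ?ltn_ord //= => im.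
  rewrite -scalerAl -exprSr -subSn ?ltn_ord //; congr (v 0 _ *: _).
  by apply/val_inj.
by rewrite mxE /= insubF ?ltnn //= subnn expr0 alg_polyC.
Qed.

Lemma map_row_poly (A B : comNzRingType) (g : {rmorphism A -> B}) k (v : 'rV[A]_k) :
  map_poly g (row_poly v) = row_poly (map_mx g v).
Proof.
rewrite rmorph_sum; apply: eq_bigr => i _.
by rewrite /= map_polyZ map_polyXn mxE.
Qed.

Lemma row_polyD (A : comNzRingType) k (u v : 'rV[A]_k) :
  row_poly (u + v) = row_poly u + row_poly v.
Proof. by rewrite -big_split; apply: eq_bigr => i _; rewrite mxE scalerDl. Qed.

Lemma row_polyZ (A : comNzRingType) k (c : A) (v : 'rV[A]_k) :
  row_poly (c *: v) = c%:P * row_poly v.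
Proof. by rewrite mul_polyC scaler_sumr; apply: eq_bigr => i _; rewrite mxE scalerA. Qed.

Lemma monic_row_poly (A : comNzRingType) (g : {poly A}) k :
  g \is monic -> size g = k.+2 ->
  g = ('X^k + row_poly (\row_(i < k) g`_(k - i))) * 'X + (g`_0)%:P.
Proof.
move=> gm sg; apply/polyP => -[|j]; rewrite coefD coefMX coefC /= ?add0r // addr0.
rewrite coefD coefXn; case: (ltngtP j k) => jk.
- have jk' : (k - j.+1 < k)%N by lia.
  have := coef_row_poly (\row_(i < k) g`_(k - i)) (Ordinal jk').
  rewrite mxE /= add0r.
  have -> : (k - (k - j.+1))%N = j.+1 by lia.
  by have -> : (k - (k - j.+1).+1)%N = j by lia.
- rewrite add0r !nth_default ?sg //; last exact: leq_trans (size_row_poly _) (ltnW jk).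
- rewrite jk [(row_poly _)`_k]nth_default ?size_row_poly // addr0.
  by move: gm; rewrite monicE lead_coefE sg /= => /eqP.
Qed.

Variables (b : Zp) (b_unit : b \is a GRing.unit).

Lemma red_unit_neq0 : rho b != 0.
Proof. by rewrite -padic_unitE. Qed.

Definition fiber_poly (c : 'rV[F]_m) : {poly F} := ('X^m + row_poly c) * 'X + (rho b)%:P.

Lemma fiber_poly_horner0 c : (fiber_poly c).[0] = rho b.
Proof. by rewrite hornerD hornerMX mulr0 add0r hornerC. Qed.

Lemma fiber_poly_monics c : fiber_poly c \in monics F m.+1.
Proof.
have gM : 'X^m + row_poly c \in monics F m.
  have lt : (size (row_poly c) < size ('X^m : {poly F}))%N.
    by rewrite size_polyXn ltnS size_row_poly.
  by rewrite mem_monics monicE lead_coefDl // size_polyDl // lead_coefXn size_polyXn !eqxx.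
have sX := size_mulX (monics_neq0 gM); rewrite (monics_size gM) in sX.
have lt : (size ((rho b)%:P : {poly F}) < size (('X^m + row_poly c) * 'X)%R)%N.
  by rewrite sX (leq_ltn_trans (size_polyC_leq1 _)).
rewrite mem_monics /fiber_poly monicE lead_coefDl // size_polyDl // sX eqxx andbT.
by rewrite lead_coefMX -monicE (monics_monic gM).
Qed.

Definition fiber_S c := poly_lift pr (sq_part (fiber_poly c)).
Definition fiber_H c := poly_lift pr (fiber_poly c %/ sq_part (fiber_poly c) ^+ 2).
(** The lift of [c] whose polynomial agrees with [S^2 H] in all coefficients but the constant
    one. *)
Definition fiber_lift c : 'rV[Zp]_m := \row_i (fiber_S c ^+ 2 * fiber_H c)`_(m - i).
(* The constant term of the lift [S^2 H] agrees with [b] only modulo [p]. *)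
Definition fiber_delta c : Zp :=
  xget 0 [set d | b = (fiber_S c ^+ 2 * fiber_H c)`_0 + p%:R * d].

Lemma fiber_liftP c : [/\ fiber_S c \is monic, fiber_H c \is monic,
  separable_poly (redp (fiber_H c)), map_mx rho (fiber_lift c) = c &
  forall v, @V_last p pr m.+1 b (fiber_lift c + p%:R *: v) =
     fiber_S c ^+ 2 * fiber_H c + p%:R * (row_poly v * 'X + (fiber_delta c)%:P)].
Proof.
have fM := fiber_poly_monics c; have fm := monics_monic fM.
have [h [sm hm sep_h fE]] := sq_partP fm.
have hE : fiber_poly c %/ sq_part (fiber_poly c) ^+ 2 = h.
  by rewrite {1}fE mulrC mulpK // expf_neq0 // monic_neq0.
have [Sm sS] := poly_lift_monic pr sm; have [Hm sH] := poly_lift_monic pr hm.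
rewrite -/(fiber_S c) in Sm sS; rewrite -hE -/(fiber_H c) in Hm sH.
have redG : redp (fiber_S c ^+ 2 * fiber_H c) = fiber_poly c.
  by rewrite rmorphM rmorphXn /= !poly_liftK hE -fE.
have Gm : fiber_S c ^+ 2 * fiber_H c \is monic by rewrite monicMl ?monic_exp.
have sG : size (fiber_S c ^+ 2 * fiber_H c) = m.+2.
  by rewrite -(size_redp_monic Gm) redG (monics_size fM).
have GE := monic_row_poly Gm sG.
split=> //; first by rewrite poly_liftK hE.
  have e := congr1 (fun g => map_poly rho g) GE.
  rewrite /= redG rmorphD rmorphM rmorphD /= map_polyXn map_polyX map_polyC map_row_poly in e.
  apply/rowP => i; rewrite -!coef_row_poly.
  have := congr1 (fun g : {poly F} => g`_(m - i)) e.
  rewrite /fiber_poly !coefD !coefMX !coefC !coefD /=.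
  have -> : (m - i == 0)%N = false by have := ltn_ord i; lia.
  rewrite !addr0 -subnS => /addrI ->.
  by [].
move=> v; rewrite V_lastE [in RHS]GE row_polyD row_polyZ polyC_natr.
have dE : b = (fiber_S c ^+ 2 * fiber_H c)`_0 + p%:R * fiber_delta c.
  have [|d dE] := @red_eq0 p pr (b - (fiber_S c ^+ 2 * fiber_H c)`_0).
    rewrite rmorphB /= -coef_map redG -horner_coef0 fiber_poly_horner0 subrr //.
  have ex : exists d, b = (fiber_S c ^+ 2 * fiber_H c)`_0 + p%:R * d.
    by exists d; rewrite -dE addrC subrK.
  exact: (xgetPex 0 ex).
rewrite [in LHS]dE polyCD polyCM polyC_natr; ring.
Qed.

Variables (mu : {measure set (padic_space pr m) -> \bar R}) (mu_haar : is_haar mu).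
Local Notation q := (#|F|%:R : R).

(* The residue of [R] modulo [p] when [f] is written [S ^ 2 * H + p R]. *)
Definition fiber_rem c (r : 'rV[F]_m) : {poly F} :=
  row_poly r * 'X + (rho (fiber_delta c))%:P.

Lemma V_last_digits c r w : let f := @V_last p pr m.+1 b
    (fiber_lift c + p%:R *: map_mx (@padic_lift p pr) r + p%:R ^+ 2 *: w) in
  [/\ f \is monic, size f = m.+2 &
    exists2 T, f = fiber_S c ^+ 2 * fiber_H c + p%:R * T & redp T = fiber_rem c r].
Proof.
have [Sm Hm sep_h _ fE] := fiber_liftP c.
rewrite /= -addrA expr2 -scalerA -scalerDr.
have red_V v : redp (@V_last p pr m.+1 b v) = fiber_poly (map_mx rho v).
  by rewrite V_lastE rmorphD rmorphM rmorphD /= map_polyXn map_polyX map_polyC map_row_poly.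
set v := fiber_lift c + _.
have fX : ('X^m + row_poly v) \is monic /\ size ('X^m + row_poly v) = m.+1.
  have lt : (size (row_poly v) < size ('X^m : {poly Zp}))%N.
    by rewrite size_polyXn ltnS size_row_poly.
  by rewrite monicE lead_coefDl // size_polyDl // lead_coefXn size_polyXn eqxx.
have sX : size (('X^m + row_poly v) * 'X) = m.+2.
  by rewrite size_mulX ?fX.2 // monic_neq0 // fX.1.
have lt : (size (b%:P : {poly Zp}) < size (('X^m + row_poly v) * 'X)%R)%N.
  by rewrite sX (leq_ltn_trans (size_polyC_leq1 _)).
split.
- by rewrite V_lastE monicE lead_coefDl // lead_coefMX -monicE fX.1.
- by rewrite V_lastE size_polyDl.
exists (row_poly (map_mx (@padic_lift p pr) r + p%:R *: w) * 'X + (fiber_delta c)%:P).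
  exact: fE.
rewrite rmorphD rmorphM /= map_polyX map_polyC map_row_poly map_mxD map_liftK.
rewrite /fiber_rem; congr (row_poly _ * _ + _).
apply/rowP => i; rewrite !mxE.
have z x : rho (p%:R * x) = 0 by rewrite rmorphM /= red_p mul0r.
exact: etrans (congr1 (fun t => r 0 i + t) (z (w 0 i))) (addr0 _).
Qed.

Lemma sum_fiber_rem c :
  \sum_r (coprimep (sq_part (fiber_poly c)) (fiber_rem c r))%:R =
    q ^+ m * phi_weight R (fiber_poly c).
Proof.
have fM := fiber_poly_monics c; have [sM sk] := size_sq_part fM.
set s := sq_part _ in sM sk *; set k := (size s).-1 in sM sk.
(* [deg s <= (m + 1) / 2 <= m], by [m_gt0]. *)
have km : (k <= m)%N by apply: leq_trans sk _; lia.
(* [s(0)^2 h(0)] is the reduction of the unit [b]. *)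
have s0 : s.[0] != 0.
  have [h [sm hm sep_h fE]] := sq_partP (monics_monic fM).
  have := red_unit_neq0; rewrite -(fiber_poly_horner0 c) fE hornerM horner_exp.
  by apply: contraNneq => ->; rewrite expr0n mul0r.
rewrite (sum_row_poly m (fun t => (coprimep s (t * 'X + (rho (fiber_delta c))%:P))%:R)).
rewrite (sum_coprime_translate _ _ sM s0 km) /phi_weight -/s -/k.
have q0 : q != 0 by rewrite pnatr_eq0 -lt0n; apply/card_gt0P; exists 0.
by rewrite -{2}(subnK km) exprD mulrACA mulrA mulfK ?expf_neq0 // mulrC.
Qed.

Lemma P_maxE : @P_max R p pr m.+1 mu b = phi_count R m.+1 (rho b) / q ^+ m.
Proof.
have lK c : map_mx rho (fiber_lift c) = c by have [] := fiber_liftP c.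
have QT c r w : maximal_quotient (@V_last p pr m.+1 b
    (fiber_lift c + p%:R *: map_mx (@padic_lift p pr) r + p%:R ^+ 2 *: w)) <->
    coprimep (sq_part (fiber_poly c)) (fiber_rem c r).
  have [Sm Hm sep_h _ _] := fiber_liftP c.
  have [fm fs [T fE TE]] := V_last_digits c r w.
  rewrite -TE -(poly_liftK pr (sq_part _)); apply: (maximal_quotientP fm _ sep_h fE).
  by rewrite fs.
rewrite /P_max /density_last.
rewrite (haar_count lK mu_haar (Q := [set v | maximal_quotient (@V_last p pr m.+1 b v)]) QT).
rewrite (eq_bigr _ (fun c _ => sum_fiber_rem c)) -mulr_sumr.
rewrite /phi_count /weight_sum (sum_monics_row_poly m (rho b)) card_Fp //.
have p0 : p%:R != 0 :> R by rewrite pnatr_eq0 -lt0n prime_gt0.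
by rewrite -mulf_div divff ?mul1r // expf_neq0.
Qed.

Definition sqf_weight (f : {poly F}) : bool := (sq_part f == 1) ||
  [&& p != 2%N, size (sq_part f) == 2%N & coprimep (sq_part f) (f %/ sq_part f ^+ 2)].

Lemma P_sqfE : @P_sqf R p pr m.+1 mu b =
  (\sum_(f <- monics F m.+1 | f.[0] == rho b) (sqf_weight f)%:R * phi_weight R f) / q ^+ m.
Proof.
have lK c : map_mx rho (fiber_lift c) = c by have [] := fiber_liftP c.
have QT c r w : sqf_disc (@V_last p pr m.+1 b
    (fiber_lift c + p%:R *: map_mx (@padic_lift p pr) r + p%:R ^+ 2 *: w)) <->
    coprimep (sq_part (fiber_poly c)) (fiber_rem c r) && sqf_weight (fiber_poly c).
  have [Sm Hm sep_h _ _] := fiber_liftP c.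
  have [fm fs [T fE TE]] := V_last_digits c r w.
  have fs' : size (@V_last p pr m.+1 b (fiber_lift c + p%:R *: map_mx (@padic_lift p pr) r
      + p%:R ^+ 2 *: w)) = m.-1.+3 by rewrite fs prednK.
  have := sqf_disc_criterion fm fs' Sm Hm sep_h fE.
  by rewrite TE /fiber_S /fiber_H !poly_liftK.
rewrite /P_sqf /density_last.
rewrite (haar_count lK mu_haar (Q := [set v | sqf_disc (@V_last p pr m.+1 b v)]) QT).
rewrite (eq_bigr (fun c => q ^+ m * ((sqf_weight (fiber_poly c))%:R *
    phi_weight R (fiber_poly c)))); last first.
  move=> c _; rewrite mulrCA -sum_fiber_rem mulr_sumr; apply: eq_bigr => r _.
  by rewrite -natrM mulnb andbC.
rewrite -mulr_sumr (sum_monics_row_poly m (rho b)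
  (fun f => (sqf_weight f)%:R * phi_weight R f)) card_Fp //.
have p0 : p%:R != 0 :> R by rewrite pnatr_eq0 -lt0n prime_gt0.
by rewrite -mulf_div divff ?mul1r // expf_neq0.
Qed.
End Densities.

(** * Numbers of e-th roots in a finite field *)

Section PowerRoots.
Variables (F : finFieldType) (K : realFieldType).
Local Notation q := (#|F|%:R : K).
Local Notation nr := (nroots K).
Implicit Types (b c : F).

Lemma nrootsE e b : nr e b = #|[pred c : F | c ^+ e == b]|%:R.
Proof. by rewrite /nroots -sum1_card natr_sum. Qed.

Lemma nroots_ge0 e b : 0 <= nr e b.
Proof. by rewrite nrootsE ler0n. Qed.

Lemma nroots_le e b : (0 < e)%N -> nr e b <= e%:R.
Proof.
move=> e0; rewrite nrootsE ler_nat -ltnS -(size_XnsubC b e0) cardE.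
apply: max_poly_roots; rewrite ?enum_uniq //.
  by rewrite -size_poly_eq0 size_XnsubC.
by apply/allP => c; rewrite mem_enum inE rootE !hornerE /= subr_eq0.
Qed.

Lemma nroots_eq0 e b : (forall c, c ^+ e != b) -> nr e b = 0.
Proof. by move=> bN; rewrite /nroots big1 // => c /eqP cb; case/eqP: (bN c). Qed.

Lemma nroots_ge1 e b c : c ^+ e = b -> 1 <= nr e b.
Proof.
move=> cb; rewrite nrootsE ler1n; apply/card_gt0P; exists c.
by rewrite inE cb.
Qed.

Lemma nroots_ge2 e c : c != 1 -> c ^+ e = 1 -> 2 <= nr e (1 : F).
Proof.
move=> c1 ce; rewrite nrootsE (ler_nat _ 2) (cardD1 1) (cardD1 c) !inE expr1n c1 ce.
by rewrite !eqxx.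
Qed.

(** The numbers of roots average to 1 over the nonzero elements, so an excess at 1 is paid for by a
    zero elsewhere. *)
Lemma exists_nonpower e : (0 < e)%N -> 2 <= nr e (1 : F) -> exists2 b : F, b != 0 & nr e b = 0.
Proof.
move=> e0 r1; apply: contrapT => all1.
have ge1 b : b != 0 -> 1 <= nr e b.
  move=> b0; have [[c cb]|nc] := pselect (exists c, c ^+ e = b); first exact: nroots_ge1 cb.
  case: all1; exists b => //; apply: nroots_eq0 => c.
  by apply/eqP => cb; apply: nc; exists c.
have := sum_nroots F K e0; rewrite (bigD1 1) ?oner_eq0 //= => sE.
have : \sum_(c : F | (c != 0) && (c != 1)) (1 : K) <=
    \sum_(c : F | (c != 0) && (c != 1)) nr e c.
  by apply: ler_sum => c /andP[c0 _]; apply: ge1.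
have := card_neq0 F K; rewrite (bigD1 1) ?oner_eq0 //=; lra.
Qed.

Lemma expf_card_pred c : c != 0 -> c ^+ (#|F| - 1) = 1.
Proof.
move=> c0; apply: (mulfI c0); rewrite mulr1 -exprS subn1 prednK ?expf_card //.
by apply/card_gt0P; exists 0.
Qed.

(** With [k e = 1] modulo [q - 1], the map [c -> c^k] inverts [c -> c^e]. *)
Lemma nroots_coprime e b : (0 < e)%N -> coprime e (#|F| - 1) -> b != 0 -> nr e b = 1.
Proof.
move=> e0 cop b0; set N := (#|F| - 1)%N in cop.
have [k l kl _] := egcdnP N e0; rewrite (eqP cop) in kl.
have inv c : c != 0 -> c ^+ (k * e) = c.
  by move=> c0; rewrite kl exprD mulnC exprM expf_card_pred // expr1n mul1r.
rewrite /nroots (big_pred1 (b ^+ k)) // => c /=; apply/eqP/eqP => [cb|->].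
  rewrite -cb -exprM mulnC inv //; apply: contraNneq b0 => c0.
  by rewrite -cb c0 expr0n eqn0Ngt e0.
by rewrite -exprM inv.
Qed.

End PowerRoots.

(** With [d = (q - 1) / gcd], every [c^d] is an [e]-th root of unity. If all were 1, [X^d - 1] would
    have [q - 1 > d] roots. *)
Lemma exists_unity_root (F : finFieldType) e : ~~ coprime e (#|F| - 1) ->
  exists2 c : F, c != 1 & c ^+ e = 1.
Proof.
move=> ncop; set N := (#|F| - 1)%N.
have N0 : (0 < N)%N by rewrite subn_gt0 finNzRing_gt1.
have g0 : (0 < gcdn e N)%N by rewrite gcdn_gt0 N0 orbT.
have g1 : (1 < gcdn e N)%N by rewrite ltn_neqAle eq_sym ncop g0.
pose d := (N %/ gcdn e N)%N.
have dN : (d * gcdn e N)%N = N by rewrite divnK // dvdn_gcdr.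
have d0 : (0 < d)%N by rewrite lt0n; apply: contraTneq N0 => d0; rewrite -dN d0.
have dltN : (d < N)%N by rewrite -dN ltn_Pmulr.
apply: contrapT => nex.
have all1 (c : F) : c != 0 -> c ^+ d = 1.
  move=> c0; apply: contrapT => cd; apply: nex; exists (c ^+ d); first exact/eqP.
  rewrite -exprM; have /dvdnP[k ->] : (gcdn e N %| e)%N by apply: dvdn_gcdl.
  by rewrite mulnCA dN mulnC exprM expf_card_pred // expr1n.
have : \sum_(c : F | c != 0) (1 : rat) <= nroots rat d (1 : F).
  rewrite /nroots big_mkcond [X in _ <= X]big_mkcond; apply: ler_sum => c _.
  by case: eqVneq => [->|/all1 ->]; rewrite ?eqxx //=; case: ifP.
rewrite card_neq0 leNgt => /negP[]; apply: le_lt_trans (nroots_le rat (1 : F) d0) _.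
by rewrite ltrBrDr natr1 ltr_nat; move: dltN; rewrite /N; lia.
Qed.

(** * Explicit densities and their error terms *)

Section ExplicitDensities.
Variables (F : finFieldType) (K : realFieldType).
Local Notation q := (#|F|%:R : K).
Local Notation nr := (nroots K).
Local Notation S := (@sqfree_count F K).
Implicit Types (b c : F).

Lemma poly_phi_linear s : s \in monics F 1 -> poly_phi K s = q - 1.
Proof.
move=> sM; have ss := monics_size sM.
rewrite /poly_phi ss /= -(expr1 q) -sum_polys1.
have z1 : 0 \in polys F 1 by rewrite mem_polys size_poly0.
have z1E : 1 = \sum_(t <- polys F 1) (t == 0)%:R :> K.
  rewrite (bigD1_seq 0) ?polys_uniq //= eqxx big1 ?addr0 // => t /negbTE ->.
  by [].
rewrite [in X in _ - X]z1E -sumrB big_seq [RHS]big_seq.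
apply: eq_bigr => t; rewrite mem_polys => st.
have [->|t0] := eqVneq t 0; first by rewrite coprimep0 -size_poly_eq1 ss subrr.
have /size_poly1P[c c0 ->] : size t == 1%N by rewrite eqn_leq st size_poly_gt0.
by rewrite -[c%:P]mulr1 mul_polyC coprimepZr // coprimep1 subr0.
Qed.

(** The factor [1 - q^-1] is phi(s) / |s| for a linear [s]. *)
Lemma sum_sqf_weight (odd_p : bool) n b :
  \sum_(f <- monics F n | f.[0] == b) ((sq_part f == 1) || [&& odd_p, size (sq_part f) == 2%N &
     coprimep (sq_part f) (f %/ sq_part f ^+ 2)])%:R * phi_weight K f =
  S n b + odd_p%:R * (1 - q^-1) * double_root_count K n b.
Proof.
have q0 : q != 0 by have := card_gt1 F K; lra.
rewrite /S /weight_sum /double_root_count mulr_sumr -big_split big_seq_cond.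
rewrite [RHS]big_seq_cond; apply: eq_bigr => f /andP[fM _] /=.
have fm := monics_monic fM; have [sM _] := size_sq_part fM.
rewrite separable_sq_part //; have [s1|s1] := eqVneq (sq_part f) 1.
  rewrite s1 size_poly1 /= mulr0 addr0 mul1r /phi_weight s1 size_poly1 expr0 divr1.
  rewrite -[RHS](expr0 q) -sum_polys1 /poly_phi size_poly1 /=.
  by apply: eq_bigr => t _; rewrite coprime1p.
rewrite /= add0r; case: eqVneq => [s2|_] /=; last by rewrite andbF mul0r mulr0.
rewrite s2 in sM; case: odd_p => /=; last by rewrite !mul0r.
case: coprimep; last by rewrite mul0r mulr0.
by rewrite /phi_weight s2 /= poly_phi_linear // expr1 mulrBl divff // !mul1r mulr1.
Qed.

(* The degree is [n = m + 2]. *)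
Definition sqf_limit : K := 1 - (3 * q - 1) / (q * (q + 1) ^+ 2).

(** The first line is the remainder of [sqfree_countE]; the rest is that of [double_root_sumE] at
    [e = 2]. *)
Definition sqf_error m b : K :=
  - (-1) ^+ m / (q + 1) - (~~ odd m)%:R * (nr 2 b - 1) +
  (1 - q^-1) * (- (q - 1) * (-1) ^+ m * (q / (q + 1) ^+ 2 + m%:R / (q + 1))
    - (~~ odd m)%:R * ((q - 1) * (nr 2 b - 1) * (m./2)%:R)
    + (-1) ^+ m * nr m.+2 b).

(** The main terms [q / (q + 1)] and [(1 - 1/q) (q - 1) / (q + 1)^2] add up to [sqf_limit]. *)
Lemma sqf_densityE m b : b != 0 ->
  (S m.+2 b + (1 - q^-1) * double_root_count K m.+2 b) / q ^+ m.+1 =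
  sqf_limit + sqf_error m b / q ^+ m.+1.
Proof.
move=> b0; have q1 := card_gt1 F K; have q0 : q != 0 by lra.
rewrite double_root_countE // double_root_sumE // sqfree_countE // addn2 add2n /= negbK.
rewrite /sqf_limit /sqf_error -[(-1) ^+ m]signr_odd !exprS -[(-1) ^+ m]signr_odd.
have : q ^+ m != 0 by rewrite expf_neq0.
move: (q ^+ m) (m./2%:R) (nr 2 b) (nr m.+2 b) => y h r2 r y0.
by case: (odd m) => /=; field; rewrite ?y0 ?q0 /=; lra.
Qed.
End ExplicitDensities.

(** * Bounds, positivity and dependence on b *)

Section Estimates.
Variables (F : finFieldType) (K : realFieldType).
Local Notation q := (#|F|%:R : K).
Local Notation nr := (nroots K).
Local Notation S := (@sqfree_count F K).
Implicit Types (b c : F).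

Let q_gt1 : 1 < q. Proof. exact: card_gt1. Qed.

Let t_bounds : 0 < 1 - q^-1 /\ 1 - q^-1 < 1.
Proof.
split; last by rewrite ltrBlDr ltrDl invr_gt0 (lt_trans _ q_gt1).
by rewrite subr_gt0 invf_lt1 // (lt_trans _ q_gt1).
Qed.

Lemma norm_scale_le (t x y : K) : 0 <= t -> t <= 1 -> `|x| <= y -> `|t * x| <= y.
Proof.
move=> t0 t1 xy; rewrite normrM (ger0_norm t0); apply: le_trans xy.
by rewrite ler_piMl.
Qed.

Lemma half_even_le (m : nat) : (m./2)%:R <= m%:R :> K.
Proof. by rewrite ler_nat; lia. Qed.

(** The extra factor [q] for even [m] is due to [(q - 1) (r2 - 1) (m / 2)]; the remaining terms are
    linear in [m], uniformly in [q]. *)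
Lemma sqf_error_le m b :
  `|sqf_error K m b| <= 3 * m.+2%:R * (if odd m then 1 else q).
Proof.
have q1 := q_gt1; have [t0 t1] := t_bounds; have r0 := nroots_ge0 K m.+2 b.
have r1 : nr m.+2 b <= m.+2%:R by apply: nroots_le.
have s0 := nroots_ge0 K 2 b; have s1 : nr 2 b <= 2 by apply: nroots_le.
have m0 : 0 <= m%:R :> K by apply: ler0n.
have mS : m.+2%:R = m%:R + 2 :> K by rewrite -natr1 -natr1 -addrA.
rewrite mS in r1 *.
pose A := (q - 1) * (q / (q + 1) ^+ 2 + m%:R / (q + 1)).
have iq0 : 0 < (q + 1)^-1 by rewrite invr_gt0; lra.
have qp : 0 < q + 1 by lra.
have iq1 : (q + 1)^-1 <= 1 by rewrite invf_le1 //; lra.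
have iqE : q / (q + 1) = 1 - (q + 1)^-1 by field; lra.
have A0 : 0 <= A.
  have q0 : 0 <= q by apply: ler0n.
  by rewrite mulr_ge0 ?subr_ge0 ?addr_ge0 ?divr_ge0 ?exprn_ge0 // ltW.
have A1 : A <= 1 + m%:R.
  have -> : A = (1 - 2 * (q + 1)^-1) * (1 - (q + 1)^-1 + m%:R) by rewrite /A; field; lra.
  by move: (q + 1)^-1 iq0 iq1 => z z0 z1; nra.
pose h : K := (m./2)%:R; have h0 : 0 <= h by apply: ler0n.
have h1 : h <= m%:R := half_even_le m.
rewrite /sqf_error; set r := nr m.+2 b in r0 r1 *; set r2 := nr 2 b in s0 s1 *.
set t := 1 - q^-1 in t0 t1 *; rewrite -/h -[(-1) ^+ m]signr_odd.
case: (odd m) => /=.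
  rewrite [X in `|X|](_ : _ = 1 / (q + 1) + t * (A - r)); last by rewrite /A; ring.
  have a1 : `|1 / (q + 1)| <= 1 by rewrite div1r ger0_norm // ltW.
  have B1 : `|t * (A - r)| <= m%:R + 2.
    by apply: (norm_scale_le (ltW t0) (ltW t1)); rewrite ler_norml; apply/andP; split; lra.
  rewrite (le_trans (ler_normD _ _)) //; lra.
rewrite [X in `|X|](_ : _ = (- 1 / (q + 1) - (r2 - 1)) +
  t * (- A - (q - 1) * (r2 - 1) * h + r)); last by rewrite /A; ring.
rewrite (le_trans (ler_normD _ _)) //.
have a1 : `|- 1 / (q + 1) - (r2 - 1)| <= 2.
  by rewrite mulN1r ler_norml; apply/andP; split; lra.
have qh : (q - 1) * h <= q * m%:R by nra.
have B1 : `|t * (- A - (q - 1) * (r2 - 1) * h + r)| <= q * m%:R + 2 * m%:R + 2.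
  apply: (norm_scale_le (ltW t0) (ltW t1)).
  have -> : (q - 1) * (r2 - 1) * h = (r2 - 1) * ((q - 1) * h) by ring.
  have g0 : 0 <= (q - 1) * h by rewrite mulr_ge0 //; lra.
  rewrite ler_norml; apply/andP; split; move: ((q - 1) * h) (q * m%:R) qh g0 => x y xy x0; nra.
nra.
Qed.

(** The squarefree count alone is positive once [q >= 3]. *)
Lemma sqf_density_gt0 m b : b != 0 -> 3 <= q ->
  0 < S m.+2 b + (1 - q^-1) * double_root_count K m.+2 b.
Proof.
move=> b0 q3; have [t0 _] := t_bounds.
apply: ltr_wpDr.
  by rewrite mulr_ge0 ?(ltW t0) // /double_root_count sumr_ge0 // => f _; rewrite ler0n.
have s1 : nr 2 b <= 2 by apply: nroots_le.
have qm : 1 <= q ^+ m by rewrite exprn_ege1 // ltW.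
rewrite sqfree_countE //= !exprS -[(-1) ^+ m]signr_odd.
case: (odd m) => /=.
  by rewrite expr1 mul0r subr0 divr_gt0 //.
rewrite expr0 mulr1 mulN1r opprK mul1r subr_gt0.
have q1 := q_gt1; apply: (@le_lt_trans _ _ 1); first lra.
rewrite ltr_pdivlMr; last lra.
by move: (q ^+ m) qm => y y1; nra.
Qed.

(** For odd [m] the roots of exponent [m + 2] carry the whole dependence on [b]. *)
Lemma sqf_error_diff m b c : odd m ->
  sqf_error K m b = sqf_error K m c -> nr m.+2 b = nr m.+2 c.
Proof.
have [t0 _] := t_bounds; move=> om; rewrite /sqf_error om -[(-1) ^+ m]signr_odd om /= expr1.
rewrite !mul0r !subr0 => /addrI /(mulfI (lt0r_neq0 t0)) /addrI.
by rewrite !mulN1r => /oppr_inj.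
Qed.

Lemma sqf_error_odd m b c : odd m -> nr m.+2 b = nr m.+2 c ->
  sqf_error K m b = sqf_error K m c.
Proof. by move=> om e; rewrite /sqf_error om e /= !mul0r. Qed.

(** Equality would force [nr m.+2 1 = 2 / (1 - 1/q) + (q - 1) m], which exceeds the bound [m + 2] on
    the number of roots. *)
Lemma sqf_error_even m b : ~~ odd m -> 3 <= q -> nr 2 (1 : F) = 2 ->
  nr 2 b = 0 -> nr m.+2 b = 0 -> sqf_error K m b != sqf_error K m (1 : F).
Proof.
move=> em q3 r1 r2 r3; have [t0 t1] := t_bounds.
have rm : nr m.+2 (1 : F) <= m.+2%:R by apply: nroots_le.
have mS : m.+2%:R = m%:R + 2 :> K by rewrite -natr1 -natr1 -addrA.
have mE : m%:R = 2 * (m./2)%:R :> K.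
  by rewrite -natrM mul2n -[in LHS](odd_double_half m) (negbTE em).
have m0 : 0 <= (m./2)%:R :> K by apply: ler0n.
rewrite mS mE in rm.
rewrite /sqf_error em -[(-1) ^+ m]signr_odd (negbTE em) /= expr0 r1 r2 r3.
apply/eqP => e; move: rm.
have -> : nr m.+2 (1 : F) = 2 / (1 - q^-1) + 2 * (q - 1) * (m./2)%:R.
  have tn : 1 - q^-1 != 0 by apply: lt0r_neq0.
  apply: (mulfI tn); rewrite mulrDr mulrCA divff // mulr1; lra.
have t2 : 2 < 2 / (1 - q^-1) by rewrite ltr_pdivlMr //; lra.
by move: (m./2)%:R m0 => h h0; nra.
Qed.

Definition max_error n b : K := 1 / (q ^+ 2 + q + 1) - (odd n)%:R * (nr 2 b / q ^+ 2).

Lemma max_error_le n b : `|max_error n b| <= 2 / q ^+ 2.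
Proof.
have q1 := q_gt1; have s0 := nroots_ge0 K 2 b.
have s1 : nr 2 b <= 2 by apply: nroots_le.
have q2 : 0 < q ^+ 2 by rewrite exprn_gt0 // (lt_trans _ q_gt1).
have x0 : 0 <= nr 2 b / q ^+ 2 by rewrite divr_ge0 // ltW.
have x1 : nr 2 b / q ^+ 2 <= 2 / q ^+ 2 by rewrite ler_pM2r // invr_gt0.
have y0 : 0 <= 1 / (q ^+ 2 + q + 1) by rewrite divr_ge0 //; lra.
have y1 : 1 / (q ^+ 2 + q + 1) <= 2 / q ^+ 2.
  apply: (@le_trans _ _ (1 / q ^+ 2)); last by rewrite ler_pM2r ?invr_gt0 //; lra.
  by rewrite !div1r lef_pV2 ?posrE //; lra.
rewrite /max_error; case: (odd n); rewrite ?mul1r ?mul0r ?subr0 ler_norml; apply/andP; split; lra.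
Qed.

Lemma max_scale_bounds n : 0 < (q ^- 3) ^+ n <= 1.
Proof.
have q1 := q_gt1; have q3 : 0 < q ^- 3 by rewrite invr_gt0 exprn_gt0 //; lra.
rewrite exprn_gt0 //= exprn_ile1 ?ltW // invf_lt1 ?exprn_gt0 ?exprn_egt1 //; lra.
Qed.

Lemma max_density_gt0 n b : 0 < max_limit F K + (q ^- 3) ^+ n./2 * max_error n b.
Proof.
have q1 := q_gt1; have /andP[z0 z1] := max_scale_bounds n./2.
have q2 : 4 <= q ^+ 2.
  rewrite -[4%:R]/((2 * 2)%:R) natrM -expr2 lerXn2r ?nnegrE ?ler0n // (ler_nat _ 2).
  exact: finNzRing_gt1.
have s0 := nroots_ge0 K 2 b.
have s1 : nr 2 b <= 2 by apply: nroots_le.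
have u0 : 0 < (q ^+ 2 + q + 1)^-1 by rewrite invr_gt0; lra.
have u1 : (q ^+ 2 + q + 1)^-1 < 1 by rewrite invf_lt1; lra.
have v0 : 0 < (q ^+ 2)^-1 by rewrite invr_gt0; lra.
have v1 : (q ^+ 2)^-1 <= 4^-1 by rewrite lef_pV2 ?posrE; lra.
rewrite /max_limit /max_error !div1r.
have x0 : 0 <= nr 2 b / q ^+ 2 by rewrite divr_ge0 // ltW // -invr_gt0.
have x1 : nr 2 b / q ^+ 2 <= 2^-1.
  by move: (q ^+ 2)^-1 v0 v1 => v v0 v1; nra.
move: (nr 2 b / _) x0 x1 (_^-1) u0 u1 ((q ^- 3) ^+ _) z0 z1 => x x0 x1 u u0 u1 z z0 z1.
have zu : 0 < z * u by rewrite mulr_gt0.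
(* This gives [1 - u + z u >= z], which outweighs [z x <= z / 2]. *)
have : 0 <= (1 - z) * (1 - u) by rewrite mulr_ge0 // subr_ge0 // ltW.
have : z * x <= z * 2^-1 by rewrite ler_pM2l.
by case: (odd n); rewrite ?mul1r ?mul0r; lra.
Qed.

End Estimates.

(** * Square roots in odd characteristic *)

Section SquareRoots.
Variables (F : finFieldType) (K : realFieldType).
Local Notation nr := (nroots K).
Implicit Types (b c : F).
Hypothesis two_neq0 : (2%:R : F) != 0.

Lemma nroots2_1 : nr 2 (1 : F) = 2.
Proof.
apply/eqP; rewrite eq_le nroots_le //=.
apply: (@nroots_ge2 _ _ _ (-1)); last by rewrite sqrrN expr1n.
by rewrite -subr_eq0 -opprD oppr_eq0.
Qed.

Lemma nroots2_square c : c != 0 -> nr 2 (c ^+ 2) = 2.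
Proof.
by move=> c0; rewrite -(nroots2_sqr _ _ c0) divff ?expf_neq0 // nroots2_1.
Qed.

Lemma nroots2_eq b b' : b != 0 -> b' != 0 ->
  nr 2 b = nr 2 b' <-> ((exists c, b = c ^+ 2) <-> (exists c, b' = c ^+ 2)).
Proof.
have nsq d : ~ (exists c, d = c ^+ 2) -> nr 2 d = 0.
  by move=> dN; apply: nroots_eq0 => c; apply/eqP => cd; apply: dN; exists c.
have sq d : d != 0 -> (exists c, d = c ^+ 2) -> nr 2 d = 2.
  by move=> d0 [c dc]; rewrite dc nroots2_square //; move: d0; rewrite dc expf_eq0.
have two0 : (2 : K) <> 0 by apply/eqP; rewrite pnatr_eq0.
move=> b0 b0'; have [sb|sb] := pselect (exists c, b = c ^+ 2);
  have [sb'|sb'] := pselect (exists c, b' = c ^+ 2).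
- by rewrite !sq.
- by rewrite sq // nsq //; split=> [|[/(_ sb)]].
- by rewrite nsq // sq //; split=> [/esym|[_ /(_ sb')]].
- by rewrite !nsq.
Qed.

Lemma exists_nonsquare : exists2 b : F, b != 0 & nr 2 b = 0.
Proof. by apply: exists_nonpower => //; rewrite nroots2_1. Qed.

End SquareRoots.

(** * Assembly of the densities *)

Section Main.
Variables (R : realType) (p : nat) (pr : prime p) (m : nat).
Variable mu : {measure set (padic_space pr m.+1) -> \bar R}.
Hypothesis mu_haar : is_haar mu.
Local Notation F := 'F_p.
Local Notation q := (#|F|%:R : R).
Local Notation rho := (@red p pr).
Local Notation P_sqf := (@P_sqf R p pr m.+2 mu).
Local Notation P_max := (@P_max R p pr m.+2 mu).
Implicit Types b : padic_int pr.

Lemma P_max_limitE b : b \is a GRing.unit -> P_max b =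
  max_limit F R + (q ^- 3) ^+ (m.+1)./2 * max_error R m.+1 (rho b).
Proof.
by move=> bu; rewrite (P_maxE _ bu) // phi_countE // -padic_unitE.
Qed.

Lemma P_sqf_countE b : b \is a GRing.unit -> P_sqf b =
  (@sqfree_count F R m.+2 (rho b) +
    (p != 2%N)%:R * (1 - q^-1) * double_root_count R m.+2 (rho b)) / q ^+ m.+1.
Proof. by move=> bu; rewrite (P_sqfE _ bu) // sum_sqf_weight. Qed.

Lemma P_sqf_limitE b : b \is a GRing.unit -> p != 2%N -> P_sqf b =
  sqf_limit F R + sqf_error R m (rho b) / q ^+ m.+1.
Proof.
by move=> bu p2; rewrite P_sqf_countE // p2 mul1r sqf_densityE // -padic_unitE.
Qed.

Lemma red_unit2 b : p = 2%N -> b \is a GRing.unit -> rho b = 1.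
Proof.
move=> p2; rewrite padic_unitE => b0.
have p1 : (p - 1)%N = 1%N by rewrite p2.
by have := expf_card_pred b0; rewrite card_Fp // p1.
Qed.

Lemma unit_lift (a : F) : a != 0 ->
  exists2 b, b \is a GRing.unit & rho b = a.
Proof.
by exists (padic_lift pr a); rewrite ?padic_unitE padic_liftK.
Qed.

Lemma natr_card_Fp : q = p%:R. Proof. by rewrite card_Fp. Qed.

Lemma odd_prime_neq2 : odd p = (p != 2%N).
Proof.
have [-> //|op] := even_prime pr.
by rewrite op; apply/esym; apply: contraTneq op => ->.
Qed.

Lemma q_ge3 : p != 2%N -> 3 <= q.
Proof. by move=> p2; rewrite natr_card_Fp (ler_nat _ 3); have := prime_gt1 pr; lia. Qed.

Lemma two_neq0 : p != 2%N -> (2%:R : F) != 0.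
Proof. by rewrite two_Fp_eq0. Qed.

Lemma P_sqf2E b : p = 2%N -> b \is a GRing.unit ->
  P_sqf b = 2 / 3 * (1 - (-1) ^+ m.+2 / 2 ^+ m.+2).
Proof.
move=> p2 bu; have odd_p : (p != 2%N) = false by rewrite p2.
have p1 : (p - 1)%N = 1%N by rewrite p2.
have q2 : q = 2 by rewrite natr_card_Fp p2.
rewrite P_sqf_countE // red_unit2 // odd_p mul0r mul0r addr0.
have r1 : nroots R 2 (1 : F) = 1.
  by rewrite nroots_coprime ?oner_neq0 // card_Fp // p1.
rewrite sqfree_countE ?oner_neq0 // r1 subrr mulr0 subr0 q2 [2 ^+ m.+2]exprS.
have : (2 ^+ m.+1 : R) != 0 by rewrite expf_neq0 // pnatr_eq0.
by move: (2 ^+ m.+1) => z z0; field.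
Qed.

Lemma P_sqf_le b : p != 2%N -> b \is a GRing.unit ->
  `|P_sqf b - (1 - (3 * p%:R - 1) / (p%:R * (p%:R + 1) ^+ 2))| <=
    3 * (m.+2%:R / p%:R ^+ (2 * uphalf m.+2 - 2)).
Proof.
move=> p2 bu; rewrite P_sqf_limitE // /sqf_limit -natr_card_Fp addrC addKr.
have q0 : 0 < q by rewrite natr_card_Fp ltr0n prime_gt0.
rewrite normrM normfV [`|_ ^+ _|]ger0_norm ?exprn_ge0 ?(ltW q0) //.
rewrite ler_pdivrMr ?exprn_gt0 //; apply: le_trans (sqf_error_le _ _ _) _.
(* The parity of the exponent [2 * uphalf n - 2] absorbs the factor [q] lost for even [m]. *)
have -> : q ^+ m.+1 = q ^+ (~~ odd m) * q ^+ (2 * uphalf m.+2 - 2).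
  by rewrite -exprD; congr (_ ^+ _); rewrite /=; lia.
have : q ^+ (2 * uphalf m.+2 - 2) != 0 by rewrite expf_neq0 ?lt0r_neq0.
move: (q ^+ (_ - _)) => y y0; rewrite [leRHS](_ : _ = 3 * m.+2%:R * q ^+ (~~ odd m)).
  by case: (odd m).
by field.
Qed.

Lemma P_max_le b : b \is a GRing.unit ->
  `|P_max b - (1 - 1 / (p%:R ^+ 2 + p%:R + 1))| <=
    2 * (1 / p%:R ^+ (3 * uphalf m.+2 - 1)).
Proof.
move=> bu; rewrite P_max_limitE // /max_limit -natr_card_Fp addrC addKr.
have q0 : 0 < q by rewrite natr_card_Fp ltr0n prime_gt0.
have /andP[z0 _] := max_scale_bounds F R (m.+1)./2.
rewrite normrM gtr0_norm // -[uphalf m.+2]/((m.+1)./2.+1).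
apply: le_trans (ler_wpM2l (ltW z0) (max_error_le _ _ _)) _.
(* The 2 in the exponent is the [q^2] of [max_error_le]. *)
rewrite (_ : (3 * _ - 1 = 3 * (m.+1)./2 + 2)%N); last lia.
by rewrite exprVn exprD exprM mulrCA div1r [in leRHS]invfM.
Qed.

Lemma P_sqf_gt0 b : b \is a GRing.unit -> 0 < P_sqf b.
Proof.
move=> bu; have [p2|p2] := eqVneq p 2%N.
  rewrite P_sqf2E // mulr_gt0 ?divr_gt0 // subr_gt0 ltr_pdivrMr ?exprn_gt0 // mul1r.
  apply: (@le_lt_trans _ _ 1); last by rewrite exprn_egt1 // ltr1n.
  by apply: le_trans (ler_norm _) _; rewrite normrX normrN1 expr1n.
rewrite P_sqf_countE // p2 mul1r divr_gt0 ?exprn_gt0 //.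
  by rewrite sqf_density_gt0 ?q_ge3 // -padic_unitE.
by rewrite natr_card_Fp ltr0n prime_gt0.
Qed.

Lemma P_max_gt0 b : b \is a GRing.unit -> 0 < P_max b.
Proof. by move=> bu; rewrite P_max_limitE // max_density_gt0. Qed.

Lemma P_max_eq b b' : b \is a GRing.unit -> b' \is a GRing.unit ->
  P_max b = P_max b' <->
  (odd m.+1 -> nroots R 2 (rho b) = nroots R 2 (rho b')).
Proof.
move=> bu bu'; rewrite !P_max_limitE // /max_error.
have /andP[z0 _] := max_scale_bounds F R (m.+1)./2.
have q2 : q ^- 2 != 0 by rewrite invr_eq0 expf_neq0 // natr_card_Fp pnatr_eq0 -lt0n prime_gt0.
case: (odd m.+1); last by rewrite !mul0r.
rewrite !mul1r; split=> [/addrI|-> //].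
by move=> /(mulfI (lt0r_neq0 z0)) /addrI /oppr_inj /(mulIf q2).
Qed.

Lemma square_mod_pE b : square_mod_p b <-> exists c, rho b = c ^+ 2.
Proof.
split=> [[c /padic_dvd_red]|[c bc]].
  by rewrite rmorphB rmorphXn => /subr0_eq; exists (rho c).
exists (padic_lift pr c); apply/padic_dvd_red.
by rewrite rmorphB rmorphXn /= padic_liftK bc subrr.
Qed.

Lemma P_sqf_eq b b' : p != 2%N -> b \is a GRing.unit -> b' \is a GRing.unit ->
  P_sqf b = P_sqf b' <-> sqf_error R m (rho b) = sqf_error R m (rho b').
Proof.
move=> p2 bu bu'; rewrite !P_sqf_limitE //; split=> [/addrI|-> //].
by apply: mulIf; rewrite invr_eq0 expf_neq0 // natr_card_Fp pnatr_eq0 -lt0n prime_gt0.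
Qed.

(** For [p = 2] all units reduce to 1. For odd [p] a gcd of 1 forces [n] odd and makes [n]-th roots
    unique. Otherwise 1 is separated from an element without [n]-th roots if [n] is odd, and from a
    nonsquare if [n] is even. *)
Lemma P_sqf_indep : (forall b b', b \is a GRing.unit -> b' \is a GRing.unit ->
    P_sqf b = P_sqf b') <-> gcdn m.+2 (p - 1)%N = 1%N.
Proof.
have [p2|p2] := eqVneq p 2%N.
  have p1 : (p - 1)%N = 1%N by rewrite p2.
  rewrite p1 gcdn1; split=> // _ b b' bu bu'.
  by rewrite !P_sqf2E.
have even_p1 : ~~ odd (p - 1) by rewrite -odd_prime_neq2 in p2; lia.
have F2 := two_neq0 p2; split=> [all_eq|cop b b' bu bu'].
  apply/eqP/negPn/negP => ncop; have [c c1 cn] : exists2 c : F, c != 1 & c ^+ m.+2 = 1.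
    by apply: (@exists_unity_root F); rewrite card_Fp.
  have r1 : 2 <= nroots R m.+2 (1 : F) := nroots_ge2 R c1 cn.
  have eq1 (a : F) : a != 0 -> sqf_error R m a = sqf_error R m (1 : F).
    move=> a0; have [b bu <-] := unit_lift a0; have [b' bu' <-] := unit_lift (oner_neq0 F).
    by apply/P_sqf_eq => //; apply: all_eq.
  case: (boolP (odd m)) => om.
    have [a a0 ra] := exists_nonpower (ltn0Sn _) r1.
    by have := sqf_error_diff om (eq1 a a0); rewrite ra => r0; move: r1; rewrite -r0; lra.
  have [a a0 ra] := exists_nonsquare R F2.
  have := sqf_error_even om (q_ge3 p2) (nroots2_1 R F2) ra.
  rewrite eq1 // eqxx => /(_ _)/negP; apply=> //.
  (* For even [n] an [n]-th power is a square. *)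
  apply: nroots_eq0 => d; apply/eqP => da.
  have : 1 <= nroots R 2 a.
    apply: (@nroots_ge1 _ _ _ _ (d ^+ (m.+2)./2)); rewrite -exprM -da; congr (_ ^+ _).
    lia.
  by rewrite ra ler10.
have om : odd m.
  apply/negPn/negP => em.
  have : (2 %| gcdn m.+2 (p - 1))%N by rewrite dvdn_gcd !dvdn2 /= negbK em.
  by rewrite cop.
apply/P_sqf_eq => //; apply: sqf_error_odd => //.
have cop' : coprime m.+2 (#|F| - 1) by rewrite card_Fp // /coprime cop.
by rewrite !nroots_coprime // -padic_unitE.
Qed.

End Main.

Theorem theorem1p4 (R : realType) :
  exists C_sqf C_max : R,
  forall (p : nat) (pr : prime p) (n : nat) (n_ge2 : (2 <= n)%N)
    (mu : {measure set (padic_space pr n.-1) -> \bar R})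
    (mu_haar : is_haar mu),
  [/\ forall b : padic_int pr, b \is a GRing.unit ->
        [/\ p = 2%N ->
              P_sqf mu b = 2 / 3 * (1 - (-1) ^+ n / 2 ^+ n),
            p <> 2%N ->
              `|P_sqf mu b - (1 - (3 * p%:R - 1) / (p%:R * (p%:R + 1) ^+ 2))|
                <= C_sqf * (n%:R / p%:R ^+ (2 * uphalf n - 2)),
            `|P_max mu b - (1 - 1 / (p%:R ^+ 2 + p%:R + 1))|
                <= C_max * (1 / p%:R ^+ (3 * uphalf n - 1)),
            0 < P_sqf mu b
          & 0 < P_max mu b],
      (forall b b' : padic_int pr,
          b \is a GRing.unit -> b' \is a GRing.unit ->
          P_sqf mu b = P_sqf mu b') <-> gcdn n (p - 1)%N = 1%N,
      odd p && ~~ odd n ->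
        forall b b' : padic_int pr,
          b \is a GRing.unit -> b' \is a GRing.unit ->
          (P_max mu b = P_max mu b' <-> (square_mod_p b <-> square_mod_p b'))
    & ~~ (odd p && ~~ odd n) ->
        forall b b' : padic_int pr,
          b \is a GRing.unit -> b' \is a GRing.unit ->
          P_max mu b = P_max mu b'].
Proof.
(* The constants are those of [sqf_error_le] and [max_error_le]. *)
exists 3, 2 => p pr [|[|m]] // _ mu mu_haar; split.
- move=> b bu; split.
  + by move=> p2; apply: P_sqf2E.
  + by move=> /eqP p2; apply: P_sqf_le.
  + exact: P_max_le.
  + exact: P_sqf_gt0.
  + exact: P_max_gt0.
- exact: P_sqf_indep.
- move=> /andP[op en] b b' bu bu'.
  have p2 : (2%:R : 'F_p) != 0 by rewrite two_Fp_eq0 // -odd_prime_neq2.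
  rewrite P_max_eq // !square_mod_pE -(nroots2_eq R) -?padic_unitE //.
  by split=> [->|]; rewrite // negbK in en *.
- move=> h b b' bu bu'; apply/P_max_eq => // om.
  (* For odd [n] the density does not see [b]; in even degree [h] leaves only [p = 2], where every
     unit reduces to 1. *)
  have p2 : p = 2%N.
    apply/eqP; move: h; rewrite odd_prime_neq2 // -[odd m.+2]/(~~ odd m.+1).
    by rewrite negbK om andbT negbK.
  by rewrite !red_unit2.
Qed.
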